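(* Let $(X_t,J_t)$ be a spectrally negative Markov additive process with background state space $\{1,\ldots,d\}$, with all $\mathbb{E}X_1^{(i)}$ and $\mathbb{E}\,U_{ij}$ finite, satisfying the stability condition $$\sum_{i=1}^d\pi_i\Phi_i'(0)+\sum_{i=1}^d\sum_{j\neq i}\pi_i q_{ij}\,\mathbb{E}\,U_{ij}<0,$$ and let $(Q_t)_{t\geqslant 0}$ be the associated stationary workload process. Suppose that there are complex numbers $\zeta_{ij}$ and $\eta_j$, $i,j\in\{1,\ldots,d\}$, with $\mathrm{Re}\,\eta_j>0$, such that $$\mathbb{P}(Q_0\in\mathrm{d}x,\,J_0=i)=\sum_{j=1}^d\zeta_{ij}\,e^{-\eta_j x}\,\mathrm{d}x\qquad\text{for } x>0,\ i\in\{1,\ldots,d\}.$$ Let $\vartheta>0$, let $T$ be exponentially distributed with mean $\vartheta^{-1}$, independent of everything else, and put $\gamma(\vartheta):=\mathrm{Cov}(Q_0,Q_T)$. Then $$\gamma(\vartheta)=\kappa''(0)-(\kappa'(0))^2+\sum_{i=1}^d\sum_{j=1}^d\frac{\zeta_{ij}}{\eta_j^2}\Big(\bar\Omega_i(0,\vartheta)-\bar\Omega_i(\eta_j,\vartheta)+\eta_j\,\bar\Omega_i'(\eta_j,\vartheta)\Big)-\sum_{i=1}^d\nu_i(\vartheta)\,\kappa_i'(0).$$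
   Context: Markov additive process: $(J_t)$ is an irreducible continuous-time Markov chain on $\{1,\ldots,d\}$ with transition rate matrix $(q_{ij})$ and stationary distribution $\boldsymbol\pi=(\pi_1,\ldots,\pi_d)$. For each $i$, $X^{(i)}$ is a Lévy process; while $J_t=i$, $X_t$ evolves with the increments of $X^{(i)}$, and when $J$ jumps from $i$ to $j\ne i$, $X$ makes an additional jump distributed as $U_{ij}$ (all Lévy processes, jumps, and $J$ being independent, jumps for the same $(i,j)$ being i.i.d.); $X_0=0$. Spectrally negative: all $X^{(i)}$ have only downward jumps, with cumulant generating function $\Phi_i(\beta)=\log\mathbb{E}\,e^{\beta X_1^{(i)}}$, and $U_{ij}\leqslant 0$ almost surely; $\Phi_i'(0)$ is the right derivative at $0$. Workload: $Q_t=X_t+\max\{Q_0,-\inf_{0\leqslant u\leqslant t}X_u\}$ for $t\geqslant 0$, where $(Q_0,J_0)$ has the stationary distribution of the Markov process $(Q_t,J_t)$ and, given $J_0$, $Q_0$ is independent of $(X_t,J_t)_{t\geqslant 0}$. Notation: $\mathbb{E}_i(\cdot)=\mathbb{E}(\cdot\mid J_0=i)$; $\tau(y)=\inf\{t\geqslant 0:X_t\leqslant -y\}$ (with $e^{-\vartheta\cdot\infty}=0$); $\nu_i(\vartheta)=\mathbb{E}_iX_T$; $\kappa(\alpha)=\mathbb{E}\,e^{-\alpha Q_0}$; $\kappa_i(\alpha)=\mathbb{E}(e^{-\alpha Q_0}1_{\{J_0=i\}})$; derivatives at $0$ are one-sided. For $\mathrm{Re}\,\eta\geqslant 0$, $$\bar\Omega_i(\eta,\vartheta)=\int_0^\infty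 e^{-\eta y}\,\mathbb{E}_i\,e^{-\vartheta\tau(y)}\,\mathrm{d}y,$$ which for $\eta\neq 0$ equals $\eta^{-1}\big(1-\mathbb{E}_i\,e^{\eta\underline X_T}\big)$ with $\underline X_T=\inf_{0\leqslant s\leqslant T}X_s$; $\bar\Omega_i'$ denotes the derivative with respect to $\eta$. *)

(* Defs.v *)
From HB Require Import structures.
From mathcomp Require Export all_boot all_order all_algebra.
From mathcomp Require Export all_classical all_reals all_analysis.
From mathcomp Require Export complex.

Set Implicit Arguments.
Unset Strict Implicit.
Unset Printing Implicit Defensive.

Export Order.TTheory GRing.Theory Num.Theory.
Export numFieldNormedType.Exports.

#[global] Open Scope classical_set_scope.
#[global] Open Scope complex_scope.
#[global] Open Scope ring_scope.

Section Calculus.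
Context {R : realType}.

(* Derivative relative to the half-line [0, +oo[: two-sided at [x > 0], right
   derivative at [x = 0].  Iterating it gives the second derivative at 0 of a
   function that is only defined on [0, +oo[. *)
Definition deriv_ge0 (f : R -> R) (x : R) : R :=
  lim ((f y - f x) / (y - x) @[y --> within [set y | 0 <= y /\ y != x] (nbhs x)]).

Definition cexp (z : R[i]) : R[i] :=
  (expR (complex.Re z) * cos (complex.Im z)) +i*
  (expR (complex.Re z) * sin (complex.Im z)).

Definition cintegral (D : set R) (f : R -> R[i]) : R[i] :=
  (\int[lebesgue_measure]_(x in D) complex.Re (f x)) +i*
  (\int[lebesgue_measure]_(x in D) complex.Im (f x)).

End Calculus.

Section Independence.
Context {R : realType} {disp : measure_display} {Omega : measurableType disp}.
Variable P : probability Omega R.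

Definition indep_classes (F G : set (set Omega)) : Prop :=
  forall A B, F A -> G B -> P (A `&` B) = (P A * P B)%E.

Definition mutual_indep (I : eqType) (D : set I) (F : I -> set (set Omega)) : Prop :=
  forall (s : seq I) (E : I -> set Omega), uniq s ->
    (forall k, k \in s -> D k) -> (forall k, k \in s -> F k (E k)) ->
    fine (P (\big[setI/setT]_(k <- s) E k)) = \prod_(k <- s) fine (P (E k)).

End Independence.

Section Events.
Context {R : realType} {Omega : Type}.

Definition rv_events (Y : Omega -> R) : set (set Omega) :=
  [set A | exists2 B : set R, measurable B & A = Y @^-1` B].

Definition process_events (D : set R) (Y : R -> Omega -> R) : set (set Omega) :=
  \bigcup_(t in D) rv_events (Y t).

Definition chain_events (d : nat) (J : R -> Omega -> 'I_d) : set (set Omega) :=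
  [set A | exists t i, 0 <= t /\ A = [set w | J t w = i]].

End Events.

Section MarkovChain.
Context {R : realType} {d : nat}.
Implicit Types q : 'M[R]_d.

Definition rate_matrix q : Prop :=
  (forall i j, i != j -> 0 <= q i j) /\ (forall i, \sum_j q i j = 0).

Definition irreducible_rates q : Prop :=
  forall i j, connect (fun k l => (k != l) && (0 < q k l)) i j.

Definition stationary_distr q (pi : 'rV[R]_d) : Prop :=
  [/\ forall i, 0 <= pi ord0 i, \sum_i pi ord0 i = 1 & pi *m q = 0].

(* The matrix exponential e^{tq}. *)
Definition transition q (t : R) : 'M[R]_d :=
  \matrix_(i, j) limn (series (fun k => t ^+ k / k`!%:R * (q ^+ k) i j)).

Context {disp : measure_display} {Omega : measurableType disp}.
Variable P : probability Omega R.

Record markov_chain q (J : R -> Omega -> 'I_d) : Prop := MarkovChain {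
  chain_measurable : forall (t : R) i, 0 <= t -> measurable [set w | J t w = i];
  chain_rcont : forall w (t : R), 0 <= t -> \forall s \near t^'+, J s w = J t w;
  chain_llim : forall w (t : R), 0 < t -> exists j, \forall s \near t^'-, J s w = j;
  chain_fdd : forall (n : nat) (t : nat -> R) (i : nat -> 'I_d),
    t 0%N = 0 -> (forall k, t k <= t k.+1) ->
    P (\big[setI/setT]_(k < n.+1) [set w | J (t k) w = i k]) =
    (P [set w | J 0%R w = i 0%N] *
     (\prod_(k < n) transition q (t k.+1 - t k) (i k) (i k.+1))%R%:E)%E }.

End MarkovChain.

Section MAP.
Context {R : realType} {disp : measure_display} {Omega : measurableType disp}.
Variable P : probability Omega R.

Record levy_process (L : R -> {RV P >-> R}) : Prop := LevyProcess {
  levy_0 : forall w, L 0 w = 0;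
  levy_rcont : forall w (t : R), 0 <= t -> L s w @[s --> t^'+] --> L t w;
  levy_llim : forall w (t : R), 0 < t -> cvg (L s w @[s --> t^'-]);
  levy_indep : forall s t : R, 0 <= s -> s <= t ->
    indep_classes P <<s process_events `[0, s] L >>
                    (rv_events (fun w => L t w - L s w));
  levy_stat : forall (s t : R) (B : set R), 0 <= s -> s <= t -> measurable B ->
    P [set w | B (L t w - L s w)] = P [set w | B (L (t - s) w)] }.

Variable d : nat.

(* The n-th epoch of change of J; it is +oo if J has fewer than n changes. *)
Fixpoint jump_time (J : R -> Omega -> 'I_d) (w : Omega) (n : nat) : \bar R :=
  if n is m.+1 then
    let s := jump_time J w m in
    ereal_inf [set t%:E | t in [set t | (s <= t%:E)%E /\ J t w != J (fine s) w]]
  else 0%:E.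

Section Path.
Variables (L : 'I_d -> R -> Omega -> R) (U : 'I_d -> 'I_d -> nat -> Omega -> R).
Variable J : R -> Omega -> 'I_d.

(* Value of the additive component at the n-th change of J.  The family
   (U i j n)_n is i.i.d. and independent of J, so using U i j n at the (n+1)-st
   change of J (if that is from i to j), rather than at the (n+1)-st change from
   i to j, does not affect the law. *)
Fixpoint epoch_value (w : Omega) (n : nat) : R :=
  if n is m.+1 then
    let s := fine (jump_time J w m) in
    let t := fine (jump_time J w m.+1) in
    epoch_value w m + (L (J s w) t w - L (J s w) s w) + U (J s w) (J t w) m w
  else 0.

Definition map_path (X : R -> Omega -> R) : Prop :=
  forall (w : Omega) (t : R) (n : nat),
    (jump_time J w n <= t%:E)%E -> (t%:E < jump_time J w n.+1)%E ->
    let s := fine (jump_time J w n) in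
    X t w = epoch_value w n + (L (J s w) t w - L (J s w) s w).

End Path.

Variables (q : 'M[R]_d).
Variables (L : 'I_d -> R -> {RV P >-> R}) (U : 'I_d -> 'I_d -> nat -> {RV P >-> R}).
Variables (J : R -> Omega -> 'I_d) (X : R -> {RV P >-> R}).

(* The independent sources of randomness: [inl (inl i)] is the i-th Levy process,
   [inl (inr (i, j, n))] the jump U i j n, and [inr tt] the chain J. *)
Definition source := ('I_d + 'I_d * 'I_d * nat + unit)%type.

Definition source_events (k : source) : set (set Omega) :=
  match k with
  | inl (inl i) => <<s process_events [set t | 0 <= t] (L i) >>
  | inl (inr (i, j, n)) => <<s rv_events (U i j n) >>
  | inr _ => <<s chain_events J >>
  end.

(* U i i n plays no role and is left unconstrained. *)
Definition genuine_source : set source :=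
  [set k | if k is inl (inr (i, j, _)) then i != j else true].

Record markov_additive : Prop := MarkovAdditive {
  map_rates : rate_matrix q;
  map_irred : irreducible_rates q;
  map_chain : markov_chain P q J;
  map_levy : forall i, levy_process (L i);
  map_jump_law : forall i j n (B : set R), i != j -> measurable B ->
    distribution P (U i j n) B = distribution P (U i j 0%N) B;
  map_indep : mutual_indep P genuine_source source_events;
  map_eq : map_path L U J X }.

Definition spectrally_negative : Prop :=
  (forall i, {ae P, forall w, forall t : R, 0 < t ->
     L i t w <= lim (L i s w @[s --> t^'-])}) /\
  (forall i j n, i != j -> {ae P, forall w, U i j n w <= 0}).

Definition finite_means : Prop :=
  (forall i, P.-integrable setT (EFin \o L i 1)) /\
  (forall i j n, i != j -> P.-integrable setT (EFin \o U i j n)).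

Definition cumulant (i : 'I_d) (b : R) : R := ln (fine ('M_P (L i 1) b)).

Definition mean_drift (pi : 'rV[R]_d) : R :=
  \sum_i pi ord0 i * deriv_ge0 (cumulant i) 0 +
  \sum_i \sum_(j | j != i) pi ord0 i * q i j * fine ('E_P[U i j 0%N]).

End MAP.

Section Workload.
Context {R : realType} {disp : measure_display} {Omega : measurableType disp}.
Variable P : probability Omega R.
Variables (d : nat) (J : R -> Omega -> 'I_d) (X : R -> {RV P >-> R}).
Variable Q0 : {RV P >-> R}.

Definition running_inf (t : R) (w : Omega) : R := inf [set X u w | u in `[0, t]].

Definition workload (t : R) (w : Omega) : R :=
  X t w + Num.max (Q0 w) (- running_inf t w).

Definition map_events : set (set Omega) :=
  process_events [set t | 0 <= t] X `|` chain_events J.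

Record stationary_workload : Prop := StationaryWorkload {
  workload_ge0 : {ae P, forall w, 0 <= Q0 w};
  workload_stat : forall (t : R) i (B : set R), 0 <= t -> measurable B ->
    P [set w | B (workload t w) /\ J t w = i] = P [set w | B (Q0 w) /\ J 0 w = i];
  workload_cindep : forall i (B : set R) (A : set Omega),
    measurable B -> <<s map_events >> A ->
    let Ji := [set w | J 0 w = i] in
    (P ((Q0 @^-1` B `&` A) `&` Ji) * P Ji =
     P (Q0 @^-1` B `&` Ji) * P (A `&` Ji))%E }.

Definition exponential_clock (theta : R) (T : {RV P >-> R}) : Prop :=
  [/\ forall w, 0 <= T w,
      forall B, measurable B -> distribution P T B = exponential_prob theta B &
      indep_classes P (rv_events T) <<s rv_events Q0 `|` map_events >>].

Definition cond_mean (i : 'I_d) (f : Omega -> R) : R :=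
  (\int[P]_(w in [set w | J 0 w = i]) f w) / fine (P [set w | J 0 w = i]).

Definition hitting_time (y : R) (w : Omega) : \bar R :=
  ereal_inf [set t%:E | t in [set t | 0 <= t /\ X t w <= - y]].

Definition hitting_lst (i : 'I_d) (theta y : R) : R :=
  cond_mean i (fun w => fine (expeR (- (theta%:E * hitting_time y w))%E)).

Definition Omega_bar (theta : R) (i : 'I_d) (eta : R[i]) : R[i] :=
  cintegral `[0, +oo[ (fun y => cexp (- (eta * y%:C)) * (hitting_lst i theta y)%:C).

(* Complex derivative with respect to eta. *)
Definition Omega_bar' (theta : R) (i : 'I_d) (eta : R[i]) : R[i] :=
  derive1 (Omega_bar theta i : R[i] -> R[i]^o) eta.

Definition nu (T : {RV P >-> R}) (i : 'I_d) : R :=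
  cond_mean i (fun w => X (T w) w).

Definition kappa (a : R) : R := fine 'E_P[fun w => expR (- a * Q0 w)].

Definition kappa_at (i : 'I_d) (a : R) : R :=
  \int[P]_(w in [set w | J 0 w = i]) expR (- a * Q0 w).

End Workload.

(* Main.v *)
From HB Require Import structures.
Require Import Defs.
From mathcomp Require Import measurable_realfun.
From mathcomp Require Import ring lra.

(** Put Q = max (Q0, 0), which is Q0 almost surely, and let I be minus the
running infimum of X at the clock T; I >= 0 because X starts at 0.  The
reflection formula for the workload at T becomes

  Q_T = X_T + Q + (I - Q)^+            [clock_workload_split]

and by stationarity Q_T has the law of Q0.  Hence, once all terms are
integrable,

  Cov (Q0, Q_T) = E (Q X_T) + E Q^2 + E (Q (I - Q)^+) - (E Q)^2.

The second and the last term are kappa''(0) and kappa'(0)^2, by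
differentiation under the expectation.  Given J_0 = i the variable Q is
independent of the paths and of the clock [cond_indep]; so the part of
E (Q X_T) on that event is E (Q; J_0 = i) nu_i = - kappa_i'(0) nu_i.

The heart of the matter is the third term.  Writing (I - Q)^+ as the integral
over y >= 0 of 1{Q <= y} 1{y < I} and using the same conditional independence,

  E (Q (I - Q)^+; J_0 = i)
    = \int_0^oo E (Q 1{Q <= y}; J_0 = i) P_i (y < I) dy   [excess_integral].

The infimum of X before T is below -y when X hits -y before T, up to the case
of equality, and T exceeds tau(y) with probability e^{- theta tau(y)} given the
path; so P_i (y < I) <= E_i e^{- theta tau(y)} <= P_i (y <= I).  The layer
cake formula holds with either of the two outer probabilities, so the integral
with E_i e^{- theta tau(y)} in their place has the same value and no exceptional
set of levels has to be discussed.  The truncated mean comes from the density: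

  E (Q 1{Q <= y}; J_0 = i)
    = \sum_j zeta_ij (1 - (1 + eta_j y) e^{- eta_j y}) / eta_j^2
                                                 [mixture_truncated_mean],

and integrating the three parts of this kernel against E_i e^{- theta tau(y)}
gives Omega_i(0), - Omega_i(eta_j) and eta_j Omega_i'(eta_j)
[laplace_combination].

The analysis behind this is the finiteness of E |X_T|.  It follows from
E |X_t| = O (t^2) [map_abs_mean], where |X_t| is dominated, in the limit of
finer and finer grids, by variables built from the number of changes of J, the
oscillations of the Levy processes (integrable by Ottaviani's inequality) and
the additional jumps; these three are independent, so the means of products
factor.  The other moments come for free: Q has all moments by its density,
Q_T has the law of Q0, and I <= Q_T - X_T. *)

Set Implicit Arguments.
Unset Strict Implicit.
Unset Printing Implicit Defensive.

Local Notation Re := complex.Re.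
Local Notation Im := complex.Im.

(** * Integrals of functions of independent variables *)

(** Library results on distributions ask for a bundled measurable function. *)
Lemma exists_mfun d1 d2 (T1 : measurableType d1) (T2 : measurableType d2)
    (f : T1 -> T2) :
  measurable_fun setT f -> exists f' : {mfun T1 >-> T2}, f' = f :> (T1 -> T2).
Proof.
move=> mf; pose f' : {mfun T1 >-> T2} := HB.pack f (isMeasurableFun.Build _ _ _ _ _ mf).
by exists f'.
Qed.

Section IndepIntegrals.
Context {R : realType} {d0 : measure_display} {T0 : measurableType d0}.
Local Open Scope ereal_scope.

Lemma ge0_integral_mrestr (m : {measure set T0 -> \bar R}) (A : set T0)
    (mA : measurable A) (f : T0 -> \bar R) :
  measurable_fun setT f -> (forall x, 0 <= f x) ->
  \int[mrestr m mA]_w f w = \int[m]_(w in A) f w.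
Proof.
move=> mf f0; have mfA : forall B, measurable_fun B f by move=> B; exact: measurable_funTS.
rewrite -(setUv A) ge0_integral_setU//=; last 2 first.
- exact: measurableC.
- exact/disj_setPCl.
rewrite [X in _ + X](_ : _ = 0) ?adde0; last first.
  rewrite (eq_measure_integral mzero) ?integral_measure_zero// => B mB BA.
  have BA0 : B `&` A = set0 by rewrite disjoints_subset.
  by rewrite /= /mrestr BA0 measure0.
by apply: eq_measure_integral => B mB BA; rewrite /= /mrestr; congr (m _); apply/setIidPl.
Qed.

(** Under independence the joint law of f and g is the product of their laws,
so Tonelli applies; it is stated on the sample space in order to be used with
path-valued f and g. *)
Lemma indep_tonelli (P : probability T0 R) d1 d2 (T1 : measurableType d1)
    (T2 : measurableType d2) (f : T0 -> T1) (g : T0 -> T2) (F : T1 * T2 -> \bar R) :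
  measurable_fun setT f -> measurable_fun setT g ->
  (forall A B, measurable A -> measurable B ->
     P (f @^-1` A `&` g @^-1` B) = P (f @^-1` A) * P (g @^-1` B)) ->
  measurable_fun setT F -> (forall z, 0 <= F z) ->
  \int[P]_w F (f w, g w) = \int[P]_v \int[P]_w F (f w, g v).
Proof.
move=> mf mg H mF F0.
have mfg : measurable_fun setT (fun w => (f w, g w)) by exact: measurable_fun_pair.
transitivity (\int[pushforward P (fun w => (f w, g w))]_z F z).
  by rewrite ge0_integral_pushforward.
have [f' f'E] : exists f' : {mfun T0 >-> T1}, f' = f :> (T0 -> T1).
  exact: exists_mfun.
have [g' g'E] : exists g' : {mfun T0 >-> T2}, g' = g :> (T0 -> T2).
  exact: exists_mfun.
rewrite (eq_measure_integral (distribution P f' \x distribution P g')); last first.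
  move=> A mA _; apply/esym.
  apply: (@product_measure_unique _ _ _ _ _ (distribution P f') (distribution P g')
    (pushforward P (fun w => (f w, g w)))) => // B C mB mC.
  change (P (f @^-1` B `&` g @^-1` C) = P (f' @^-1` B) * P (g' @^-1` C)).
  rewrite f'E g'E.
  exact: H.
rewrite fubini_tonelli2//.
rewrite ge0_integral_distribution//=; last first.
- by move=> y; exact: integral_ge0.
- exact: measurable_fun_fubini_tonelli_G.
rewrite -g'E; apply: eq_integral => y _ /=; rewrite -f'E /fubini_G/=.
rewrite (@ge0_integral_distribution _ _ _ _ _ _ f' (fun x => F (x, g' y)))//.
exact: measurableT_comp.
Qed.

End IndepIntegrals.

(** * Changes of the background chain *)

Section Cadlag.
Context {R : realType}.

(** One-sided limits bound f near each point, and the segment is compact. *)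
Lemma cadlag_bounded (f : R -> R) (K : R) :
  (forall t : R, 0 <= t -> f s @[s --> t^'+] --> f t) ->
  (forall t : R, 0 < t -> cvg (f s @[s --> t^'-])) ->
  exists2 M : R, 0 <= M & forall s : R, 0 <= s <= K -> `|f s| <= M.
Proof.
move=> frc fll.
have := @segment_compact R 0 K; rewrite compact_near_coveringP => cov.
have {cov} : \forall M \near +oo, `[0, K] `<=` [set s | 0 <= s -> `|f s| <= M].
  apply: cov => x; rewrite /= in_itv/= => /andP[x0 xK].
  have [e1 /= e10 He1] : \forall s \near x^'+, `|f s| <= `|f x| + 1.
    have /cvgrPdist_le /(_ 1 ltr01) := frc _ x0; apply: filterS => s /= Hs.
    by have := ler_normB (f x) (f x - f s); rewrite opprB addrCA subrr addr0; lra.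
  have [e2 [M2 [e20 He2]]] : exists e2 M2 : R, 0 < e2 /\
      forall y : R, 0 <= y -> x - e2 < y < x -> `|f y| <= M2.
    move: x0; rewrite le_eqVlt => /predU1P[x0|x0].
      by exists 1, 0; split=> // y y0 /andP[_]; rewrite -x0 ltNge y0.
    have /cvg_ex[/= l Hl] := fll _ x0.
    have [e2 /= e20 He2] : \forall s \near x^'-, `|f s| <= `|l| + 1.
      have /cvgrPdist_le /(_ 1 ltr01) := Hl; apply: filterS => s /= Hs.
      by have := ler_normB l (l - f s); rewrite opprB addrCA subrr addr0; lra.
    exists e2, (`|l| + 1); split => // y _ /andP[y1 y2]; apply: He2 => //=.
    by rewrite gtr0_norm; lra.
  exists ([set y | `|x - y| < Num.min e1 e2], [set M | `|f x| + 1 + `|M2| < M]).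
    split => /=; last by exists (`|f x| + 1 + `|M2|); split => //; rewrite num_real.
    by exists (Num.min e1 e2) => //=; rewrite lt_min e10.
  move=> [y M] [/= + HM] y0; rewrite lt_min => /andP[h1 h2].
  have M20 := normr_ge0 M2; have M2M := ler_norm M2; have fx0 := normr_ge0 (f x).
  have [yx|xy|->] := ltgtP y x; last by lra.
    suff : `|f y| <= M2 by lra.
    by apply: He2 => //; rewrite yx andbT; move: h2; rewrite gtr0_norm; lra.
  by have := He1 y h1 xy; lra.
move=> [M0 [_ HM]]; exists (`|M0| + 1) => //.
move=> s s0K; apply: (HM (`|M0| + 1)) => /=.
- by have := ler_norm M0; lra.
- by rewrite in_itv.
- by case/andP: s0K.
Qed.

End Cadlag.

Section JumpTimes.
Context {R : realType} {disp : measure_display} {Omega : measurableType disp}.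
Context {d : nat}.
Variables (J : R -> Omega -> 'I_d) (w : Omega).
Hypothesis J_rcont : forall t : R, 0 <= t -> \forall s \near t^'+, J s w = J t w.
Hypothesis J_llim : forall t : R, 0 < t -> exists j, \forall s \near t^'-, J s w = j.
Local Notation S := (jump_time J w).
Local Open Scope ereal_scope.

Lemma jump_timeS_ge n : S n <= S n.+1.
Proof. by apply: le_ereal_inf_tmp => /= _ [t [Ht _] <-]. Qed.

Lemma jump_time_ge0 n : 0 <= S n.
Proof.
by elim: n => [|n IH]//; apply: le_trans IH (jump_timeS_ge n).
Qed.

Lemma jump_time_le m n : (m <= n)%N -> S m <= S n.
Proof.
move=> mn; rewrite -(subnK mn); elim: (n - m)%N => [|k IH]//.
by rewrite addSn; apply: le_trans IH (jump_timeS_ge _).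
Qed.

Lemma jump_time_fin n t : S n <= t%:E -> S n = (fine (S n))%:E.
Proof.
move=> h; rewrite fineK// ge0_fin_numE ?jump_time_ge0//.
by apply: le_lt_trans h _; rewrite ltry.
Qed.

Lemma J_const n t : S n <= t%:E -> t%:E < S n.+1 -> J t w = J (fine (S n)) w.
Proof.
move=> h1 h2; apply: contrapT => /eqP ne.
by move: h2; rewrite ltNge => /negP; apply; apply: ereal_inf_lbound; exists t.
Qed.

Lemma jump_timeS_gt n t : S n <= t%:E -> S n < S n.+1.
Proof.
move=> h; have E := jump_time_fin h; set s := fine (S n) in E.
have s0 : (0 <= s)%R by rewrite -lee_fin -E jump_time_ge0.
have [e /= e0 He] := J_rcont s0.
apply: (@lt_le_trans _ _ (s + e)%:E); first by rewrite E lte_fin ltrDl.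
apply: le_ereal_inf_tmp => /= _ [u [Hu ne] <-]; rewrite lee_fin leNgt.
apply/negP => ue; move: Hu; rewrite E lee_fin le_eqVlt => /predU1P[su|su].
  by move: ne; rewrite -/s su eqxx.
by move: ne; rewrite -/s He ?eqxx//= ltr0_norm; lra.
Qed.

Lemma J_jump n t : S n.+1 <= t%:E -> J (fine (S n.+1)) w != J (fine (S n)) w.
Proof.
move=> h; have E := jump_time_fin h; set s := fine (S n.+1) in E *.
have hn : S n <= t%:E by apply: le_trans h; exact: jump_timeS_ge.
have s0 : (0 <= s)%R by rewrite -lee_fin -E jump_time_ge0.
apply/eqP => JE; have [e /= e0 He] := J_rcont s0.
have : S n.+1 < (s + e)%:E by rewrite E lte_fin ltrDl.
rewrite ltNge => /negP; apply.
apply: le_ereal_inf_tmp => /= _ [u [Hu ne] <-]; rewrite lee_fin leNgt.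
apply/negP => ue; move: ne; apply/negP; rewrite negbK.
have [us|su|su] := ltgtP u s.
- by apply/eqP/J_const => //; rewrite E lte_fin.
- by rewrite He ?JE//= ltr0_norm; lra.
- by rewrite su JE.
Qed.

(** Jump times accumulating at u would make J jump in every left neighbourhood
of u, against the left limit of J at u. *)
Lemma nonexplosion t : (0 <= t)%R -> exists n, S n <= t%:E /\ t%:E < S n.+1.
Proof.
move=> t0; apply: contrapT => /forallNP H.
have Hle n : S n <= t%:E.
  elim: n => [|n IH]; first by rewrite lee_fin.
  by rewrite leNgt; apply/negP => h; apply: (H n).
have E n := jump_time_fin (Hle n).
pose s n := fine (S n).
have sS n : (s n < s n.+1)%R.
  by rewrite -lte_fin -/(s _) /s -!E; exact: jump_timeS_gt (Hle n).
have hs : has_sup (range s).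
  split; first by exists (s 0%N), 0%N.
  by exists t => _ [n _ <-]; rewrite -lee_fin -E.
pose u := sup (range s).
have su n : (s n < u)%R.
  by apply: lt_le_trans (sS n) _; apply: ub_le_sup; [exact: hs.2|exists n.+1].
have u0 : (0 < u)%R by apply: le_lt_trans (su 0%N); rewrite /s.
have [j [e /= e0 He]] := J_llim u0.
have [_ [n _ <-] Hn] := sup_adherent e0 hs.
have JE v : (s n <= v < u)%R -> J v w = j.
  by move=> /andP[v1 v2]; apply: He => //=; rewrite -/u in Hn; rewrite gtr0_norm; lra.
have : J (s n.+1) w = J (s n) w.
  by rewrite !JE ?su ?(ltW (sS n))// lexx.
by apply/eqP; rewrite /s; exact: J_jump (Hle n.+1).
Qed.

Lemma grid_point_near (s x : R) : (0 <= s)%R -> (s < x)%R ->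
  \forall m \near \oo, exists k : nat, (s < k%:R / m.+1%:R < x)%R.
Proof.
move=> s0 sx; have xs0 : (0 < x - s)%R by rewrite subr_gt0.
exists (Num.truncn (x - s)^-1) => // m /= Hm.
have m0 : (0 < m.+1%:R :> R)%R by rewrite ltr0n.
exists (Num.truncn (s * m.+1%:R)).+1.
have ms0 : (0 <= s * m.+1%:R)%R by rewrite mulr_ge0.
rewrite ltr_pdivlMr// ltr_pdivrMr// truncnS_gt/=.
have h1 : ((Num.truncn (s * m.+1%:R))%:R <= s * m.+1%:R)%R by by rewrite truncn_le.
have h2 : ((x - s)^-1 < m.+1%:R)%R.
  by apply: lt_le_trans (truncnS_gt _) _; rewrite ler_nat ltnS.
have h3 : (1 < (x - s) * m.+1%:R)%R.
  by rewrite mulrC -ltr_pdivrMr// div1r.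
by rewrite -natr1; lra.
Qed.

(** Unlike the number of jump times before K, this depends on J at finitely
many fixed times, so its mean is controlled by the transition matrices. *)
Definition grid_changes (K m : nat) : nat :=
  \sum_(k < K * m.+1) (J (k%:R / m.+1%:R) w != J (k.+1%:R / m.+1%:R) w).

Lemma change_between (g : nat -> 'I_d) (k k' : nat) : (k <= k')%N -> g k != g k' ->
  (0 < \sum_(k <= l < k') (g l != g l.+1))%N.
Proof.
move=> kk' ne; rewrite lt0n; apply/negP => /eqP h0.
suff E l : (k <= l <= k')%N -> g l = g k.
  by move: ne; rewrite (E k') ?eqxx// kk' leqnn.
elim: l => [|l IH]; first by rewrite leqn0 => /andP[/eqP-> _].
move=> /andP[kl lk']; move: kl; rewrite leq_eqVlt => /predU1P[->//|kl].
rewrite -IH; last by rewrite -ltnS kl ltnW.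
apply/esym/eqP; apply: contraT => h.
suff : (0 < \sum_(k <= i < k') (g i != g i.+1))%N by rewrite h0.
rewrite (@big_cat_nat _ _ _ l)//=; last by rewrite ltnW.
by rewrite addn_gt0 (@big_ltn _ _ _ l)// h addn_gt0 orbT.
Qed.

(** A fine grid has a point between any two consecutive jump times, and J takes
different values on both sides of a jump. *)
Lemma grid_changes_ge (K n : nat) : S n < K%:R%:E ->
  \forall m \near \oo, (n <= grid_changes K m)%N.
Proof.
move=> Hn.
(* For the induction: the changes are counted up to some grid point between the
n-th jump time and the next. *)
suff : \forall m \near \oo, exists2 k, (k <= K * m.+1)%N &
    [/\ (S n <= (k%:R / m.+1%:R)%:E), (k%:R / m.+1%:R)%:E < S n.+1 &
    (n <= \sum_(0 <= l < k) (J (l%:R / m.+1%:R) w != J (l.+1%:R / m.+1%:R) w))%N].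
  apply: filterS => m [k kK [_ _ h]].
  rewrite /grid_changes -(big_mkord predT
    (fun l => nat_of_bool (J (l%:R / m.+1%:R) w != J (l.+1%:R / m.+1%:R) w))).
  by rewrite (@big_cat_nat _ _ _ k)//=; exact: leq_trans h (leq_addr _ _).
elim: n Hn => [|n IH] Hn.
  near=> m; exists 0%N => //; rewrite mul0r; split => //.
  exact: (@jump_timeS_gt 0 0).
have HnK : S n < K%:R%:E by apply: le_lt_trans Hn; exact: jump_timeS_ge.
have E := jump_time_fin (ltW Hn); set s := fine (S n.+1) in E.
have s0 : (0 <= s)%R by rewrite -lee_fin -E jump_time_ge0.
have [x sx [xK xS]] : exists2 x, (s < x)%R & x%:E <= K%:R%:E /\ x%:E <= S n.+2.
  have := jump_timeS_gt (ltW Hn); rewrite E => h.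
  move: Hn; rewrite E lte_fin => Hn.
  case: (S n.+2) h => [r| |] //=.
    rewrite lte_fin => h; exists (Num.min K%:R r); first by rewrite lt_min Hn.
    by rewrite !lee_fin !ge_min !lexx orbT.
  by move=> _; exists K%:R => //; rewrite leey.
have /= Hg := grid_point_near s0 sx.
near=> m.
have [k kK [h1 h2 h3]] : exists2 k, (k <= K * m.+1)%N &
    [/\ (S n <= (k%:R / m.+1%:R)%:E), (k%:R / m.+1%:R)%:E < S n.+1 &
    (n <= \sum_(0 <= l < k) (J (l%:R / m.+1%:R) w != J (l.+1%:R / m.+1%:R) w))%N].
  by near: m; exact: IH.
have [k' /andP[k1 k2]] : exists k : nat, (s < k%:R / m.+1%:R < x)%R by near: m.
have m0 : (0 < m.+1%:R :> R)%R by rewrite ltr0n.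
have kk' : (k < k')%N.
  move: h2; rewrite E lte_fin => h2.
  by have := lt_trans h2 k1; rewrite ltr_pM2r ?invr_gt0// ltr_nat.
have g1 : S n.+1 <= (k'%:R / m.+1%:R)%:E by rewrite E lee_fin ltW.
have g2 : (k'%:R / m.+1%:R)%:E < S n.+2 by apply: lt_le_trans xS; rewrite lte_fin.
exists k'; last split => //.
  move: xK; rewrite lee_fin => xK; have := lt_le_trans k2 xK.
  by rewrite ltr_pdivrMr// -natrM ltr_nat => /ltnW.
rewrite (@big_cat_nat _ _ _ k)//=; last exact: ltnW.
rewrite -addn1 leq_add//.
apply: (@change_between (fun l => J (l%:R / m.+1%:R) w)); first exact: ltnW.
by rewrite (J_const h1 h2) (J_const g1 g2) eq_sym; exact: J_jump g1.
Unshelve. all: by end_near. Qed.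

End JumpTimes.

(** * Paths of the additive process and their running infimum *)

Section RunningInf.
Context {R : realType}.
Variable f : R -> R.
Hypothesis f_rcont : forall t : R, 0 <= t -> f s @[s --> t^'+] --> f t.
Hypothesis f_bnd : forall t : R, exists M : R, forall s : R, 0 <= s <= t -> `|f s| <= M.

(** The running infimum and the hitting time of the workload, for one path:
stated for a function of time, their properties need no probability. *)
Definition path_inf (t : R) : R := inf [set f u | u in `[0, t]].

Lemma path_has_inf (t : R) : 0 <= t -> has_inf [set f u | u in `[0, t]].
Proof.
move=> t0; split; first by exists (f 0), 0; rewrite //= in_itv/= lexx.
have [M HM] := f_bnd t; exists (- M) => _ [s + <-]; rewrite /= in_itv/= => /HM.
by rewrite ler_norml => /andP[].
Qed.

Lemma path_inf_ge (t y : R) : 0 <= t -> path_inf t < y <-> exists2 s : R, 0 <= s <= t & f s < y.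
Proof.
move=> t0; split.
  have h := path_has_inf t0; move=> ty.
  have [_ [s + <-] sy] := inf_adherent (eps := y - path_inf t) (ltac:(by rewrite subr_gt0)) h.
  rewrite /= in_itv/= => s0t; exists s => //; move: sy; rewrite -/(path_inf t).
  by rewrite addrCA subrr addr0.
move=> [s s0t sy]; apply: le_lt_trans sy; apply: ge_inf; first exact: (path_has_inf t0).2.
by exists s => //=; rewrite in_itv.
Qed.

Lemma path_inf_le (t s : R) : 0 <= s <= t -> path_inf t <= f s.
Proof.
move=> h; have t0 : 0 <= t by case/andP: h => /le_trans; apply.
apply: ge_inf; first exact: (path_has_inf t0).2.
by exists s => //=; rewrite in_itv.
Qed.

Definition path_hit (y : R) : \bar R :=
  ereal_inf [set t%:E | t in [set t | 0 <= t /\ f t <= - y]].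

Lemma path_hit_le (t y : R) : 0 <= t -> y < - path_inf t -> (path_hit y <= t%:E)%E.
Proof.
rewrite ltrNr => t0 /path_inf_ge => /(_ t0)[s /andP[s0 st] sy].
apply: (@le_trans _ _ s%:E); last by rewrite lee_fin.
by apply: ereal_inf_lbound; exists s => //=; split => //; exact: ltW.
Qed.

(** This direction needs right-continuity: the hitting time is an infimum of
times, and right-continuity makes the path be at most -y up to any error at
that infimum. *)
Lemma path_hit_ge (t y : R) : 0 <= t -> (path_hit y <= t%:E)%E -> y <= - path_inf t.
Proof.
move=> t0 Ht; rewrite lerNr; apply/ler_addgt0Pr => e e0.
have /cvgrPdist_lt/(_ _ e0) [d /= d0 Hd] := f_rcont t0.
have : (path_hit y < (t + d)%:E)%E by apply: le_lt_trans Ht _; rewrite lte_fin ltrDl.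
move=> /ereal_inf_lt[_ [s [s0 sy] <-]]; rewrite lte_fin => std.
have [st|ts] := leP s t.
  have := path_inf_le (ltac:(by rewrite s0) : 0 <= s <= t); lra.
have := Hd s; rewrite /= ltr0_norm ?subr_lt0// => /(_ _ ts) h.
have {h} : `|f t - f s| < e by apply: h; lra.
have := path_inf_le (ltac:(by rewrite t0 lexx) : 0 <= t <= t).
rewrite ltr_norml => ? /andP[]; lra.
Qed.

(** By right-continuity the infimum is determined by countably many times,
which makes it measurable; rational multiples of t, with t itself among them,
serve all t at once. *)
Lemma path_inf_rat (t y : R) : 0 <= t ->
  path_inf t < y <-> exists2 q : rat, 0 <= q <= 1 & f (ratr q * t) < y.
Proof.
move=> t0; rewrite path_inf_ge//; split; last first.
  move=> [q /andP[q0 q1] h]; exists (ratr q * t) => //.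
  have q0' : 0 <= ratr q :> R by rewrite ler0q.
  have q1' : ratr q <= 1 :> R by rewrite -(rmorph1 (@ratr R)) ler_rat.
  by rewrite mulr_ge0//= ler_piMl.
move=> [s /andP[s0 st] sy].
move: st; rewrite le_eqVlt => /predU1P[st|st].
  by exists 1; rewrite ?lexx ?ler01// rmorph1 mul1r -st.
have tp : 0 < t by lra.
have ys0 : 0 < y - f s by rewrite subr_gt0.
have /cvgrPdist_lt/(_ _ ys0) [d /= d0 Hd] := f_rcont s0.
have [q] := rat_in_itvoo (ltac:(rewrite ltr_pM2r ?invr_gt0//; rewrite lt_min; apply/andP; split; [exact: st|rewrite ltrDl; exact: d0]) : s / t < Num.min t (s + d) / t).
rewrite in_itv/= ltr_pdivrMr// ltr_pdivlMr// lt_min => /andP[q1 /andP[q2 q3]].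
have q0 : 0 <= ratr q :> R.
  by rewrite -(pmulr_lge0 _ tp); lra.
exists q.
  rewrite -(ler0q R) q0/= -(ler_rat R) rmorph1.
  by rewrite -(ler_pM2r tp) mul1r ltW.
have h : `|f s - f (ratr q * t)| < y - f s.
  by apply: Hd => //=; rewrite ltr0_norm; lra.
by have := ler_norm (f (ratr q * t) - f s); rewrite distrC; lra.
Qed.

End RunningInf.

Section MapPath.
Context {R : realType} {disp : measure_display} {Omega : measurableType disp}.
Context {d : nat}.
Variables (L : 'I_d -> R -> Omega -> R) (U : 'I_d -> 'I_d -> nat -> Omega -> R).
Variables (J : R -> Omega -> 'I_d) (X : R -> Omega -> R) (w : Omega).
Hypothesis J_rcont : forall t : R, 0 <= t -> \forall s \near t^'+, J s w = J t w.
Hypothesis J_llim : forall t : R, 0 < t -> exists j, \forall s \near t^'-, J s w = j.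
Hypothesis L_rcont : forall i (t : R), 0 <= t -> L i s w @[s --> t^'+] --> L i t w.
Hypothesis L_llim : forall i (t : R), 0 < t -> cvg (L i s w @[s --> t^'-]).
Hypothesis X_map : map_path L U J X.
Local Notation S := (jump_time J w).

(** The jump that occurs at the n-th change depends on J; summing over all
pairs gives a majorant that is independent of J. *)
Definition jump_size (n : nat) (w : Omega) : R :=
  \sum_i \sum_(j | j != i) `|U i j n w|.

Lemma jump_size_ge0 n : 0 <= jump_size n w.
Proof. by apply: sumr_ge0 => i _; apply: sumr_ge0. Qed.

Lemma jump_size_ge n i j : i != j -> `|U i j n w| <= jump_size n w.
Proof.
move=> ij; rewrite /jump_size (bigD1 i)//= (bigD1 j)/= 1?eq_sym//.
rewrite -addrA lerDl addr_ge0//; first by apply: sumr_ge0.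
by apply: sumr_ge0 => k _; apply: sumr_ge0.
Qed.

Lemma epoch_value_bound (n : nat) (t v : R) : (S n <= t%:E)%E ->
  (forall i p, (p <= n)%N -> `|L i (fine (S p)) w| <= v) ->
  `|epoch_value L U J w n| <= n%:R * (2 * v) + \sum_(p < n) jump_size p w.
Proof.
elim: n => [|n IH] St Hv; first by rewrite mul0r big_ord0 addr0 /= normr0.
have Sn : (S n <= t%:E)%E by apply: le_trans St; exact: jump_timeS_ge.
have {}IH := IH Sn (fun i p pn => Hv i p (leqW pn)).
rewrite big_ord_recr -natr1 mulrDl mul1r.
set e := epoch_value _ _ _ _ n in IH.
rewrite [epoch_value _ _ _ _ _]/= -/e.
have jne : J (fine (S n)) w != J (fine (S n.+1)) w.
  by rewrite eq_sym; exact: J_jump St.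
have := jump_size_ge n jne.
have := Hv (J (fine (S n)) w) n (leqnSn n).
have := Hv (J (fine (S n)) w) n.+1 (leqnn _).
rewrite !ler_norml; move: IH; rewrite !ler_norml => /andP[? ?] /andP[? ?] /andP[? ?] /andP[? ?].
by apply/andP; split; rewrite /=; lra.
Qed.

(** Up to time t the path consists of at most n+1 increments of Levy processes,
each at most 2 v, and n jumps. *)
Lemma map_path_bound (n : nat) (t v : R) : (S n <= t%:E)%E -> (t%:E < S n.+1)%E ->
  (forall i p, (p <= n)%N -> `|L i (fine (S p)) w| <= v) ->
  (forall i, `|L i t w| <= v) ->
  `|X t w| <= n.+1%:R * (2 * v) + \sum_(p < n) jump_size p w.
Proof.
move=> h1 h2 Hv Ht; rewrite (X_map h1 h2).
have := epoch_value_bound h1 Hv.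
have := Hv (J (fine (S n)) w) n (leqnn _); have := Ht (J (fine (S n)) w).
rewrite !ler_norml => /andP[? ?] /andP[? ?] /andP[? ?].
by rewrite -natr1 mulrDl mul1r; apply/andP; split; lra.
Qed.

(** Just after t no jump time occurs, so X moves like a single Levy process. *)
Lemma map_path_rcont (t : R) : 0 <= t -> X s w @[s --> t^'+] --> X t w.
Proof.
move=> t0; have [n [h1 h2]] := nonexplosion J_rcont J_llim t0.
rewrite (X_map h1 h2); set i := J _ w; set s0 := fine _; set e := epoch_value _ _ _ _ _.
have H : L i s w @[s --> t^'+] --> L i t w := L_rcont t0.
have {}H : e + (L i s w - L i s0 w) @[s --> t^'+] --> e + (L i t w - L i s0 w).
  by apply: cvgD; [exact: cvg_cst|apply: cvgB => //; exact: cvg_cst].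
apply: cvg_trans H; apply: near_eq_cvg.
have [x tx xS] : exists2 x : R, t < x & (x%:E <= S n.+1)%E.
  case: (S n.+1) h2 => [r| |]//=; first by rewrite lte_fin => tr; exists r.
  by move=> _; exists (t + 1); rewrite ?ltrDl// leey.
near=> s; have ts : t < s by [].
have sx : s < x by near: s; exact: nbhs_right_lt.
rewrite (X_map (n := n))//; first by apply: le_trans h1 _; rewrite lee_fin ltW.
by apply: lt_le_trans xS; rewrite lte_fin.
Unshelve. all: by end_near. Qed.

Lemma map_path_bounded (t : R) : exists M : R, forall s : R, 0 <= s <= t -> `|X s w| <= M.
Proof.
have [t0|t0] := leP 0 t; last first.
  by exists 0 => s /andP[s0 st]; have := le_trans s0 st; rewrite leNgt t0.
have [n [h1 h2]] := nonexplosion J_rcont J_llim t0.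
have HM i := cadlag_bounded t (fun u => @L_rcont i u) (fun u => @L_llim i u).
pose v i : R := sval (cid2 (HM i)).
have v0 i : 0 <= v i by rewrite /v; case: cid2.
have Hv i s : 0 <= s <= t -> `|L i s w| <= v i by rewrite /v; case: cid2 => //= M _; exact.
pose V := \sum_i v i.
have HV i s : 0 <= s <= t -> `|L i s w| <= V.
  move=> /Hv/le_trans; apply; rewrite /V (bigD1 i)//= lerDl; exact: sumr_ge0.
exists (n.+1%:R * (2 * V) + \sum_(p < n) jump_size p w) => s /andP[s0 st].
have [k [k1 k2]] := nonexplosion J_rcont J_llim s0.
have kn : (k <= n)%N.
  rewrite leqNgt; apply/negP => nk; have := jump_time_le J w nk.
  apply/negP; rewrite -ltNge; apply: le_lt_trans h2; apply: le_trans k1 _.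
  by rewrite lee_fin.
have V0 : 0 <= V by exact: sumr_ge0.
apply: (@le_trans _ _ (k.+1%:R * (2 * V) + \sum_(p < k) jump_size p w)).
  apply: map_path_bound => // [i p pk|i]; last by apply: HV; rewrite s0.
  have h : (S p <= s%:E)%E by apply: le_trans k1; exact: jump_time_le pk.
  have E := jump_time_fin h; apply: HV.
  by rewrite -!lee_fin -E jump_time_ge0/= (le_trans h)// lee_fin.
apply: lerD; first by rewrite ler_wpM2r ?mulr_ge0// ler_nat.
rewrite -!(big_mkord predT (fun p => jump_size p w)) (@big_cat_nat _ _ _ k _ n)//=.
rewrite lerDl; apply: sumr_ge0 => p _; exact: jump_size_ge0.
Qed.

Lemma map_path_0 : X 0 w = 0.
Proof.
have h : (0%:E < S 1)%E by exact: (@jump_timeS_gt _ _ _ _ _ _ J_rcont 0 0).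
by rewrite (X_map (n := 0))//= subrr addr0.
Qed.

End MapPath.

(** * Joint measurability in time and path *)

Section Selection.
Context {d1 d2} {T1 : measurableType d1} {T2 : measurableType d2}.

Lemma measurable_nat_fun (N : T1 -> nat) :
  (forall k, measurable (N @^-1` [set k])) -> measurable_fun setT N.
Proof.
move=> H _ Y _; rewrite setTI.
have -> : N @^-1` Y = \bigcup_(k in Y) (N @^-1` [set k]).
  apply/seteqP; split => [x Yx|x [k Yk NxE]]; first by exists (N x).
  by rewrite /preimage/= NxE.
by apply: bigcup_measurable => k _; exact: H.
Qed.

Lemma measurable_select (N : T1 -> nat) (F : nat -> T1 -> T2) :
  measurable_fun setT N -> (forall k, measurable_fun setT (F k)) ->
  measurable_fun setT (fun x => F (N x) x).
Proof.
move=> mN mF _ Y mY; rewrite setTI.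
have -> : (fun x => F (N x) x) @^-1` Y = \bigcup_k (N @^-1` [set k] `&` F k @^-1` Y).
  apply/seteqP; split => [x Yx|x [k _ [NxE]]]; first by exists (N x).
  by rewrite /preimage/= NxE.
apply: bigcupT_measurable => k; apply: measurableI.
  by rewrite -[X in measurable X]setTI; exact: mN.
by rewrite -[X in measurable X]setTI; exact: mF.
Qed.

End Selection.

Section JointMeasurability.
Context {R : realType} {d1} {T1 : measurableType d1}.
Variable X : R -> T1 -> R.
Hypothesis mX : forall t, 0 <= t -> measurable_fun setT (X t).
Hypothesis X_rcont : forall w (t : R), 0 <= t -> X s w @[s --> t^'+] --> X t w.

Lemma measurable_truncn (c : R) : 0 <= c ->
  measurable_fun [set: R] (fun t : R => Num.truncn (`|t| * c)).
Proof.
move=> c0; apply: measurable_nat_fun => k.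
have -> : (fun t : R => Num.truncn (`|t| * c)) @^-1` [set k] =
    [set: R] `&` (fun t : R => `|t| * c) @^-1` `[k%:R, k.+1%:R[.
  apply/seteqP; split => t /=; rewrite in_itv/=.
    by move=> <-; split => //; apply: truncn_itv; rewrite mulr_ge0.
  by case=> _ /truncn_def.
have : measurable_fun [set: R] (fun t : R => `|t| * c).
  by apply: measurable_funM => //; exact: normr_measurable.
by apply; [exact: measurableT|exact: measurable_itv].
Qed.

Lemma right_grid_cvg (t : R) : 0 <= t ->
  ((Num.truncn (t * m.+1%:R)).+1%:R / m.+1%:R : R) @[m --> \oo] --> t^'+.
Proof.
move=> t0 A [e /= e0 HA].
exists (Num.truncn e^-1) => // m /= Hm; apply: HA.
  have m0 : 0 < m.+1%:R :> R by rewrite ltr0n.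
  have h1 : t < (Num.truncn (t * m.+1%:R)).+1%:R / m.+1%:R.
    by rewrite ltr_pdivlMr// truncnS_gt.
  rewrite /= ltr0_norm ?subr_lt0// opprB ltrBlDl ltr_pdivrMr// -natr1.
  have h2 : (Num.truncn (t * m.+1%:R))%:R <= t * m.+1%:R by rewrite truncn_le mulr_ge0.
  have h3 : e^-1 < m.+1%:R.
    by apply: lt_le_trans (truncnS_gt _) _; rewrite ler_nat ltnS.
  have : 1 < e * m.+1%:R by rewrite mulrC -ltr_pdivrMr// div1r.
  lra.
by rewrite ltr_pdivlMr ?ltr0n// truncnS_gt.
Qed.

(** By right-continuity X is the limit of its values at the next point of a
grid, which are measurable as countable selections. The absolute value extends
the time to the line, as X is constrained at nonnegative times only. *)
Lemma joint_measurable : measurable_fun setT (fun z : R * T1 => X `|z.1| z.2).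
Proof.
apply: (@measurable_fun_cvg _ _ _ _ (fun m (z : R * T1) =>
    X ((Num.truncn (`|z.1| * m.+1%:R)).+1%:R / m.+1%:R) z.2)); last first.
  move=> z _.
  apply: (@cvg_comp _ _ _ (fun m => (Num.truncn (`|z.1| * m.+1%:R)).+1%:R / m.+1%:R : R)
    (fun s => X s z.2) _ (`|z.1|^'+)); last exact: X_rcont.
  exact: right_grid_cvg.
move=> m; apply: (@measurable_select _ _ _ _ (fun z : R * T1 => Num.truncn (`|z.1| * m.+1%:R))
   (fun k z => X (k.+1%:R / m.+1%:R) z.2)).
  exact: (measurableT_comp (measurable_truncn (ler0n R m.+1)) measurable_fst).
move=> k; apply: (measurableT_comp _ measurable_snd).
by apply: mX; rewrite divr_ge0.
Qed.

Hypothesis X_bnd : forall w (t : R), exists M : R,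
  forall s : R, 0 <= s <= t -> `|X s w| <= M.

Lemma path_inf_measurable :
  measurable_fun setT (fun z : R * T1 => path_inf (X^~ z.2) `|z.1|).
Proof.
apply: (measurability _ (RGenInftyO.measurableE R)) => _ [_ [y ->] <-].
have -> : setT `&` (fun z : R * T1 => path_inf (X^~ z.2) `|z.1|) @^-1` `]-oo, y[%classic =
   \bigcup_(q : rat) (if 0 <= q <= 1 then
     setT `&` (fun z : R * T1 => X `|ratr q * z.1| z.2) @^-1` `]-oo, y[%classic else set0).
  apply/seteqP; split => [z /= [_]|z [q _]].
    rewrite in_itv/= => /(path_inf_rat (@X_rcont z.2) (@X_bnd z.2) _ (normr_ge0 _))[q q01 h].
    exists q => //; rewrite q01/=; split => //.
    by rewrite in_itv/= normrM [`|ratr q|]ger0_norm// ler0q; case/andP: q01.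
  case: ifPn => // q01 [_]; rewrite /= !in_itv/= => h; split => //.
  apply/(path_inf_rat (@X_rcont z.2) (@X_bnd z.2) _ (normr_ge0 _)); exists q => //.
  by move: h; rewrite normrM [`|ratr q|]ger0_norm// ler0q; case/andP: q01.
apply: bigcupT_measurable_rat => q; case: ifP => // _.
suff h : measurable_fun setT (fun z : R * T1 => X `|ratr q * z.1| z.2).
  by apply: h => //; exact: measurable_itv.
have : measurable_fun setT (fun z : R * T1 => (ratr q * z.1, z.2)).
  apply: measurable_fun_pair => //; apply: measurable_funM => //.
exact: (measurableT_comp joint_measurable).
Qed.

End JointMeasurability.

Section LowerIntegral.
Context {R : realType} {d1} {T1 : measurableType d1} (mu : {measure set T1 -> \bar R}).
Local Open Scope ereal_scope.

(** The integral of a nonnegative function is a supremum over the simple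
functions below it, hence monotone without measurability. This dispenses with
the measurability of hitting times. *)
Lemma ge0_le_integralN (D : set T1) (f g : T1 -> \bar R) :
  (forall x, D x -> 0 <= f x) -> (forall x, D x -> f x <= g x) ->
  \int[mu]_(x in D) f x <= \int[mu]_(x in D) g x.
Proof.
move=> f0 fg; have g0 x : D x -> 0 <= g x by move=> Dx; apply: le_trans (f0 _ Dx) (fg _ Dx).
rewrite !ge0_integralE//; apply: ereal_sup_le => _ [h hf <-].
exists h => // x; apply: le_trans (hf x) _.
rewrite !patchE; case: ifPn => // xD; apply: fg; exact: set_mem.
Qed.

End LowerIntegral.

(** * Oscillation of a Levy process *)

Section MeasurableSets.
Context {R : realType} {d1} {T1 : measurableType d1}.
Implicit Types f g : T1 -> R.

Lemma measurable_set_ltr f g : measurable_fun setT f -> measurable_fun setT g ->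
  measurable [set x | f x < g x].
Proof.
move=> mf mg; rewrite -[X in measurable X]setTI.
by apply: (measurable_fun_ltr mf mg measurableT (Y := [set true])).
Qed.

Lemma measurable_set_ler f g : measurable_fun setT f -> measurable_fun setT g ->
  measurable [set x | f x <= g x].
Proof.
move=> mf mg; rewrite -[X in measurable X]setTI.
by apply: (measurable_fun_ler mf mg measurableT (Y := [set true])).
Qed.

Lemma bigmax_measurable (n : nat) (f : 'I_n -> T1 -> R) :
  (forall j, measurable_fun setT (f j)) ->
  measurable_fun setT (fun x => \big[Num.max/0]_(j < n) f j x).
Proof.
move=> mf; elim: (index_enum _) => [|j s IH].
  by under eq_fun do rewrite big_nil; exact: measurable_cst.
under eq_fun do rewrite big_cons.
exact: measurable_maxr.
Qed.

End MeasurableSets.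

Section LevyOscillation.
Context {R : realType} {disp : measure_display} {Omega : measurableType disp}.
Variables (P : probability Omega R) (L : R -> {RV P >-> R}).
Hypothesis HL : levy_process L.

Lemma process_measurable (D : set R) (Y : R -> Omega -> R) (t : R) : D t ->
  measurable_fun (setT : set (g_sigma_algebraType (process_events D Y))) (Y t).
Proof.
move=> Dt _ B mB; rewrite setTI; apply: sub_sigma_algebra.
by exists t => //; exists B.
Qed.

(** Sampled over [k, k + 1] at the points of a grid, ends included, it needs
only finitely many of the variables, unlike the supremum of |L t - L k|. *)
Definition levy_osc (k m : nat) (w : Omega) : R :=
  \big[Num.max/0]_(j < m.+2) `|L (k%:R + j%:R / m.+1%:R) w - L k%:R w|.

Lemma levy_osc_ge0 k m w : 0 <= levy_osc k m w.
Proof. by rewrite /levy_osc; elim/big_ind: _ => // x y x0 y0; rewrite le_max x0. Qed.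

Lemma levy_osc_ge k m (j : nat) w : (j <= m.+1)%N ->
  `|L (k%:R + j%:R / m.+1%:R) w - L k%:R w| <= levy_osc k m w.
Proof.
move=> jm; have jm' : (j < m.+2)%N by [].
exact: (le_bigmax _ (fun j : 'I_m.+2 =>
  `|L (k%:R + j%:R / m.+1%:R) w - L k%:R w|) (Ordinal jm')).
Qed.

(** Otherwise there would be times s_n in [0, 1] with |L s_n| > n of
probability more than 1/2 each, hence with positive probability infinitely
often; but the paths are bounded on [0, 1]. *)
Lemma levy_tight : exists2 a : R, 0 <= a &
  forall s : R, 0 <= s <= 1 -> (P [set w | (a < `|L s w|)%R] <= (2^-1)%:E)%E.
Proof.
apply: contrapT => H.
have {}H (n : nat) : exists s : R, 0 <= s <= 1 /\
    ((2^-1)%:E < P [set w | (n%:R < `|L s w|)%R])%E.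
  apply: contrapT => /forallNP H'; apply: H; exists n%:R => // s s01.
  by rewrite leNgt; apply/negP => h; apply: (H' s).
have [s Hs] := choice H.
pose A n := [set w | n%:R < `|L (s n) w|].
have mA n : measurable (A n).
  by apply: measurable_set_ltr => //; apply: measurableT_comp => //; exact: normr_measurable.
(* These sets decrease to the empty set, although each has probability at least
1/2. *)
pose E n := \bigcup_(k in [set k | (n <= k)%N]) A k.
have mE n : measurable (E n) by apply: bigcup_measurable => k _; exact: mA.
have E0 : \bigcap_n E n = set0.
  apply/seteqP; split => // w Ew.
  have [M M0 HM] := cadlag_bounded 1 (@levy_rcont _ _ _ _ _ HL w) (@levy_llim _ _ _ _ _ HL w).
  have [k /= Mk Ak] := Ew (Num.truncn M).+1 I.
  have := HM _ (Hs k).1; rewrite leNgt => /negP; apply.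
  apply: le_lt_trans Ak; apply: ltW; apply: lt_le_trans (truncnS_gt _) _.
  by rewrite ler_nat.
have := @nonincreasing_cvg_mu _ _ _ P E _ mE _ _; rewrite E0 measure0.
have P1 : (P (E 0%N) < +oo)%E by apply: le_lt_trans (probability_le1 _ (mE _)) _; rewrite ltry.
move=> /(_ P1 measurable0) h.
have {}h : P \o E @ \oo --> (0%:E : \bar R).
  apply: h => m n mn; apply/subsetPset => w [k /= nk Ak]; exists k => //=.
  exact: leq_trans nk.
have : \forall n \near \oo, ((P \o E) n < (2^-1)%:E)%E.
  have := h [set x | (x < (2^-1)%:E)%E]; apply.
  apply: open_nbhs_nbhs; split; first exact: open_ereal_lt_ereal.
  by rewrite /= lte_fin invr_gt0.
move=> [n _ /(_ n (leqnn n))] /=; apply/negP; rewrite -leNgt.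
apply: le_trans (ltW (Hs n).2) _; apply: le_measure; rewrite ?inE//; first exact: mA.
by move=> w Aw; exists n => /=.
Qed.

Lemma levy_osc_measurable k m : measurable_fun setT (levy_osc k m).
Proof.
apply: bigmax_measurable => j; apply: measurableT_comp; first exact: normr_measurable.
exact: measurable_funB.
Qed.

(** Ottaviani's inequality. At the first grid point where the increment exceeds
x + a, the rest of the increment up to k + 1 is independent of the past and
stays within a with probability at least 1/2; then the whole increment exceeds
x. *)
Lemma levy_ottaviani (a x : R) (k m : nat) : 0 <= a -> 0 <= x ->
  (forall s : R, 0 <= s <= 1 -> (P [set w | (a < `|L s w|)%R] <= (2^-1)%:E)%E) ->
  (P [set w | (x + a < levy_osc k m w)%R] <= 2%:E * P [set w | (x < `|L 1 w|)%R])%E.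
Proof.
move=> a0 x0 tight.
pose t j : R := k%:R + j%:R / m.+1%:R.
pose Y j (w : Omega) : R := L (t j) w - L k%:R w.
have m0 : 0 < m.+1%:R :> R by rewrite ltr0n.
have t0 j : 0 <= t j by rewrite addr_ge0// divr_ge0// ltW.
have tm : t m.+1 = k.+1%:R by rewrite /t divff ?gt_eqf// -natr1.
have mY j : measurable_fun setT (Y j) by exact: measurable_funB.
have mnY j : measurable_fun setT (fun w => `|Y j w|).
  by apply: measurableT_comp (mY j); exact: normr_measurable.
(* First passage above x + a at the j-th grid point, and a small rest of the
unit of time after it. *)
pose A j := [set w | x + a < `|Y j w|] `&` \bigcap_(i in `I_j) [set w | `|Y i w| <= x + a].
pose G j := [set w | `|L k.+1%:R w - L (t j) w| <= a].
have mA j : measurable (A j).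
  apply: measurableI; first exact: measurable_set_ltr.
  by apply: bigcap_measurableType => i _; exact: measurable_set_ler.
have mG j : measurable (G j).
  apply: measurable_set_ler => //; apply: measurableT_comp; first exact: normr_measurable.
  exact: measurable_funB.
have PAG j : (j <= m.+1)%N -> (P (A j) <= 2%:E * P (A j `&` G j))%E.
  move=> jm; have tj : t j <= k.+1%:R.
    by rewrite -tm lerD2l ler_pM2r ?invr_gt0// ler_nat.
  have -> : P (A j `&` G j) = (P (A j) * P (G j))%E.
    apply: (levy_indep HL (t0 j) tj); last first.
      exists [set y : R | `|y| <= a] => //.
      exact: (@measurable_set_ler _ _ R (fun y => `|y|) (cst a)).
    pose TG := g_sigma_algebraType (process_events `[0, t j] (fun s => L s : Omega -> R)).
    have mYi i : (i <= j)%N -> measurable_fun (setT : set TG) (fun w => `|Y i w|).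
      move=> ij; apply: (measurableT_comp (@normr_measurable R setT)).
      apply: measurable_funB; apply: process_measurable; rewrite /= in_itv/= ?t0//=.
        by rewrite lerD2l ler_pM2r ?invr_gt0// ler_nat.
      by rewrite ler0n/= lerDl divr_ge0// ltW.
    apply: (@measurableI _ TG); first by apply: measurable_set_ltr => //; exact: mYi.
    apply: (@bigcap_measurableType _ TG) => i /= ij.
    by apply: measurable_set_ler => //; apply: mYi; exact: ltnW.
  have PG : ((2^-1)%:E <= P (G j))%E.
    have -> : G j = ~` [set w | a < `|L k.+1%:R w - L (t j) w|].
      by apply/seteqP; split => w; rewrite /G/= leNgt => /negP.
    have mN : measurable [set w | a < `|L k.+1%:R w - L (t j) w|].
      apply: measurable_set_ltr => //; apply: measurableT_comp; first exact: normr_measurable.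
      exact: measurable_funB.
    rewrite probability_setC//.
    have -> : P [set w | a < `|L k.+1%:R w - L (t j) w|] = P [set w | a < `|L (k.+1%:R - t j) w|].
      apply: (levy_stat HL (B := [set y : R | a < `|y|]) (t0 j) tj).
      exact: (@measurable_set_ltr _ _ R (cst _) (fun y => `|y|)).
    have h : 0 <= k.+1%:R - t j <= 1.
      rewrite subr_ge0 tj/= /t -natr1 opprD addrACA subrr add0r lerBlDr lerDl.
      by rewrite divr_ge0// ltW.
    have := tight _ h; case: (P _) => [r| |]//=.
    by rewrite -EFinB !lee_fin; lra.
  have PA2 : P (A j) = (2%:E * (P (A j) * (2^-1)%:E))%E.
    by rewrite muleCA -EFinM mulfV ?pnatr_eq0// mule1.
  rewrite [X in (X <= _)%E]PA2; apply: lee_wpmul2l => //.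
  by apply: lee_pmul => //; rewrite ?lee_fin ?invr_ge0.
have hsub : [set w | x + a < levy_osc k m w] `<=` \big[setU/set0]_(j < m.+2) A j.
  move=> w /= hw; rewrite -(bigcup_mkord m.+2 A).
  have hex : exists j : nat, (j < m.+2)%N && (x + a < `|Y j w|).
    apply: contrapT => /forallNP hj; move: hw; apply/negP; rewrite -leNgt.
    apply: bigmax_le; first by rewrite addr_ge0.
    move=> j _; rewrite leNgt; apply/negP => h; apply: (hj j).
    by rewrite ltn_ord.
  have [j /andP[jm hj] hmin] := ex_minnP hex.
  exists j => //; split => // i /= ij; rewrite leNgt; apply/negP => hi.
  have : (j <= i)%N by apply: hmin; rewrite hi (ltn_trans ij).
  by rewrite leqNgt ij.
have tA : trivIset setT (fun j => A j `&` G j).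
  apply/trivIsetP => i j _ _ ij; apply/seteqP; split => // w [[[Ai Ai'] _] [[Aj Aj'] _]].
  move: ij; rewrite neq_ltn => /orP[h|h].
    by have := Aj' _ h; rewrite /= leNgt Ai.
  by have := Ai' _ h; rewrite /= leNgt Aj.
apply: (@le_trans _ _ (P (\big[setU/set0]_(j < m.+2) A j))).
  apply: le_measure; rewrite ?inE//.
    by apply: measurable_set_ltr => //; exact: levy_osc_measurable.
  exact: bigsetU_measurable.
apply: (@le_trans _ _ (\sum_(j < m.+2) P (A j))%E).
  exact: Boole_inequality.
apply: (@le_trans _ _ (\sum_(j < m.+2) 2%:E * P (A j `&` G j))%E).
  by apply: lee_sum => j _; apply: PAG; rewrite -ltnS.
rewrite -ge0_sume_distrr//; apply: lee_wpmul2l => //.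
have -> : P [set w | x < `|L 1 w|] = P [set w | x < `|L k.+1%:R w - L k%:R w|].
  have := levy_stat HL (B := [set y : R | x < `|y|]) (ler0n R k) (ltac:(by rewrite ler_nat) : k%:R <= k.+1%:R :> R).
  rewrite -natr1 addrAC subrr add0r => -> //.
  exact: (@measurable_set_ltr _ _ R (cst _) (fun y => `|y|)).
have mAG j : measurable (A j `&` G j) by exact: measurableI.
rewrite -(@measure_bigsetU _ _ _ P (fun j => A j `&` G j))//.
apply: le_measure; rewrite ?inE//.
- exact: bigsetU_measurable.
- by apply: measurable_set_ltr => //; rewrite -tm; exact: mnY.
rewrite -(bigcup_mkord m.+2 (fun j => A j `&` G j)) => w [j _ [[/= Aj _] Gj]] /=.
have -> : L k.+1%:R w - L k%:R w = (L k.+1%:R w - L (t j) w) + Y j w.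
  by rewrite /Y addrA subrK.
have := ler_normB ((L k.+1%:R w - L (t j) w) + Y j w) (L k.+1%:R w - L (t j) w).
by rewrite addrAC subrr add0r; rewrite /G/= in Gj; lra.
Qed.

(** Ottaviani's inequality compares the tails of the oscillation and of |L 1|;
integrate the tails. The bound does not depend on the grid. *)
Lemma levy_osc_mean : P.-integrable setT (EFin \o L 1) ->
  exists2 c : R, 0 <= c &
  forall k m, (\int[P]_w (levy_osc k m w)%:E <= c%:E)%E.
Proof.
move=> iL; have [a a0 tight] := levy_tight.
have mL : measurable_fun setT (fun w => `|L 1 w|).
  by apply: measurableT_comp => //; exact: normr_measurable.
pose l := fine (\int[P]_w (`|L 1 w|)%:E)%E.
have lE : (\int[P]_w (`|L 1 w|)%:E)%E = l%:E.
  rewrite fineK// ge0_fin_numE; last by apply: integral_ge0 => w _; rewrite lee_fin.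
  by have /integrableP[_] := iL.
have l0 : 0 <= l by rewrite -lee_fin -lE; apply: integral_ge0 => w _; rewrite lee_fin.
exists (a + 2 * l); first by rewrite addr_ge0// mulr_ge0.
move=> k m; pose Z w := Num.max (levy_osc k m w - a) 0.
have mZ : measurable_fun setT Z.
  apply: measurable_maxr => //; apply: measurable_funB => //; exact: levy_osc_measurable.
have [Z' Z'E] := exists_mfun mZ; have [L' L'E] := exists_mfun mL.
have Z0 w : 0 <= Z w by rewrite le_max lexx orbT.
have EZ : (\int[P]_w (Z w)%:E <= (2 * l)%:E)%E.
  have := @ge0_expectation_ccdf _ _ _ P Z'; rewrite Z'E unlock => -> //.
  rewrite EFinM -lE.
  have := @ge0_expectation_ccdf _ _ _ P L'; rewrite L'E unlock => -> //.
  rewrite -ge0_integralZl//; last exact: measurable_funTS (ccdf_measurable L').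
  apply: ge0_le_integral => //.
  - by apply: measurable_funTS; exact: ccdf_measurable.
  - by apply: measurable_funTS; apply: measurable_funeM; exact: ccdf_measurable.
  move=> x; rewrite /= in_itv/= andbT => x0.
  rewrite /ccdf /distribution /pushforward Z'E L'E set_itvoy.
  have := levy_ottaviani k m a0 x0 tight.
  rewrite (_ : [set w | x + a < levy_osc k m w] = Z @^-1` [set y | x < y])//.
  by apply/seteqP; split => w /=; rewrite lt_max ltrBrDr (ltNge x 0) x0 orbF.
apply: (@le_trans _ _ (\int[P]_w (a%:E + (Z w)%:E))%E).
  apply: ge0_le_integral => //.
  - by move=> w _; rewrite lee_fin levy_osc_ge0.
  - by apply/measurable_EFinP; exact: levy_osc_measurable.
  - apply: emeasurable_funD => //; exact/measurable_EFinP.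
  move=> w _; rewrite -EFinD lee_fin -lerBlDl le_max lexx //.
rewrite ge0_integralD//; last 2 first.
- by move=> w _; rewrite lee_fin.
- exact/measurable_EFinP.
have -> : (\int[P]__ a%:E = a%:E)%E by have := expectation_cst P a; rewrite unlock.
by rewrite EFinD leeD2l.
Qed.

End LevyOscillation.

(** * Mean number of changes of the chain *)

Section MeanBounds.
Context {R : realType} {disp : measure_display} {Omega : measurableType disp}.
Variable P : probability Omega R.

(** Bounds on means in this form compose without side conditions of
integrability. *)
Definition mean_le (f : Omega -> R) (c : R) : Prop :=
  [/\ measurable_fun setT f, forall w, 0 <= f w & (\int[P]_w (f w)%:E <= c%:E)%E].

Lemma mean_le_cst c : 0 <= c -> mean_le (cst c) c.
Proof.
by move=> c0; split=> //; have := expectation_cst P c; rewrite unlock => ->.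
Qed.

Lemma mean_leD f g a b : mean_le f a -> mean_le g b -> mean_le (fun w => f w + g w) (a + b).
Proof.
move=> [mf f0 fa] [mg g0 gb]; split.
- exact: measurable_funD.
- by move=> w; rewrite addr_ge0.
under eq_integral do rewrite EFinD.
rewrite ge0_integralD//; first by rewrite EFinD; exact: leeD.
- by move=> w _; rewrite lee_fin.
- exact/measurable_EFinP.
- by move=> w _; rewrite lee_fin.
- exact/measurable_EFinP.
Qed.

Lemma mean_leZ f a k : 0 <= k -> mean_le f a -> mean_le (fun w => k * f w) (k * a).
Proof.
move=> k0 [mf f0 fa]; split.
- exact: measurable_funM.
- by move=> w; rewrite mulr_ge0.
under eq_integral do rewrite EFinM.
rewrite ge0_integralZl//; first by rewrite EFinM; exact: lee_wpmul2l.
- exact/measurable_EFinP.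
- by move=> w _; rewrite lee_fin.
Qed.

Lemma mean_le_sum (I : Type) (s : seq I) (p : pred I) (f : I -> Omega -> R) (c : I -> R) :
  (forall i, p i -> mean_le (f i) (c i)) ->
  mean_le (fun w => \sum_(i <- s | p i) f i w) (\sum_(i <- s | p i) c i).
Proof.
move=> H; elim: s => [|i s IH].
  by under eq_fun do rewrite big_nil; rewrite big_nil; exact: mean_le_cst.
under eq_fun do rewrite big_cons; rewrite big_cons.
by case: ifP => // pi; apply: mean_leD => //; exact: H.
Qed.

Lemma mean_leW f a b : a <= b -> mean_le f a -> mean_le f b.
Proof. by move=> ab [mf f0 fa]; split => //; apply: le_trans fa _; rewrite lee_fin. Qed.

Lemma mean_leM (f g : Omega -> R) a b :
  (forall A B, measurable A -> measurable B ->
     P (f @^-1` A `&` g @^-1` B) = (P (f @^-1` A) * P (g @^-1` B))%E) ->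
  0 <= a -> mean_le f a -> mean_le g b -> mean_le (fun w => f w * g w) (a * b).
Proof.
move=> ind a0 [mf f0 fa] [mg g0 gb]; split.
- exact: measurable_funM.
- by move=> w; rewrite mulr_ge0.
have mEf : measurable_fun setT (EFin \o f) by exact/measurable_EFinP.
have mEg : measurable_fun setT (EFin \o g) by exact/measurable_EFinP.
pose F (z : R * R) : \bar R := (`|z.1| * `|z.2|)%:E.
have -> : (\int[P]_w (f w * g w)%:E = \int[P]_w F (f w, g w))%E.
  by apply: eq_integral => w _; rewrite /F/= !ger0_norm.
rewrite (indep_tonelli mf mg ind)//; last 2 first.
- apply/measurable_EFinP; apply: measurable_funM.
    exact: (measurableT_comp (@normr_measurable R setT) measurable_fst).
  exact: (measurableT_comp (@normr_measurable R setT) measurable_snd).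
- by move=> z; rewrite lee_fin mulr_ge0.
apply: (@le_trans _ _ (\int[P]_v (a%:E * (g v)%:E))%E); last first.
  rewrite ge0_integralZl//; last by move=> w _; rewrite lee_fin.
  by rewrite EFinM; apply: lee_wpmul2l.
have E v : (\int[P]_w F (f w, g v) = \int[P]_w (f w)%:E * (g v)%:E)%E.
  under eq_integral do rewrite /F/= !ger0_norm// EFinM.
  by rewrite ge0_integralZr// ?lee_fin// => w _; rewrite lee_fin.
apply: ge0_le_integral => //.
- by move=> v _; apply: integral_ge0 => w _; rewrite lee_fin mulr_ge0.
- under eq_fun do rewrite E.
  by apply: measurable_funeM.
- by apply: measurable_funeM.
- move=> v _; rewrite E; apply: lee_wpmul2r => //.
  by rewrite lee_fin.
Qed.

Lemma mean_le_indic (A : set Omega) c : measurable A -> (P A <= c%:E)%E ->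
  mean_le (fun w => \1_A w) c.
Proof.
move=> mA PA; split=> //.
- exact: measurable_indic.
- by rewrite integral_indic// setIT.
Qed.

Lemma le_measure_fin_union (I : finType) (A : set Omega) (F : I -> set Omega) (c : R) :
  measurable A -> (forall i, measurable (F i)) -> A `<=` \bigcup_i F i -> 0 <= c ->
  (forall i, (P (F i) <= c%:E)%E) -> (P A <= (#|I|%:R * c)%:E)%E.
Proof.
move=> mA mF AF c0 Fc.
have [_ _] := @mean_le_sum I (index_enum I) predT (fun i w => \1_(F i) w) (fun=> c)
  (fun i _ => mean_le_indic (mF i) (Fc i)).
rewrite sumr_const cardT -cardE mulr_natl; apply: le_trans.
rewrite -[A]setIT -integral_indic//; apply: ge0_le_integral => //.
- exact/measurable_EFinP.
- by apply/measurable_EFinP; apply: measurable_sum => i; exact: measurable_indic.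
move=> w _; rewrite lee_fin; have [Aw|Aw] := pselect (A w); last first.
  rewrite indicE memNset//; apply: sumr_ge0 => i _.
  by rewrite indicE.
have [i _ Fi] := AF _ Aw; rewrite (bigD1 i)//= !indicE !mem_set// lerDl.
by apply: sumr_ge0 => j _; rewrite indicE.
Qed.

End MeanBounds.

Section Transition.
Context {R : realType} {d : nat}.
Variable q : 'M[R]_d.

Let b : R := \sum_i \sum_j `|q i j|.

Let b0 : 0 <= b.
Proof. by apply: sumr_ge0 => i _; apply: sumr_ge0. Qed.

Lemma mx_exp_bound k i j : `|(q ^+ k) i j| <= b ^+ k.
Proof.
elim: k i j => [|k IH] i j.
  by rewrite !expr0 mxE; case: eqP => _; rewrite ?normr1 ?normr0// ler01.
rewrite exprS [X in `|X|]mxE exprS.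
apply: le_trans (ler_norm_sum _ _ _) _.
apply: (@le_trans _ _ (\sum_l `|q i l| * b ^+ k)).
  by apply: ler_sum => l _; rewrite normrM ler_wpM2l.
rewrite -mulr_suml ler_wpM2r ?exprn_ge0// /b [leRHS](bigD1 i)//= lerDl.
by apply: sumr_ge0 => l _; apply: sumr_ge0.
Qed.

(** The zeroth term of the exponential series vanishes off the diagonal, so the
sum is at most e^{hb} - 1 with b the sum of all the moduli of the entries. *)
Lemma transition_offdiag (h : R) i j : 0 <= h -> h <= 1 -> i != j ->
  `|transition q h i j| <= h * (b * expR b).
Proof.
move=> h0 h1 ij; rewrite mxE.
set u : nat -> R := fun k => h ^+ k / k`!%:R * (q ^+ k) i j.
have hu k : `|u k| <= exp_coeff (h * b) k.
  rewrite /u normrM /exp_coeff/= exprMn mulrAC ger0_norm; last first.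
    by rewrite divr_ge0// exprn_ge0.
  by rewrite -!mulrA ler_wpM2l ?exprn_ge0// ler_wpM2l ?invr_ge0// mx_exp_bound.
have hb0 : 0 <= h * b by rewrite mulr_ge0.
have cu : cvgn (series u).
  apply: normed_cvg; apply: (series_le_cvg _ _ hu) => //=.
  - by move=> n; exact: exp_coeff_ge0.
  - exact: is_cvg_series_exp_coeff.
have ce := is_cvg_series_exp_coeff (h * b).
have hs n : `|series u n.+1| <= series (exp_coeff (h * b)) n.+1 - 1.
  rewrite /series/= !big_mkord !big_ord_recl /u/exp_coeff/= !expr0 mxE (negPf ij).
  rewrite mulr0 add0r divr1 addrAC subrr add0r.
  apply: le_trans (ler_norm_sum _ _ _) _; apply: ler_sum => k _; exact: hu.
have : `|limn (series u)| <= expR (h * b) - 1.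
  rewrite -lim_norm//; apply: limr_le; first exact: is_cvg_norm.
  near=> n; have [k ->] : exists k, n = k.+1.
    by exists n.-1; rewrite prednK//; near: n; exists 1%N.
  apply: le_trans (hs k) _; rewrite lerB//.
  apply: nondecreasing_cvgn_le => //.
  by apply: nondecreasing_series => m _ _; exact: exp_coeff_ge0.
move=> /le_trans; apply.
have e1 : 1 - h * b <= expR (- (h * b)) by have := expR_ge1Dx (- (h * b)).
have e2 : expR (h * b) - 1 <= h * b * expR (h * b).
  have : (1 - h * b) * expR (h * b) <= expR (- (h * b)) * expR (h * b).
    by rewrite ler_wpM2r// expR_ge0.
  by rewrite -expRD addNr expR0; lra.
apply: le_trans e2 _; rewrite -mulrA ler_wpM2l// ler_wpM2l// ler_expR.
by rewrite ler_piMl.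
Unshelve. all: by end_near. Qed.

Context {disp : measure_display} {Omega : measurableType disp}.
Variables (P : probability Omega R) (J : R -> Omega -> 'I_d).
Hypothesis HJ : markov_chain P q J.

(** Sum over the values of J at the times 0, s and s + h; the initial one is
included since the finite-dimensional laws start from time 0. *)
Lemma chain_change_prob (s h : R) : 0 <= s -> 0 <= h -> h <= 1 ->
  (P [set w | J s w != J (s + h) w] <= ((d * d * d)%:R * (h * (b * expR b)))%:E)%E.
Proof.
move=> s0 h0 h1.
have sh0 : 0 <= s + h by rewrite addr_ge0.
have mJ t i : 0 <= t -> measurable [set w | J t w = i] by exact: (chain_measurable HJ).
have -> : (d * d * d)%N = #|{: 'I_d * 'I_d * 'I_d}| by rewrite !card_prod !card_ord.
pose F (z : 'I_d * 'I_d * 'I_d) : set Omega := if z.1.2 == z.2 then set0 else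
  [set w | J 0 w = z.1.1] `&` ([set w | J s w = z.1.2] `&` [set w | J (s + h) w = z.2]).
have c0 : 0 <= h * (b * expR b) by rewrite !mulr_ge0// expR_ge0.
apply: (@le_measure_fin_union _ _ _ _ _ _ F) => //.
- have -> : [set w | J s w != J (s + h) w] =
     ~` \bigcup_i ([set w | J s w = i] `&` [set w | J (s + h) w = i]).
    apply/seteqP; split => w /=.
      by move=> /eqP ne [i _ [/= e1 e2]]; apply: ne; rewrite e1 e2.
    by move=> ne; apply/eqP => e; apply: ne; exists (J (s + h) w).
  apply: measurableC; apply: fin_bigcup_measurable => // i _.
  by apply: measurableI; exact: mJ.
- move=> z; rewrite /F; case: ifP => // _.
  by apply: measurableI; [|apply: measurableI]; exact: mJ.
- by move=> w /= ne; exists (J 0 w, J s w, J (s + h) w) => //; rewrite /F/= (negPf ne).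
move=> [[i0 i] j]; rewrite /F/=; case: eqP => [_|/eqP ij]; first by rewrite measure0 lee_fin.
pose t (k : nat) : R := if k is 0%N then 0 else if k is 1%N then s else s + h.
pose ii (k : nat) : 'I_d := if k is 0%N then i0 else if k is 1%N then i else j.
have t_nd k : t k <= t k.+1 by case: k => [|[|k]] //=; rewrite lerDl.
have := chain_fdd HJ 2 (t := t) ii erefl t_nd.
have := chain_fdd HJ 1 (t := t) ii erefl t_nd.
rewrite !big_ord_recl !big_ord0 /= !setIT !mulr1 subr0.
rewrite addrAC subrr add0r => E1 E2.
rewrite E2 EFinM muleA -E1.
have P1 : (P ([set w | J 0 w = i0] `&` [set w | J s w = i]) <= 1)%E.
  by apply: probability_le1; apply: measurableI; exact: mJ.
apply: (@le_trans _ _ (P ([set w | J 0 w = i0] `&` [set w | J s w = i]) *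
  (h * (b * expR b))%:E)%E).
  apply: lee_wpmul2l => //; rewrite lee_fin.
  by apply: le_trans (ler_norm _) _; exact: transition_offdiag.
by rewrite -[leRHS]mul1e; apply: lee_wpmul2r => //; rewrite lee_fin.
Qed.

Lemma grid_changes_measurable K m :
  measurable_fun (setT : set (g_sigma_algebraType (chain_events J)))
    (fun w => (grid_changes J w K m)%:R : R).
Proof.
under eq_fun do rewrite /grid_changes natr_sum.
apply: measurable_sum => k.
have mJ t i : 0 <= t ->
    @measurable _ (g_sigma_algebraType (chain_events J)) [set w | J t w = i].
  by move=> t0; apply: sub_sigma_algebra; exists t, i.
set s := k%:R / _; set t := _ / _.
have s0 : 0 <= s by rewrite divr_ge0.
have t0 : 0 <= t by rewrite divr_ge0.
pose TJ := g_sigma_algebraType (chain_events J).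
have mA : @measurable _ TJ (~` \bigcup_i ([set w | J s w = i] `&` [set w | J t w = i])).
  apply: measurableC; apply: fin_bigcup_measurable => // i _.
  by apply: measurableI; exact: mJ.
rewrite (_ : (fun w : TJ => (J s w != J t w)%:R : R) =
   \1_(~` \bigcup_i ([set w | J s w = i] `&` [set w | J t w = i]))); first exact: measurable_indic.
apply/funext => w; rewrite indicE; congr (nat_of_bool _)%:R.
apply/idP/idP => [/eqP ne|].
  by rewrite inE/= => -[i _ [/= e1 e2]]; apply: ne; rewrite e1 e2.
by rewrite inE/= => ne; apply/eqP => e; apply: ne; exists (J t w).
Qed.

(** Each of the K (m + 1) grid steps has a change with probability O (1 / (m +
1)), so the bound does not depend on the grid. *)
Lemma grid_changes_mean K m : mean_le P (fun w => (grid_changes J w K m)%:R)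
  (K%:R * ((d * d * d)%:R * (b * expR b))).
Proof.
have -> : K%:R * ((d * d * d)%:R * (b * expR b)) =
    \sum_(k < K * m.+1) (d * d * d)%:R * (m.+1%:R^-1 * (b * expR b)) :> R.
  rewrite sumr_const card_ord -[RHS]mulr_natl natrM.
  have m0 : m.+1%:R != 0 :> R by rewrite pnatr_eq0.
  by field.
under eq_fun do rewrite /grid_changes natr_sum.
apply: mean_le_sum => k _.
have mJ t i : 0 <= t -> measurable [set w | J t w = i] by exact: (chain_measurable HJ).
set s := k%:R / _; set t := _ / _.
have s0 : 0 <= s by rewrite divr_ge0.
have t0 : 0 <= t by rewrite divr_ge0.
have tE : t = s + m.+1%:R^-1 by rewrite /t /s -natr1 mulrDl mul1r.
have mA : measurable [set w | J s w != J t w].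
  rewrite (_ : [set w | _] = ~` \bigcup_i ([set w | J s w = i] `&` [set w | J t w = i])).
    apply: measurableC; apply: fin_bigcup_measurable => // i _.
    by apply: measurableI; exact: mJ.
  apply/seteqP; split => w /=.
    by move=> /eqP ne [i _ [/= e1 e2]]; apply: ne; rewrite e1 e2.
  by move=> ne; apply/eqP => e; apply: ne; exists (J t w).
rewrite (_ : (fun w => (J s w != J t w)%:R : R) = \1_[set w | J s w != J t w]); last first.
  by apply/funext => w; rewrite indicE; congr (nat_of_bool _)%:R; apply/esym/asboolb.
apply: mean_le_indic => //; rewrite tE; apply: chain_change_prob => //.
by rewrite invf_le1// ler1n.
Qed.

End Transition.

(** * First absolute moment of the additive process *)

Section OscCover.
Context {R : realType} {disp : measure_display} {Omega : measurableType disp}.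
Variables (P : probability Omega R) (L : R -> {RV P >-> R}).
Hypothesis HL : levy_process L.

Lemma levy_osc_sum (a m : nat) w : `|L a%:R w| <= \sum_(k < a) levy_osc L k m w.
Proof.
elim: a => [|a IH]; first by rewrite big_ord0 (levy_0 HL) normr0.
rewrite big_ord_recr/=; have := levy_osc_ge L a w (leqnn m.+1).
rewrite divff ?pnatr_eq0// natr1.
have := ler_normD (L a.+1%:R w - L a%:R w) (L a%:R w); rewrite subrK; lra.
Qed.

Lemma levy_osc_grid (K k m : nat) w : k%:R / m.+1%:R < K%:R :> R ->
  `|L (k%:R / m.+1%:R) w| <= \sum_(k < K) levy_osc L k m w.
Proof.
move=> kK; set a := (k %/ m.+1)%N; set b := (k %% m.+1)%N.
have m0 : 0 < m.+1%:R :> R by rewrite ltr0n.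
have aK : (a < K)%N.
  by rewrite ltn_divLR//; move: kK; rewrite ltr_pdivrMr// -natrM ltr_nat.
have E : k%:R / m.+1%:R = a%:R + b%:R / m.+1%:R :> R.
  by rewrite {1}(divn_eq k m.+1) natrD natrM mulrDl mulfK ?gt_eqF.
have bm : (b <= m.+1)%N by rewrite ltnW// ltn_pmod.
rewrite E; have h1 := levy_osc_ge L a w bm; have h2 := levy_osc_sum a m w.
have := ler_normD (L (a%:R + b%:R / m.+1%:R) w - L a%:R w) (L a%:R w).
rewrite subrK => h3.
apply: (@le_trans _ _ (\sum_(k < a.+1) levy_osc L k m w)).
  by rewrite big_ord_recr/=; lra.
rewrite -!(big_mkord predT (fun k => levy_osc L k m w)) (@big_cat_nat _ _ _ a.+1 _ K)//=.
by rewrite lerDl; apply: sumr_ge0 => i _; exact: levy_osc_ge0.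
Qed.

(** Right-continuity moves s to a nearby grid point with an error of at most 1;
from there, telescope over the units of time. *)
Lemma levy_osc_cover (K : nat) (s : R) w : 0 <= s -> s < K%:R ->
  \forall m \near \oo, `|L s w| <= \sum_(k < K) levy_osc L k m w + 1.
Proof.
move=> s0 sK.
have [e /= e0 He] : \forall u \near s^'+, `|L s w - L u w| <= 1.
  by have /cvgrPdist_le/(_ _ ltr01) := @levy_rcont _ _ _ _ _ HL w s s0.
have hx : s < Num.min (s + e) K%:R by rewrite lt_min sK ltrDl e0.
have := grid_point_near s0 hx; apply: filterS => m [k /andP[k1]].
rewrite lt_min => /andP[k2 k3].
have := levy_osc_grid w k3; move: k1 k2; set u := _ / _ => k1 k2 hg.
have h : `|L s w - L u w| <= 1.
  by apply: He => //=; rewrite ltr0_norm ?subr_lt0//; lra.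
have := ler_normD (L s w - L u w) (L u w).
by rewrite subrK; lra.
Qed.

End OscCover.

Section LiminfBound.
Context {R : realType}.
Local Open Scope ereal_scope.

Lemma limn_einf_ge (u : (\bar R)^nat) (c : \bar R) :
  (\forall n \near \oo, c <= u n) -> c <= limn_einf u.
Proof.
move=> [n _ Hn]; rewrite limn_einf_lim.
apply: (@le_trans _ _ (einfs u n)).
  by apply: le_ereal_inf_tmp => _ [k /= nk <-]; exact: Hn.
rewrite (cvg_lim _ (@cvg_einfs_sup _ u))//.
by apply: ereal_sup_ubound; exists n.
Qed.

Lemma limn_einf_le (u : (\bar R)^nat) (c : \bar R) :
  (forall n, u n <= c) -> limn_einf u <= c.
Proof.
move=> Hu; rewrite limn_einf_lim; apply: lime_le; first exact: is_cvg_einfs.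
near=> n; apply: le_trans (Hu n); apply: ereal_inf_lbound.
by exists n => /=.
Unshelve. all: by end_near. Qed.

End LiminfBound.

Section MapMean.
Context {R : realType} {disp : measure_display} {Omega : measurableType disp}.
Variables (P : probability Omega R) (d : nat) (q : 'M[R]_d).
Variables (L : 'I_d -> R -> {RV P >-> R}) (U : 'I_d -> 'I_d -> nat -> {RV P >-> R}).
Variables (J : R -> Omega -> 'I_d) (X : R -> {RV P >-> R}).
Hypothesis HM : markov_additive q L U J X.
Hypothesis Hfin : finite_means L U.

Lemma source_indep (k1 k2 : source d) (A B : set Omega) :
  genuine_source k1 -> genuine_source k2 -> k1 != k2 ->
  measurable A -> measurable B ->
  source_events L U J k1 A -> source_events L U J k2 B ->
  P (A `&` B) = (P A * P B)%E.
Proof.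
move=> g1 g2 ne mA mB A1 B2.
have := map_indep HM (s := [:: k1; k2]) (E := fun k => if k == k1 then A else B).
rewrite !big_cons !big_nil !setIT !mulr1 eqxx [k2 == k1]eq_sym (negPf ne) => H.
have fin (S : set Omega) : measurable S -> P S \is a fin_num by exact: fin_num_measure.
rewrite -(fineK (fin _ mA)) -(fineK (fin _ mB)) -EFinM -H ?fineK//.
- by apply: fin; exact: measurableI.
- by rewrite /= inE ne.
- by move=> k; rewrite !inE => /orP[]/eqP->.
- move=> k; rewrite !inE => /orP[]/eqP->; first by rewrite eqxx.
  by rewrite eq_sym (negPf ne).
Qed.

Local Notation TJ := (g_sigma_algebraType (chain_events J)).
Local Notation TL i :=
  (g_sigma_algebraType (process_events [set t : R | 0 <= t] (fun t => L i t : Omega -> R))).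
Local Notation TU i j n := (g_sigma_algebraType (rv_events (U i j n))).

Lemma indep_J_L i (f g : Omega -> R) :
  measurable_fun setT f -> measurable_fun setT g ->
  measurable_fun (setT : set TJ) f -> measurable_fun (setT : set (TL i)) g ->
  forall A B, measurable A -> measurable B ->
     P (f @^-1` A `&` g @^-1` B) = (P (f @^-1` A) * P (g @^-1` B))%E.
Proof.
move=> mf mg fJ gL A B mA mB.
apply: (@source_indep (inr tt) (inl (inl i))) => //.
- by rewrite -[X in measurable X]setTI; exact: mf.
- by rewrite -[X in measurable X]setTI; exact: mg.
- by have := fJ measurableT A mA; rewrite setTI.
- by have := gL measurableT B mB; rewrite setTI.
Qed.

Lemma indep_J_U i j n (f g : Omega -> R) : i != j ->
  measurable_fun setT f -> measurable_fun setT g ->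
  measurable_fun (setT : set TJ) f -> measurable_fun (setT : set (TU i j n)) g ->
  forall A B, measurable A -> measurable B ->
     P (f @^-1` A `&` g @^-1` B) = (P (f @^-1` A) * P (g @^-1` B))%E.
Proof.
move=> ij mf mg fJ gL A B mA mB.
apply: (@source_indep (inr tt) (inl (inr (i, j, n)))) => //.
- by rewrite -[X in measurable X]setTI; exact: mf.
- by rewrite -[X in measurable X]setTI; exact: mg.
- by have := fJ measurableT A mA; rewrite setTI.
- by have := gL measurableT B mB; rewrite setTI.
Qed.

Lemma chain_sub_measurable (A : set Omega) :
  <<s chain_events J >> A -> measurable A.
Proof.
apply: smallest_sub; first exact: sigma_algebra_measurable.
by move=> _ [t [i [t0 ->]]]; exact: (chain_measurable (map_chain HM) _ t0).
Qed.

Lemma measurable_fun_chain (f : Omega -> R) :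
  measurable_fun (setT : set TJ) f -> measurable_fun setT f.
Proof. by move=> mf _ B mB; apply: chain_sub_measurable; exact: mf. Qed.

Lemma levy_osc_measurable_L i k m :
  measurable_fun (setT : set (TL i)) (levy_osc (L i) k m).
Proof.
apply: bigmax_measurable => j; apply: measurableT_comp; first exact: normr_measurable.
by apply: measurable_funB; apply: process_measurable => //=; rewrite addr_ge0// divr_ge0.
Qed.

Let N K m (w : Omega) : R := (grid_changes J w K m)%:R.

Let mNJ K m : measurable_fun (setT : set TJ) (N K m).
Proof. exact: grid_changes_measurable. Qed.

(** The bound of map_path_bound with the jump times replaced by grid
quantities, expanded into sums of products of a function of J and a function of
one other source. The cut-off K (m + 1) is the largest possible number of
changes on the grid. *)
Definition map_majorant (K m : nat) (w : Omega) : R :=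
  2 + 2 * N K m w
  + (\sum_i \sum_(k < K) 2 * levy_osc (L i) k m w)
  + (\sum_i \sum_(k < K) 2 * (N K m w * levy_osc (L i) k m w))
  + \sum_i \sum_(j | j != i) \sum_(n < K * m.+1)
      ((n < grid_changes J w K m)%N%:R * `|U i j n w|).

Lemma grid_changes_le K m w : (grid_changes J w K m <= K * m.+1)%N.
Proof.
rewrite /grid_changes -[leqRHS]card_ord -sum1_card; apply: leq_sum => k _.
by case: eqP.
Qed.

Lemma map_majorant_ge (K : nat) (t : R) w : 0 <= t -> t < K%:R ->
  \forall m \near \oo, `|X t w| <= map_majorant K m w.
Proof.
move=> t0 tK; have HJ := map_chain HM; have HL := map_levy HM.
have Jr := @chain_rcont _ _ _ _ _ _ _ HJ w; have Jl := @chain_llim _ _ _ _ _ _ _ HJ w.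
have [n [h1 h2]] := nonexplosion Jr Jl t0.
have Sp (p : 'I_n.+1) : (jump_time J w p <= t%:E)%E.
  by apply: le_trans h1; apply: jump_time_le; rewrite -ltnS.
have Sn0 p : 0 <= fine (jump_time J w p) by apply: fine_ge0; exact: jump_time_ge0.
have SpK (p : 'I_n.+1) : fine (jump_time J w p) < K%:R.
  by apply: le_lt_trans tK; rewrite -lee_fin -(jump_time_fin (Sp p)).
have nK : (jump_time J w n < K%:R%:E)%E by apply: le_lt_trans h1 _; rewrite lte_fin.
have H1 : \forall m \near \oo, forall (z : 'I_d * 'I_n.+1),
    `|L z.1 (fine (jump_time J w z.2)) w| <= \sum_(k < K) levy_osc (L z.1) k m w + 1.
  by apply: filter_forall => z; exact: levy_osc_cover.
have H2 : \forall m \near \oo, forall i : 'I_d,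
    `|L i t w| <= \sum_(k < K) levy_osc (L i) k m w + 1.
  by apply: filter_forall => i; exact: levy_osc_cover.
near=> m.
have osc0 i : 0 <= \sum_(k < K) levy_osc (L i) k m w.
  by apply: sumr_ge0 => k _; exact: levy_osc_ge0.
pose Z : R := \sum_i \sum_(k < K) levy_osc (L i) k m w.
have Z0 : 0 <= Z by exact: sumr_ge0.
have ZE i : \sum_(k < K) levy_osc (L i) k m w <= Z.
  by rewrite /Z [leRHS](bigD1 i)//= lerDl; exact: sumr_ge0.
have nN : (n <= grid_changes J w K m)%N.
  by near: m; exact: grid_changes_ge.
have H1m : forall (z : 'I_d * 'I_n.+1),
    `|L z.1 (fine (jump_time J w z.2)) w| <= \sum_(k < K) levy_osc (L z.1) k m w + 1.
  by near: m.
have H2m : forall i : 'I_d, `|L i t w| <= \sum_(k < K) levy_osc (L i) k m w + 1.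
  by near: m.
have HB := @map_path_bound _ _ _ _ (fun i t => L i t) (fun i j n => U i j n) J (fun t => X t) w
  Jr (map_eq HM) n t (Z + 1) h1 h2.
apply: le_trans (HB _ _) _.
- move=> i p pn; have pn' : (p < n.+1)%N by [].
  by apply: le_trans (H1m (i, Ordinal pn')) _; rewrite lerD2r.
- by move=> i; apply: le_trans (H2m i) _; rewrite lerD2r.
have -> : map_majorant K m w = (N K m w + 1) * (2 * (Z + 1)) +
   \sum_i \sum_(j | j != i) \sum_(n < K * m.+1) ((n < grid_changes J w K m)%N%:R * `|U i j n w|).
  rewrite /map_majorant.
  have -> : \sum_i \sum_(k < K) 2 * levy_osc (L i) k m w = 2 * Z.
    by rewrite mulr_sumr; apply: eq_bigr => i _; rewrite mulr_sumr.
  have -> : \sum_i \sum_(k < K) 2 * (N K m w * levy_osc (L i) k m w) = 2 * (N K m w * Z).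
    rewrite !mulr_sumr; apply: eq_bigr => i _; rewrite !mulr_sumr; exact: eq_bigr.
  by ring.
apply: lerD.
  by rewrite ler_wpM2r ?mulr_ge0 ?addr_ge0// /N natr1 ler_nat.
rewrite /jump_size exchange_big/=; apply: ler_sum => i _.
rewrite exchange_big/=; apply: ler_sum => j ji.
have nM := leq_trans nN (grid_changes_le K m w).
rewrite -(big_mkord predT (fun p => `|U i j p w|)).
rewrite -(big_mkord predT (fun p => (p < grid_changes J w K m)%N%:R * `|U i j p w|)).
rewrite (@big_cat_nat _ _ _ n _ (K * m.+1))//=.
rewrite -[leLHS]addr0; apply: lerD; last by apply: sumr_ge0 => p _; rewrite mulr_ge0.
rewrite big_nat [leRHS]big_nat; apply: ler_sum => p /andP[_ pn].
by rewrite (leq_trans pn nN) mul1r.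
Unshelve. all: by end_near. Qed.

(** Each term is a product of independent factors with bounded means; the mean
number of changes is the sum of the probabilities of having more than n of
them. *)
Lemma map_majorant_mean : exists2 C : R, 0 <= C &
  forall K m, mean_le P (map_majorant K m) (C * (1 + K%:R) ^+ 2).
Proof.
have HJ := map_chain HM; have HL := map_levy HM.
pose c1 : R := (d * d * d)%:R * ((\sum_i \sum_j `|q i j|) * expR (\sum_i \sum_j `|q i j|)).
have c10 : 0 <= c1.
  by rewrite mulr_ge0// mulr_ge0 ?expR_ge0//; apply: sumr_ge0 => i _; exact: sumr_ge0.
have HN K m : mean_le P (N K m) (K%:R * c1) by exact: grid_changes_mean HJ K m.
have Hosc i := levy_osc_mean (HL i) (Hfin.1 i).
pose c2 i : R := sval (cid2 (Hosc i)).
have c20 i : 0 <= c2 i by rewrite /c2; case: cid2.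
have Ho i k m : mean_le P (levy_osc (L i) k m) (c2 i).
  split; [exact: levy_osc_measurable|by move=> w; exact: levy_osc_ge0|].
  by rewrite /c2; case: cid2 => //= c _; exact.
pose c3 i j : R := fine (\int[P]_w (`|U i j 0%N w|)%:E)%E.
have HU i j n : i != j -> mean_le P (fun w => `|U i j n w|) (c3 i j).
  move=> ij; split => //.
    by apply: measurableT_comp => //; exact: normr_measurable.
  have E n' : (\int[P]_w (`|U i j n' w|)%:E = \int[distribution P (U i j n')]_x (`|x|)%:E)%E.
    by rewrite ge0_integral_distribution//; apply/measurable_EFinP; exact: normr_measurable.
  rewrite /c3 fineK; last first.
    rewrite ge0_fin_numE; last by apply: integral_ge0 => w _; rewrite lee_fin.
    by have /integrableP[_] := Hfin.2 i j 0%N ij.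
  rewrite !E (eq_measure_integral (distribution P (U i j 0%N)))// => B mB _.
  exact: (map_jump_law HM _ ij mB).
have c30 i j : 0 <= c3 i j.
  by apply: fine_ge0; apply: integral_ge0 => w _; rewrite lee_fin.
pose A2 := \sum_i c2 i; pose A3 := \sum_i \sum_(j | j != i) c3 i j.
have A20 : 0 <= A2 by exact: sumr_ge0.
have A30 : 0 <= A3 by apply: sumr_ge0 => i _; exact: sumr_ge0.
exists (2 + 2 * c1 + 2 * A2 + 2 * (c1 * A2) + c1 * A3).
  by have := mulr_ge0 c10 A20; have := mulr_ge0 c10 A30; lra.
move=> K m.
have K0 : 0 <= K%:R :> R by [].
have HNn (n : nat) : measurable_fun (setT : set TJ)
    (fun w => (n < grid_changes J w K m)%N%:R : R).
  rewrite (_ : (fun w => _) = \1_[set w : TJ | n%:R < N K m w]).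
    by apply: measurable_indic; apply: measurable_set_ltr => //; exact: mNJ.
  by apply/funext => w; rewrite indicE /N; congr (nat_of_bool _)%:R;
    rewrite -(ltr_nat R); apply/esym/asboolb.
pose p (n : nat) : R := fine (\int[P]_w ((n < grid_changes J w K m)%N%:R)%:E)%E.
have Hp (n : nat) : mean_le P (fun w => (n < grid_changes J w K m)%N%:R : R) (p n).
  split => //; first by apply: measurable_fun_chain.
  rewrite fineK// ge0_fin_numE; last by apply: integral_ge0 => w _; rewrite lee_fin.
  have [h1 h2 h3] := mean_le_cst P (ler01 : 0 <= 1 :> R).
  apply: le_lt_trans (ltry 1); apply: le_trans h3; apply: ge0_le_integral => //.
  - by apply/measurable_EFinP; exact: measurable_fun_chain.
  - by apply/measurable_EFinP.
  - by move=> w _; rewrite lee_fin/=; case: (n < _)%N.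
have p0 n : 0 <= p n by apply: fine_ge0; apply: integral_ge0 => w _; rewrite lee_fin.
(* The mean of the number of changes is the sum of the probabilities of its
exceeding n. *)
have psum : \sum_(n < K * m.+1) p n <= K%:R * c1.
  have [_ _] := HN K m; rewrite -lee_fin -sumEFin; apply: le_trans.
  have -> : (\int[P]_w (N K m w)%:E =
     \int[P]_w \sum_(n < K * m.+1) ((n < grid_changes J w K m)%N%:R)%:E)%E.
    apply: eq_integral => w _; rewrite sumEFin; congr _%:E.
    rewrite -natr_sum; congr _%:R.
    have gle := grid_changes_le K m w.
    rewrite -(big_mkord predT (fun n => nat_of_bool (n < grid_changes J w K m)%N)).
    rewrite (@big_cat_nat _ _ _ (grid_changes J w K m))//=.
    rewrite big_nat (eq_bigr (fun=> 1%N)) => [|i /andP[_ ->]//].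
    rewrite -big_nat sum_nat_const_nat subn0 muln1 big_nat big1 ?addn0// => i /andP[h _].
    by rewrite ltnNge h.
  rewrite ge0_integral_sum//; last first.
    by move=> n; apply/measurable_EFinP; case: (Hp n).
  apply: lee_sum => n _; rewrite fineK//.
  rewrite ge0_fin_numE; last by apply: integral_ge0 => w _; rewrite lee_fin.
  by case: (Hp n) => _ _ h; apply: le_lt_trans h _; rewrite ltry.
have mean : mean_le P (map_majorant K m)
   (2 + 2 * (K%:R * c1) + (\sum_i \sum_(k < K) 2 * c2 i) +
    (\sum_i \sum_(k < K) 2 * (K%:R * c1 * c2 i)) +
    \sum_i \sum_(j | j != i) \sum_(n < K * m.+1) p n * c3 i j).
  rewrite /map_majorant; apply: mean_leD; first apply: mean_leD; first apply: mean_leD.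
  - apply: (@mean_leD _ _ _ _ (cst 2)); first exact: mean_le_cst.
    exact: mean_leZ.
  - by apply: mean_le_sum => i _; apply: mean_le_sum => k _; exact: mean_leZ.
  - apply: mean_le_sum => i _; apply: mean_le_sum => k _; apply: mean_leZ => //.
    apply: mean_leM => //; last by rewrite mulr_ge0.
    apply: (@indep_J_L i) => //; first by case: (HN K m).
      by case: (Ho i k m).
    exact: levy_osc_measurable_L.
  - apply: mean_le_sum => i _; apply: mean_le_sum => j ji; apply: mean_le_sum => n _.
    have ij : i != j by rewrite eq_sym.
    apply: mean_leM => //; last exact: HU.
    apply: (@indep_J_U i j n) => //; first by case: (Hp n).
      by case: (HU i j n ij).
    apply: measurableT_comp; first exact: normr_measurable.
    by move=> _ B mB; rewrite setTI; apply: sub_sigma_algebra; exists B.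
apply: mean_leW mean.
have -> : \sum_i \sum_(k < K) 2 * c2 i = 2 * K%:R * A2.
  rewrite /A2 mulr_sumr; apply: eq_bigr => i _.
  by rewrite sumr_const card_ord -mulr_natl; ring.
have -> : \sum_i \sum_(k < K) 2 * (K%:R * c1 * c2 i) = 2 * K%:R * K%:R * c1 * A2.
  rewrite /A2 mulr_sumr; apply: eq_bigr => i _.
  by rewrite sumr_const card_ord -mulr_natl; ring.
have H3 : \sum_i \sum_(j | j != i) \sum_(n < K * m.+1) p n * c3 i j <= K%:R * c1 * A3.
  rewrite /A3 mulr_sumr; apply: ler_sum => i _; rewrite mulr_sumr; apply: ler_sum => j _.
  by rewrite -mulr_suml ler_wpM2r.
apply: le_trans (lerD (lexx _) H3) _.
have h1 : 0 <= c1 * A2 by rewrite mulr_ge0.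
have h2 : 0 <= c1 * A3 by rewrite mulr_ge0.
have k1 : 0 <= K%:R * c1 by rewrite mulr_ge0.
have k2 : 0 <= K%:R * A2 by rewrite mulr_ge0.
have k3 : 0 <= K%:R * (c1 * A2) by rewrite mulr_ge0.
have k4 : 0 <= K%:R * (c1 * A3) by rewrite mulr_ge0.
have kk : 0 <= K%:R * K%:R :> R by rewrite mulr_ge0.
have l1 : 0 <= K%:R * K%:R * c1 by rewrite mulr_ge0.
have l2 : 0 <= K%:R * K%:R * A2 by rewrite mulr_ge0.
have l3 : 0 <= K%:R * K%:R * (c1 * A2) by rewrite mulr_ge0.
have l4 : 0 <= K%:R * K%:R * (c1 * A3) by rewrite mulr_ge0.
by rewrite expr2; nra.
Qed.

(** The majorants dominate |X t| for all fine grids, so Fatou's lemma transfers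
the bound on their means. *)
Theorem map_abs_mean : exists2 C : R, 0 <= C &
  forall t : R, 0 <= t -> (\int[P]_w (`|X t w|)%:E <= (C * (2 + t) ^+ 2)%:E)%E.
Proof.
have [C C0 HC] := map_majorant_mean; exists C => // t t0.
pose K := (Num.truncn t).+1.
have tK : t < K%:R by exact: truncnS_gt.
apply: (@le_trans _ _ (\int[P]_w limn_einf (fun m => (map_majorant K m w)%:E))%E).
  apply: ge0_le_integral => //.
  - by apply/measurable_EFinP; apply: measurableT_comp => //; exact: normr_measurable.
  - apply: measurableT_comp => //; apply: measurable_fun_limn_esup => m.
    by apply: measurableT_comp => //; apply/measurable_EFinP; case: (HC K m).
  move=> w _; apply: limn_einf_ge.
  by have := map_majorant_ge w t0 tK; apply: filterS => m; rewrite lee_fin.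
apply: le_trans (fatou _ _ _ _) _ => //.
- by move=> m; apply/measurable_EFinP; case: (HC K m).
- by move=> m w _; rewrite lee_fin; case: (HC K m).
apply: limn_einf_le => m; have [_ _ h] := HC K m; apply: le_trans h _.
rewrite lee_fin ler_wpM2l// lerXn2r// ?nnegrE ?addr_ge0//.
rewrite /K -natr1; have : (Num.truncn t)%:R <= t by rewrite truncn_le.
lra.
Qed.

End MapMean.

(** * Complex exponential and complex integrals *)

Section ComplexParts.
Context {R : realType}.
Implicit Types z w : R[i].

Lemma cReD z w : Re (z + w) = Re z + Re w. Proof. by case: z w => [a b] [c d]. Qed.
Lemma cImD z w : Im (z + w) = Im z + Im w. Proof. by case: z w => [a b] [c d]. Qed.
Lemma cReN z : Re (- z) = - Re z. Proof. by case: z. Qed.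
Lemma cImN z : Im (- z) = - Im z. Proof. by case: z. Qed.
Lemma cReM z w : Re (z * w) = Re z * Re w - Im z * Im w.
Proof. by case: z w => [a b] [c d]. Qed.
Lemma cImM z w : Im (z * w) = Re z * Im w + Im z * Re w.
Proof. by case: z w => [a b] [c d]. Qed.
Lemma cRe_sum (I : Type) (s : seq I) (p : pred I) (f : I -> R[i]) :
  Re (\sum_(i <- s | p i) f i) = \sum_(i <- s | p i) Re (f i).
Proof. by elim/big_rec2: _ => // i x y _ <-; rewrite cReD. Qed.
Lemma cIm_sum (I : Type) (s : seq I) (p : pred I) (f : I -> R[i]) :
  Im (\sum_(i <- s | p i) f i) = \sum_(i <- s | p i) Im (f i).
Proof. by elim/big_rec2: _ => // i x y _ <-; rewrite cImD. Qed.
Lemma complex_eq z w : Re z = Re w -> Im z = Im w -> z = w.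
Proof. by case: z w => [a b] [c d] /= -> ->. Qed.

(** The l1 norm of the plane is submultiplicative, equivalent to the modulus
and free of square roots. *)
Definition norm1c z : R := `|Re z| + `|Im z|.

Lemma norm1c_ge0 z : 0 <= norm1c z. Proof. by rewrite addr_ge0. Qed.

Lemma norm1c_Re z : `|Re z| <= norm1c z. Proof. by rewrite lerDl. Qed.
Lemma norm1c_Im z : `|Im z| <= norm1c z. Proof. by rewrite lerDr. Qed.

Lemma norm1cM z w : norm1c (z * w) <= norm1c z * norm1c w.
Proof.
rewrite /norm1c cReM cImM.
have := ler_normB (Re z * Re w) (Im z * Im w).
have := ler_normD (Re z * Im w) (Im z * Re w).
by rewrite !normrM mulrDl !mulrDr; lra.
Qed.

Lemma norm1c_real (x : R) : norm1c x%:C = `|x|.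
Proof. by rewrite /norm1c/= normr0 addr0. Qed.

Lemma normc_le_norm1c z : `|z| <= (norm1c z)%:C.
Proof.
rewrite normc_def lecR; apply: (@le_trans _ _ (Num.sqrt (norm1c z ^+ 2))).
  apply: ler_wsqrtr; rewrite /norm1c sqrrD !real_normK ?num_real//.
  by rewrite -addrA lerD2l lerDr mulrn_wge0// mulr_ge0.
by rewrite sqrtr_sqr ger0_norm// norm1c_ge0.
Qed.

Lemma norm1c_le_normc z : exists2 r : R, `|z| = r%:C & norm1c z <= 2 * r.
Proof.
rewrite normc_def; set r := Num.sqrt _; exists r => //.
have h1 : `|Re z| <= r.
  by rewrite -sqrtr_sqr ler_wsqrtr// lerDl sqr_ge0.
have h2 : `|Im z| <= r.
  by rewrite -sqrtr_sqr ler_wsqrtr// lerDr sqr_ge0.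
by rewrite /norm1c; lra.
Qed.

End ComplexParts.

Section ExpBounds.
Context {R : realType}.
Implicit Types (a b x : R) (z w : R[i]).

Lemma expR_sub1_le a : `|expR a - 1| <= `|a| * expR `|a|.
Proof.
have e1 : expR a - 1 <= a * expR a.
  have := expR_ge1Dx (- a); have := expR_gt0 a; have : expR a * expR (- a) = 1.
    by rewrite -expRD subrr expR0.
  by set u := expR a; set v := expR (- a) => ? ? ?; nra.
have e2 := expR_ge1Dx a.
have [a0|a0] := leP 0 a.
  by rewrite [`|expR a - 1|]ger0_norm ?(ger0_norm a0); lra.
rewrite ltr0_norm ?subr_lt0 ?expR_lt1// (ltr0_norm a0).
have : 1 <= expR (- a) by rewrite -[1]expR0 ler_expR; lra.
by nra.
Qed.

Lemma expR_taylor1 a : `|expR a - 1 - a| <= a ^+ 2 * expR `|a|.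
Proof.
have e2 := expR_ge1Dx a.
rewrite ger0_norm; last by lra.
have e1 : expR a - 1 - a <= a * (expR a - 1).
  have := expR_ge1Dx (- a); have := expR_gt0 a; have : expR a * expR (- a) = 1.
    by rewrite -expRD subrr expR0.
  by set u := expR a; set v := expR (- a) => ? ? ?; nra.
apply: le_trans e1 _; apply: le_trans (ler_norm _) _.
rewrite normrM -[a ^+ 2]real_normK ?num_real// expr2 -mulrA ler_wpM2l//.
exact: expR_sub1_le.
Qed.

Lemma abs_sin_le x : `|sin x| <= `|x|.
Proof.
wlog x0 : x / 0 <= x.
  move=> H; have [x0|x0] := leP 0 x; first exact: H.
  by rewrite -[`|sin x|]normrN -sinN -[`|x|]normrN; apply: H; lra.
move: x0; rewrite le_eqVlt => /predU1P[<-|x0]; first by rewrite sin0 !normr0.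
have [c _] := @MVT_segment R sin cos 0 x (ltW x0) (fun x _ => is_derive_sin x)
  (continuous_subspaceT (@continuous_sin R)).
rewrite sin0 !subr0 => ->; rewrite normrM ler_piMl//.
exact: cos_max.
Qed.

Lemma cos_taylor0 x : `|cos x - 1| <= `|x|.
Proof.
have -> : cos x - 1 = - (2 * sin (x / 2) ^+ 2).
  have E : x = (x / 2) *+ 2 by rewrite -mulr_natr divfK// pnatr_eq0.
  by rewrite {1}E cos_mulr2n cos2sin2; ring.
rewrite normrN normrM [`|2|]ger0_norm// normrX expr2.
have h1 := abs_sin_le (x / 2); have h2 := sin_max (x / 2).
have h3 : `|x / 2| = `|x| / 2 by rewrite normrM [`|2^-1|]ger0_norm.
have h4 := normr_ge0 (sin (x / 2)).
by rewrite h3 in h1; nra.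
Qed.

Lemma cos_taylor1 x : `|cos x - 1| <= x ^+ 2.
Proof.
have -> : cos x - 1 = - (2 * sin (x / 2) ^+ 2).
  have E : x = (x / 2) *+ 2 by rewrite -mulr_natr divfK// pnatr_eq0.
  by rewrite {1}E cos_mulr2n cos2sin2; ring.
rewrite normrN normrM [`|2|]ger0_norm// normrX.
have h1 := abs_sin_le (x / 2).
have h3 : `|x / 2| = `|x| / 2 by rewrite normrM [`|2^-1|]ger0_norm.
have h4 := normr_ge0 (sin (x / 2)).
have h5 := normr_ge0 x.
rewrite -[x ^+ 2]real_normK ?num_real//; rewrite h3 in h1.
by rewrite !expr2; nra.
Qed.

Lemma sin_taylor1 x : `|sin x - x| <= x ^+ 2.
Proof.
wlog x0 : x / 0 <= x.
  move=> H; have [x0|x0] := leP 0 x; first exact: H.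
  have := H (- x); rewrite sinN sqrrN -opprD normrN; apply; lra.
have d (c : R) : is_derive c 1 (fun x => sin x - x) (cos c - 1) by apply: is_deriveB.
have cont : continuous (fun x : R => sin x - x).
  by move=> c; apply: cvgB; [exact: continuous_sin|exact: cvg_id].
have [c] := @MVT_segment R (fun x => sin x - x) (fun c => cos c - 1) 0 x x0 (fun x _ => d x)
  (continuous_subspaceT cont).
rewrite in_itv/= sin0 !subr0 => /andP[c0 cx] ->; rewrite normrM.
have := cos_taylor0 c; rewrite [`|c|]ger0_norm// [`|x|]ger0_norm// expr2 => h.
by rewrite ler_wpM2r//; lra.
Qed.

Lemma cexpD z w : cexp (z + w) = cexp z * cexp w.
Proof.
case: z w => [a b] [c d]; rewrite /cexp/=; apply: complex_eq => /=;
  rewrite expRD ?cosD ?sinD; ring.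
Qed.

Lemma norm1c_cexp z : norm1c (cexp z) <= 2 * expR (Re z).
Proof.
rewrite /norm1c/= !normrM ger0_norm ?expR_ge0//.
have := cos_max (Im z); have := sin_max (Im z); have := expR_ge0 (Re z); nra.
Qed.

(** The remainder in z^2 is what the differentiation of Laplace transforms
requires. *)
Lemma cexp_taylor1 z : norm1c (cexp z - 1 - z) <= 6 * norm1c z ^+ 2 * expR (norm1c z).
Proof.
case: z => a b; rewrite /norm1c /cexp/=.
have a0 := normr_ge0 a; have b0 := normr_ge0 b.
set r := `|a| + `|b|.
have Er : expR `|a| <= expR r by rewrite ler_expR lerDl.
have Ea : expR a <= expR r by apply: le_trans Er; rewrite ler_expR ler_norm.
have e0 := expR_gt0 a; have e0r := expR_gt0 r.
have e1r : 1 <= expR r by rewrite -[1]expR0 ler_expR addr_ge0.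
have ar : a ^+ 2 <= r ^+ 2 by rewrite -[a ^+ 2]real_normK ?num_real// lerXn2r ?nnegrE ?addr_ge0// lerDl.
have br : b ^+ 2 <= r ^+ 2 by rewrite -[b ^+ 2]real_normK ?num_real// lerXn2r ?nnegrE ?addr_ge0// lerDr.
have r20 := sqr_ge0 r.
have abr : `|a| * `|b| <= r ^+ 2.
  by rewrite /r; nra.
have H1 : `|expR a * cos b - 1 - a| <= 2 * r ^+ 2 * expR r.
  have -> : expR a * cos b - 1 - a = (expR a - 1 - a) + expR a * (cos b - 1) by ring.
  apply: le_trans (ler_normD _ _) _; rewrite normrM [`|expR a|]ger0_norm ?expR_ge0//.
  have h1 := expR_taylor1 a; have h2 := cos_taylor1 b.
  have h3 : a ^+ 2 * expR `|a| <= r ^+ 2 * expR r.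
    by apply: ler_pM; rewrite ?sqr_ge0 ?expR_ge0.
  have h4 : expR a * `|cos b - 1| <= expR r * r ^+ 2.
    by apply: ler_pM; rewrite ?expR_ge0 ?normr_ge0// (le_trans h2).
  by lra.
have H2 : `|expR a * sin b - 0 - b| <= 2 * r ^+ 2 * expR r.
  have -> : expR a * sin b - 0 - b = expR a * (sin b - b) + b * (expR a - 1) by ring.
  apply: le_trans (ler_normD _ _) _; rewrite !normrM [`|expR a|]ger0_norm ?expR_ge0//.
  have h1 := expR_sub1_le a; have h2 := sin_taylor1 b.
  have h4 : expR a * `|sin b - b| <= expR r * r ^+ 2.
    by apply: ler_pM; rewrite ?expR_ge0 ?normr_ge0// (le_trans h2).
  have h5 : `|b| * `|expR a - 1| <= `|b| * (`|a| * expR r).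
    by rewrite ler_wpM2l//; apply: le_trans h1 _; rewrite ler_wpM2l.
  have h6 : `|b| * (`|a| * expR r) <= r ^+ 2 * expR r.
    by rewrite mulrA ler_wpM2r ?expR_ge0// mulrC.
  by lra.
by have : 0 <= r ^+ 2 * expR r; [rewrite mulr_ge0// ltW|lra].
Qed.

End ExpBounds.

Section CIntegral.
Context {R : realType}.
Local Notation mu := (@lebesgue_measure R).
Variable D : set R.
Hypothesis mD : measurable D.

(** Measurability and integrability of the two parts, as cintegral is defined
by parts. *)
Definition cmeasurable (f : R -> R[i]) : Prop :=
  measurable_fun setT (fun y => Re (f y)) /\ measurable_fun setT (fun y => Im (f y)).

Lemma cmeasurable_cst c : cmeasurable (fun=> c).
Proof. by split. Qed.

Lemma cmeasurable_real (g : R -> R) : measurable_fun setT g -> cmeasurable (fun y => (g y)%:C).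
Proof. by split. Qed.

Lemma cmeasurableM f g : cmeasurable f -> cmeasurable g -> cmeasurable (fun y => f y * g y).
Proof.
move=> [f1 f2] [g1 g2]; split.
  by under eq_fun do rewrite cReM; apply: measurable_funB; exact: measurable_funM.
by under eq_fun do rewrite cImM; apply: measurable_funD; exact: measurable_funM.
Qed.

Lemma cmeasurableD f g : cmeasurable f -> cmeasurable g -> cmeasurable (fun y => f y + g y).
Proof.
move=> [f1 f2] [g1 g2]; split.
  by under eq_fun do rewrite cReD; exact: measurable_funD.
by under eq_fun do rewrite cImD; exact: measurable_funD.
Qed.

Lemma cmeasurableN f : cmeasurable f -> cmeasurable (fun y => - f y).
Proof.
move=> [f1 f2]; split.
  by under eq_fun do rewrite cReN; exact: measurableT_comp.
by under eq_fun do rewrite cImN; exact: measurableT_comp.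
Qed.

Lemma cmeasurable_cexp f : cmeasurable f -> cmeasurable (fun y => cexp (f y)).
Proof.
move=> [f1 f2]; split; apply: measurable_funM.
- exact: measurableT_comp.
- apply: measurableT_comp f2; apply: continuous_measurable_fun; exact: continuous_cos.
- exact: measurableT_comp.
- apply: measurableT_comp f2; apply: continuous_measurable_fun; exact: continuous_sin.
Qed.

Lemma cmeasurable_cexp_lin (eta : R[i]) : cmeasurable (fun y => cexp (- (eta * y%:C))).
Proof.
apply: cmeasurable_cexp; apply: cmeasurableN; apply: cmeasurableM.
  exact: cmeasurable_cst.
exact: cmeasurable_real.
Qed.

Definition cintegrable (f : R -> R[i]) : Prop :=
  mu.-integrable D (EFin \o (fun y => Re (f y))) /\
  mu.-integrable D (EFin \o (fun y => Im (f y))).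

Lemma cintegrable_bound f (g : R -> R) : cmeasurable f ->
  mu.-integrable D (EFin \o g) -> (forall y, D y -> norm1c (f y) <= g y) -> cintegrable f.
Proof.
move=> [f1 f2] ig fg; split; apply: (@le_integrable _ _ _ mu D mD _ (EFin \o g)) => //.
- by apply/measurable_EFinP; exact: measurable_funTS.
- move=> y Dy /=; rewrite lee_fin; apply: le_trans (ler_norm _); apply: le_trans (fg _ Dy).
  by rewrite lerDl.
- by apply/measurable_EFinP; exact: measurable_funTS.
- move=> y Dy /=; rewrite lee_fin; apply: le_trans (ler_norm _); apply: le_trans (fg _ Dy).
  by rewrite lerDr.
Qed.

Lemma cintegrableZ c f : cintegrable f -> cintegrable (fun y => c * f y).
Proof.
move=> [f1 f2]; split.
  rewrite (_ : _ \o _ = (fun y => (Re c)%:E * (Re (f y))%:E - (Im c)%:E * (Im (f y))%:E)%E).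
    by apply: integrableB => //; exact: integrableZl.
  by apply/funext => y /=; rewrite cReM EFinB !EFinM.
rewrite (_ : _ \o _ = (fun y => (Re c)%:E * (Im (f y))%:E + (Im c)%:E * (Re (f y))%:E)%E).
  by apply: integrableD => //; exact: integrableZl.
by apply/funext => y /=; rewrite cImM EFinD !EFinM.
Qed.

Lemma cintegrableD f g : cintegrable f -> cintegrable g -> cintegrable (fun y => f y + g y).
Proof.
move=> [f1 f2] [g1 g2]; split.
  rewrite (_ : _ \o _ = (fun y => (Re (f y))%:E + (Re (g y))%:E)%E); first exact: integrableD.
  by apply/funext => y /=; rewrite cReD EFinD.
rewrite (_ : _ \o _ = (fun y => (Im (f y))%:E + (Im (g y))%:E)%E); first exact: integrableD.
by apply/funext => y /=; rewrite cImD EFinD.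
Qed.

Lemma cintegralD f g : cintegrable f -> cintegrable g ->
  cintegral D (fun y => f y + g y) = cintegral D f + cintegral D g.
Proof.
move=> [f1 f2] [g1 g2]; apply: complex_eq; rewrite ?cReD ?cImD /cintegral/=.
  by under eq_Rintegral do rewrite cReD; rewrite RintegralD.
by under eq_Rintegral do rewrite cImD; rewrite RintegralD.
Qed.

Lemma cintegralZ c f : cintegrable f ->
  cintegral D (fun y => c * f y) = c * cintegral D f.
Proof.
move=> [f1 f2]; have Z k (g : R -> R) : mu.-integrable D (EFin \o g) ->
    mu.-integrable D (EFin \o (fun y => k * g y)).
  by move=> ig; rewrite (_ : _ \o _ = (fun y => k%:E * (g y)%:E)%E)//; exact: integrableZl.
apply: complex_eq; rewrite ?cReM ?cImM /cintegral/=.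
  under eq_Rintegral do rewrite cReM.
  by rewrite RintegralB ?RintegralZl//; exact: Z.
under eq_Rintegral do rewrite cImM.
by rewrite RintegralD ?RintegralZl//; exact: Z.
Qed.

Lemma cintegral_sum (I : Type) (s : seq I) (f : I -> R -> R[i]) :
  (forall i, cintegrable (f i)) ->
  cintegrable (fun y => \sum_(i <- s) f i y) /\
  cintegral D (fun y => \sum_(i <- s) f i y) = \sum_(i <- s) cintegral D (f i).
Proof.
move=> fi; elim: s => [|i s [IH1 IH2]].
  under eq_fun do rewrite big_nil; rewrite big_nil; split.
    by split; exact: integrable0.
  apply: complex_eq; rewrite /cintegral/= /Rintegral.
    by under eq_integral do rewrite /=; rewrite integral0.
  by under eq_integral do rewrite /=; rewrite integral0.
under eq_fun do rewrite big_cons; rewrite big_cons; split.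
  exact: cintegrableD.
by rewrite cintegralD// IH2.
Qed.

Lemma norm1c_cintegral f (g : R -> R) : cintegrable f ->
  mu.-integrable D (EFin \o g) -> (forall y, D y -> norm1c (f y) <= g y) ->
  norm1c (cintegral D f) <= 2 * \int[mu]_(y in D) g y.
Proof.
move=> [f1 f2] ig fg; rewrite /norm1c/=.
have key (u : R -> R) : mu.-integrable D (EFin \o u) -> (forall y, D y -> `|u y| <= g y) ->
    `|\int[mu]_(y in D) u y| <= \int[mu]_(y in D) g y.
  move=> iu ug; apply: (@le_trans _ _ (\int[mu]_(y in D) `|u y|)); first exact: le_normr_Rintegral.
  apply: le_Rintegral => //.
  by have := integrable_abse iu; apply: eq_integrable.
rewrite mulr_natl mulr2n; apply: lerD; apply: key => // y Dy.
  exact: le_trans (norm1c_Re (f y)) (fg y Dy).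
exact: le_trans (norm1c_Im (f y)) (fg y Dy).
Qed.

End CIntegral.

(** * Laplace transforms of bounded functions *)

Section PowExp.
Context {R : realType}.
Local Notation mu := (@lebesgue_measure R).
Local Notation D := (`[0%R, +oo[%classic : set R).

Lemma exp_integrable (a : R) : 0 < a ->
  mu.-integrable D (EFin \o (fun y => expR (- (a * y)))).
Proof.
move=> a0.
have i1 : mu.-integrable D (EFin \o exponential_pdf a).
  by apply: integrableS (integrable_exponential_pdf a0).
have i2 : mu.-integrable D (fun y => (a^-1)%:E * (EFin \o exponential_pdf a) y)%E.
  exact: integrableZl.
apply: eq_integrable i2 => //= y; rewrite inE/= in_itv/= andbT => y0.
by rewrite exponential_pdfE// -EFinM mulrA mulVf ?gt_eqF// mul1r mulNr.
Qed.

(** Half of the exponential rate absorbs the power. *)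
Lemma pow_exp_le (a : R) (k : nat) : 0 < a ->
  exists2 C : R, 0 <= C & forall y, 0 <= y -> y ^+ k * expR (- (a * y)) <= C * expR (- (a / 2 * y)).
Proof.
move=> a0; case: k => [|k].
  exists 1 => // y y0; rewrite expr0 !mul1r ler_expR; nra.
have c0 : 0 < a / 2 by lra.
exists (k.+1`!%:R / (a / 2) ^+ k.+1) => [|y y0]; first by rewrite divr_ge0// exprn_ge0// ltW.
have -> : expR (- (a * y)) = expR (- (a / 2 * y)) * expR (- (a / 2 * y)).
  by rewrite -expRD; congr expR; lra.
rewrite mulrA ler_wpM2r ?expR_ge0// expRN ler_pdivrMr ?expR_gt0//.
rewrite mulrAC ler_pdivlMr ?exprn_gt0//.
have := @expR_ge1Dxn R (a / 2 * y) k (mulr_ge0 (ltW c0) y0).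
have f0 : 0 < k.+1`!%:R :> R by rewrite ltr0n fact_gt0.
rewrite -(ler_pM2l f0) mulrDr mulr1 mulrCA mulfV ?gt_eqF// mulr1 exprMn.
by rewrite [y ^+ _ * _]mulrC; lra.
Qed.

Lemma pow_exp_integrable (a : R) (k : nat) : 0 < a ->
  mu.-integrable D (EFin \o (fun y => y ^+ k * expR (- (a * y)))).
Proof.
move=> a0; have [C C0 HC] := pow_exp_le k a0.
have a20 : 0 < a / 2 by lra.
apply: (@le_integrable _ _ _ mu D _ _ (fun y => C%:E * (EFin \o (fun y => expR (- (a / 2 * y)))) y)%E) => //.
- apply/measurable_EFinP; apply: measurable_funTS; apply: measurable_funM.
    exact: measurable_funX.
  apply: measurableT_comp => //; apply: measurableT_comp => //; exact: measurable_funM.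
- move=> y; rewrite /= in_itv/= andbT => y0; rewrite lee_fin.
  rewrite ger0_norm ?mulr_ge0 ?exprn_ge0 ?expR_ge0//.
  by apply: le_trans (HC _ y0) _; rewrite ler_norm.
- by apply: integrableZl => //; exact: exp_integrable.
Qed.

Lemma norm1c_cexp_lin (eta : R[i]) (y : R) :
  norm1c (cexp (- (eta * y%:C))) <= 2 * expR (- (Re eta * y)).
Proof.
apply: le_trans (norm1c_cexp _) _.
by rewrite cReN cReM /= mulr0 subr0.
Qed.

End PowExp.

Section LaplaceTransform.
Context {R : realType}.
Local Notation mu := (@lebesgue_measure R).
Local Notation D := (`[0%R, +oo[%classic : set R).
Variable h : R -> R.
Hypothesis mh : measurable_fun setT h.
Hypothesis h01 : forall y, 0 <= h y <= 1.

Definition laplace (eta : R[i]) : R[i] :=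
  cintegral D (fun y => cexp (- (eta * y%:C)) * (h y)%:C).

(** The derivative of the transform, by differentiation under the integral
sign. *)
Definition laplace_deriv (eta : R[i]) : R[i] :=
  cintegral D (fun y => - y%:C * cexp (- (eta * y%:C)) * (h y)%:C).

Let mD : measurable D. Proof. exact: measurable_itv. Qed.

Let norm_h y : norm1c ((h y)%:C) <= 1.
Proof. by rewrite norm1c_real ger0_norm; case/andP: (h01 y). Qed.

Let h0 y : 0 <= h y. Proof. by case/andP: (h01 y). Qed.

Let cm_exp_h eta : cmeasurable (fun y => cexp (- (eta * y%:C)) * (h y)%:C).
Proof. by apply: cmeasurableM; [exact: cmeasurable_cexp_lin|exact: cmeasurable_real]. Qed.

Lemma laplace_integrable eta : 0 < Re eta ->
  cintegrable D (fun y => cexp (- (eta * y%:C)) * (h y)%:C).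
Proof.
move=> eta0.
have i1 : mu.-integrable D (fun y => 2%:E * (EFin \o (fun y => expR (- (Re eta * y)))) y)%E.
  by apply: integrableZl => //; exact: exp_integrable.
apply: (cintegrable_bound mD (cm_exp_h eta) (g := fun y => 2 * expR (- (Re eta * y)))).
  exact: i1.
move=> y _; apply: le_trans (norm1cM _ _) _; rewrite -[leRHS]mulr1.
by apply: ler_pM; rewrite ?norm1c_ge0// norm1c_cexp_lin.
Qed.

Let cm_yexp_h eta : cmeasurable (fun y => - y%:C * cexp (- (eta * y%:C)) * (h y)%:C).
Proof.
apply: cmeasurableM; last exact: cmeasurable_real.
apply: cmeasurableM; last exact: cmeasurable_cexp_lin.
by apply: cmeasurableN; exact: cmeasurable_real.
Qed.

Lemma laplace_deriv_integrable eta : 0 < Re eta ->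
  cintegrable D (fun y => - y%:C * cexp (- (eta * y%:C)) * (h y)%:C).
Proof.
move=> eta0.
have i1 : mu.-integrable D (fun y : R => (2%:E * (y ^+ 1 * expR (- (Re eta * y)))%:E)%E).
  by apply: integrableZl => //; exact: pow_exp_integrable.
apply: (cintegrable_bound mD (cm_yexp_h eta) (g := fun y => 2 * (y ^+ 1 * expR (- (Re eta * y))))).
  exact: i1.
move=> y; rewrite /= in_itv/= andbT => y0.
apply: le_trans (norm1cM _ _) _; rewrite -[leRHS]mulr1.
apply: ler_pM; rewrite ?norm1c_ge0//.
apply: le_trans (norm1cM _ _) _; rewrite expr1 mulrCA; apply: ler_pM; rewrite ?norm1c_ge0//.
  by rewrite /norm1c/= oppr0 normr0 addr0 normrN ger0_norm.
exact: norm1c_cexp_lin.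
Qed.

(** The remainder in the expansion of e^{-sy} is at most a constant times |s|^2
y^2 e^{|s| y}; for |s| at most half of Re eta it is integrable against e^{- eta
y}. *)
Lemma laplace_taylor eta : 0 < Re eta -> exists2 M : R, 0 <= M &
  forall s : R[i], norm1c s <= Re eta / 2 ->
    norm1c (laplace (s + eta) - laplace eta - s * laplace_deriv eta) <= M * norm1c s ^+ 2.
Proof.
move=> eta0; set rho := Re eta in eta0 *.
have rho2 : 0 < rho / 2 by lra.
pose I2 := \int[mu]_(y in D) (y ^+ 2 * expR (- (rho / 2 * y))).
have I20 : 0 <= I2.
  apply: Rintegral_ge0 => y; rewrite /= in_itv/= andbT => y0.
  by rewrite mulr_ge0 ?exprn_ge0 ?expR_ge0.
have iI2 := pow_exp_integrable 2 rho2.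
(* 2 from the modulus of the exponential, 6 from its expansion, 2 from the
integral of a complex function. *)
exists (24 * I2); first by rewrite mulr_ge0.
move=> s hs.
have rs : 0 < Re (s + eta).
  rewrite cReD; have := norm1c_Re s; rewrite ler_norml => /andP[]; rewrite -/rho; lra.
have e1 := laplace_integrable rs; have e2 := laplace_integrable eta0.
have e3 := laplace_deriv_integrable eta0.
have E : laplace (s + eta) - laplace eta - s * laplace_deriv eta =
   cintegral D (fun y => cexp (- (eta * y%:C)) *
     (cexp (- (s * y%:C)) - 1 - (- (s * y%:C))) * (h y)%:C).
  have j1 := cintegrableZ mD (-1) e2; have j2 := cintegrableZ mD (- s) e3.
  have j3 := cintegrableD mD e1 j1.
  rewrite (_ : (fun y => _) = (fun y =>
     cexp (- ((s + eta) * y%:C)) * (h y)%:C + -1 * (cexp (- (eta * y%:C)) * (h y)%:C) +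
     - s * (- y%:C * cexp (- (eta * y%:C)) * (h y)%:C))).
    by rewrite (cintegralD mD j3 j2) (cintegralD mD e1 j1) (cintegralZ mD _ e2)
      (cintegralZ mD _ e3) mulN1r mulNr.
  apply/funext => y.
  by rewrite (_ : - ((s + eta) * y%:C) = - (eta * y%:C) + - (s * y%:C)) ?cexpD; ring.
rewrite E.
have bd y : D y -> norm1c (cexp (- (eta * y%:C)) *
     (cexp (- (s * y%:C)) - 1 - (- (s * y%:C))) * (h y)%:C) <=
     12 * norm1c s ^+ 2 * (y ^+ 2 * expR (- (rho / 2 * y))).
  rewrite /= in_itv/= andbT => y0.
  apply: le_trans (norm1cM _ _) _; rewrite -[leRHS]mulr1.
  apply: ler_pM; rewrite ?norm1c_ge0//.
  apply: le_trans (norm1cM _ _) _.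
  have h1 := norm1c_cexp_lin eta y; rewrite -/rho in h1.
  have h2 := cexp_taylor1 (- (s * y%:C)).
  have nsy : norm1c (- (s * y%:C)) = norm1c s * y.
    by rewrite /norm1c cReN cImN cReM cImM /= !mulr0 subr0 add0r !normrN !normrM (ger0_norm y0) mulrDl.
  rewrite nsy in h2.
  have h3 : expR (norm1c s * y) <= expR (rho / 2 * y) by rewrite ler_expR ler_wpM2r.
  apply: (@le_trans _ _ (2 * expR (- (rho * y)) * (6 * (norm1c s * y) ^+ 2 * expR (rho / 2 * y)))).
    apply: ler_pM; rewrite ?norm1c_ge0//; apply: le_trans h2 _.
    by rewrite ler_wpM2l// mulr_ge0// sqr_ge0.
  rewrite le_eqVlt; apply/orP; left; apply/eqP.
  have -> : expR (- (rho / 2 * y)) = expR (- (rho * y)) * expR (rho / 2 * y).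
    by rewrite -expRD; congr expR; lra.
  by ring.
have iG : mu.-integrable D (EFin \o (fun y => 12 * norm1c s ^+ 2 * (y ^+ 2 * expR (- (rho / 2 * y))))).
  have iG0 : mu.-integrable D (fun y : R =>
      ((12 * norm1c s ^+ 2)%:E * (y ^+ 2 * expR (- (rho / 2 * y)))%:E)%E).
    by apply: integrableZl => //; exact: iI2.
  exact: iG0.
have cm : cmeasurable (fun y => cexp (- (eta * y%:C)) *
     (cexp (- (s * y%:C)) - 1 - (- (s * y%:C))) * (h y)%:C).
  have cmsy : cmeasurable (fun y => - (s * y%:C)).
    by apply: cmeasurableN; apply: cmeasurableM; [exact: cmeasurable_cst|exact: cmeasurable_real].
  apply: cmeasurableM; last exact: cmeasurable_real.
  apply: cmeasurableM; first exact: cmeasurable_cexp_lin.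
  apply: cmeasurableD; last exact: cmeasurableN.
  apply: cmeasurableD; first exact: cmeasurable_cexp.
  exact: cmeasurable_cst.
have ci := cintegrable_bound mD cm iG bd.
apply: le_trans (norm1c_cintegral mD ci iG bd) _.
rewrite RintegralZl// -/I2 le_eqVlt; apply/orP; left; apply/eqP; ring.
Qed.

Lemma derive1_laplace eta : 0 < Re eta ->
  derive1 (laplace : R[i] -> R[i]^o) eta = laplace_deriv eta.
Proof.
move=> eta0; have [M M0 HM] := laplace_taylor eta0.
rewrite /derive1; apply: cvg_lim; first exact: norm_hausdorff.
apply/cvgrPdist_le => e e0.
have [r r0 er] : exists2 r : R, 0 < r & e = r%:C.
  by case: e e0 => a b; rewrite ltcE/= => /andP[/eqP-> a0]; exists a.
(* The l1 norm is at most twice the modulus: this halves the radius Re eta / 2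
of the expansion and gives the factor 4 = 2^2 in the remainder. *)
pose dl : R := Num.min (Re eta / 4) (r / (4 * M + 4)).
have dl0 : 0 < dl.
  rewrite lt_min; apply/andP; split; first lra.
  by rewrite divr_gt0//; lra.
apply/nbhs_ballP; exists dl%:C => /=; first by rewrite ltcR.
move=> s; rewrite /ball/= sub0r normrN => sd s0.
have [t tE ts] := norm1c_le_normc s.
rewrite tE ltcR in sd; have [sd1 sd2] : t < Re eta / 4 /\ t < r / (4 * M + 4).
  by apply/andP; rewrite -lt_min.
have HMs : norm1c (laplace (s + eta) - laplace eta - s * laplace_deriv eta) <=
  M * norm1c s ^+ 2 by apply: HM; lra.
change (`|laplace_deriv eta - s^-1 * (laplace (s + eta) - laplace eta)| <= e).
have -> : laplace_deriv eta - s^-1 * (laplace (s + eta) - laplace eta) =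
   - (s^-1 * (laplace (s + eta) - laplace eta - s * laplace_deriv eta)).
  by rewrite [s^-1 * (_ - s * _)]mulrBr [s^-1 * (s * _)]mulrA mulVf// mul1r opprB.
rewrite normrN normrM normfV mulrC ler_pdivrMr ?normr_gt0//.
apply: le_trans (normc_le_norm1c _) _; rewrite tE er -rmorphM/= lecR.
apply: le_trans HMs _.
have n0 := norm1c_ge0 s.
have t0 : 0 <= t by lra.
have h1 : M * norm1c s ^+ 2 <= M * (2 * t) ^+ 2.
  by rewrite ler_wpM2l// lerXn2r// ?nnegrE// mulr_ge0.
apply: le_trans h1 _.
have h2 : t * (4 * M + 4) <= r by rewrite -ler_pdivlMr ?ltW//; lra.
by rewrite exprMn expr2; nra.
Qed.

Hypothesis ih : mu.-integrable D (EFin \o h).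

(** The integral of x e^{- eta x} over [0, y]: the distribution function of the
Gamma law of shape 2, divided by eta^2. *)
Definition gamma_kernel (eta : R[i]) (y : R) : R[i] :=
  (1 - (1 + eta * y%:C) * cexp (- (eta * y%:C))) / eta ^+ 2.

(** Expand the kernel: its three terms have the transforms at 0 and at eta and
the derivative at eta. *)
Lemma laplace_combination (zeta eta : R[i]) : 0 < Re eta ->
  cintegrable D (fun y => zeta * gamma_kernel eta y * (h y)%:C) /\
  zeta / eta ^+ 2 * (laplace 0 - laplace eta + eta * laplace_deriv eta) =
  cintegral D (fun y => zeta * gamma_kernel eta y * (h y)%:C).
Proof.
move=> eta0.
have i0 : cintegrable D (fun y => cexp (- (0 * y%:C)) * (h y)%:C).
  have -> : (fun y => cexp (- (0 * y%:C)) * (h y)%:C) = (fun y => (h y)%:C).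
    apply/funext => y; rewrite mul0r oppr0.
    by apply: complex_eq; rewrite ?cReM ?cImM/= expR0 cos0 sin0; ring.
  by split => //; exact: integrable0.
have i1 := laplace_integrable eta0; have i2 := laplace_deriv_integrable eta0.
have j1 := cintegrableZ mD (-1) i1; have j2 := cintegrableZ mD eta i2.
have j3 := cintegrableD mD i0 j1; have j4 := cintegrableD mD j3 j2.
have E y : zeta * gamma_kernel eta y * (h y)%:C = zeta / eta ^+ 2 *
  (cexp (- (0 * y%:C)) * (h y)%:C + -1 * (cexp (- (eta * y%:C)) * (h y)%:C) +
   eta * (- y%:C * cexp (- (eta * y%:C)) * (h y)%:C)).
  rewrite mul0r oppr0; have -> : cexp 0 = 1 :> R[i].
    by apply: complex_eq; rewrite /= expR0 ?cos0 ?sin0 mul1r.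
  by rewrite /gamma_kernel; ring.
rewrite (funext E); split; first exact: cintegrableZ.
rewrite (cintegralZ mD _ j4) (cintegralD mD j3 j2) (cintegralD mD i0 j1).
by rewrite (cintegralZ mD _ i1) (cintegralZ mD _ i2) mulN1r.
Qed.

End LaplaceTransform.

Lemma Re_cexp (R : realType) (z : R[i]) : Re (cexp z) = expR (Re z) * cos (Im z).
Proof. by []. Qed.
Lemma Im_cexp (R : realType) (z : R[i]) : Im (cexp z) = expR (Re z) * sin (Im z).
Proof. by []. Qed.

Section GammaKernel.
Context {R : realType}.
Local Notation mu := (@lebesgue_measure R).

(** The fundamental theorem of calculus for the real part; imaginary parts are
reached by multiplying zeta by -i. *)
Lemma gamma_kernel_primitive (zeta eta : R[i]) (y : R) : 0 < Re eta -> 0 < y ->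
  (\int[mu]_(x in `[0%R, y]) (x * Re (zeta * cexp (- (eta * x%:C))))%:E =
   (Re (zeta * gamma_kernel eta y))%:E)%E.
Proof.
move=> eta0 y0.
have etaN0 : eta != 0 by apply/eqP => e; rewrite e ltxx in eta0.
pose a := Re eta; pose b := Im eta.
have [k kdef] : exists k, k = zeta / eta ^+ 2 by exists (zeta / eta ^+ 2).
have kE : zeta = k * eta ^+ 2 by rewrite kdef divfK// expf_neq0.
pose Af (x : R) : R := expR (- (a * x)) * ((1 + a * x) * cos (b * x) + b * x * sin (b * x)).
pose Bf (x : R) : R := expR (- (a * x)) * (b * x * cos (b * x) - (1 + a * x) * sin (b * x)).
pose F (x : R) : R := - (Re k * Af x - Im k * Bf x).
pose f (x : R) : R := x * Re (zeta * cexp (- (eta * x%:C))).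
have ReE (x : R) : Re (- (eta * x%:C)) = - (a * x).
  by rewrite cReN cReM mulr0 subr0.
have ImE (x : R) : Im (- (eta * x%:C)) = - (b * x).
  by rewrite cImN cImM mulr0 add0r.
have fE x : f x = x * (expR (- (a * x)) *
    ((Re zeta) * cos (b * x) + (Im zeta) * sin (b * x))).
  by rewrite /f cReM Re_cexp Im_cexp ReE ImE cosN sinN; ring.
have dF (x : R) : is_derive x 1 F (f x).
  have d1 : is_derive x 1 (fun x : R => a * x) a.
    by apply: is_derive_eq; rewrite /GRing.scale/= mulr1.
  have d2 : is_derive x 1 (fun x : R => b * x) b.
    by apply: is_derive_eq; rewrite /GRing.scale/= mulr1.
  have dE : is_derive x 1 (fun x : R => expR (- (a * x))) (- a * expR (- (a * x))).
    have d3 : is_derive x 1 (fun x : R => - (a * x)) (- a) by apply: is_deriveN.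
    by have := @is_derive1_comp _ expR (fun x : R => - (a * x)) x _ _ (is_derive_expR _) d3;
      rewrite mulrC.
  have dc : is_derive x 1 (fun x : R => cos (b * x)) (- b * sin (b * x)).
    have := @is_derive1_comp _ cos (fun x : R => b * x) x _ _ (is_derive_cos _) d2.
    by have -> : - sin (b * x) * b = - b * sin (b * x) by ring.
  have ds : is_derive x 1 (fun x : R => sin (b * x)) (b * cos (b * x)).
    have := @is_derive1_comp _ sin (fun x : R => b * x) x _ _ (is_derive_sin _) d2.
    by rewrite mulrC.
  rewrite fE kE /F /Af /Bf; apply: is_derive_eq.
  rewrite /GRing.scale/= expr2 !(cReM, cImM) -/a -/b.
  ring.
rewrite (@continuous_FTC2 _ f F 0 y)//.
- have -> : F 0 = - Re k.
    by rewrite /F /Af /Bf !mulr0 oppr0 expR0 cos0 sin0; ring.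
  rewrite -EFinB; congr _%:E.
  have -> : zeta * gamma_kernel eta y = k * (1 - (1 + eta * y%:C) * cexp (- (eta * y%:C))).
    by rewrite /gamma_kernel kdef; ring.
  rewrite [in RHS]cReM !cReD !cImD !cReN !cImN [Re (_ * cexp _)]cReM [Im (_ * cexp _)]cImM.
  rewrite !cReD !cImD cReM cImM Re_cexp Im_cexp ReE ImE cosN sinN /F /Af /Bf /=; ring.
- apply: continuous_subspaceT => x.
  have -> : f = (fun x => x * (expR (- (a * x)) *
    ((Re zeta) * cos (b * x) + (Im zeta) * sin (b * x)))) by apply/funext => z; exact: fE.
  apply: cvgM; first exact: cvg_id.
  apply: cvgM.
    apply: (@continuous_comp _ _ _ (fun x : R => - (a * x)) expR); last exact: continuous_expR.
    by apply: cvgN; apply: cvgM; [exact: cvg_cst|exact: cvg_id].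
  have cb : (fun x : R => b * x) @ x --> b * x by apply: cvgM; [exact: cvg_cst|exact: cvg_id].
  apply: cvgD; apply: cvgM; try exact: cvg_cst.
    exact: (@continuous_comp _ _ _ (fun x : R => b * x) cos x cb (@continuous_cos R _)).
  exact: (@continuous_comp _ _ _ (fun x : R => b * x) sin x cb (@continuous_sin R _)).
- have cF : continuous F.
    by move=> x; apply/differentiable_continuous/derivable1_diffP; apply: (@ex_derive _ _ _ _ _ _ _ (dF x)).
  split.
  + by move=> x _; apply: (@ex_derive _ _ _ _ _ _ _ (dF x)).
  + exact/cvg_at_right_filter/cF.
  + exact/cvg_at_left_filter/cF.
- by move=> x _; rewrite derive1E; exact: (@derive_val _ _ _ _ _ _ _ (dF x)).
Qed.

End GammaKernel.

(** * One-sided derivatives and densities *)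

Section DerivGe0.
Context {R : realType}.
Implicit Types (f g : R -> R) (x : R).

(** The one-sided derivative sees the function on the half-line only; needed to
iterate it. *)
Lemma deriv_ge0_eq f g x : 0 <= x -> (forall y, 0 <= y -> f y = g y) ->
  deriv_ge0 f x = deriv_ge0 g x.
Proof.
move=> x0 fg; rewrite /deriv_ge0; congr (lim _).
have E : \forall y \near within [set y | 0 <= y /\ y != x] (nbhs x),
    (f y - f x) / (y - x) = (g y - g x) / (y - x).
  by rewrite near_withinE; apply: nearW => y [y0 _]; rewrite !fg.
by apply/seteqP; split; apply: near_eq_cvg; apply: filterS E => y ->.
Qed.

(** A quadratic error bound identifies the derivative, at the end point too. *)
Lemma deriv_ge0_quadratic f x (l M : R) : 0 <= x ->
  (forall y, 0 <= y -> `|f y - f x - (y - x) * l| <= M * (y - x) ^+ 2) ->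
  deriv_ge0 f x = l.
Proof.
move=> x0 H; rewrite /deriv_ge0.
have PF : ProperFilter (within [set y | 0 <= y /\ y != x] (nbhs x)).
  apply: Build_ProperFilter_ex => A [e /= e0 HA].
  exists (x + e / 2); apply: HA => /=.
    by rewrite opprD addrA subrr sub0r normrN ger0_norm; lra.
  by split; [lra|apply/eqP; lra].
apply: cvg_lim; first exact: norm_hausdorff.
apply/cvgrPdist_le => e e0.
have M1 : 0 < `|M| + 1 by have := normr_ge0 M; lra.
exists (e / (`|M| + 1)); first by rewrite /= divr_gt0.
move=> y /= xy [y0 yx].
have yx0 : y - x != 0 by rewrite subr_eq0.
have -> : l - (f y - f x) / (y - x) = - ((f y - f x - (y - x) * l) / (y - x)).
  by field.
rewrite normrN normrM normfV ler_pdivrMr ?normr_gt0//.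
apply: le_trans (H y y0) _.
rewrite -[(y - x) ^+ 2]real_normK ?num_real// expr2 mulrA ler_wpM2r//.
have h : `|x - y| * (`|M| + 1) < e by rewrite -ltr_pdivlMr.
rewrite distrC in h; have := ler_norm M; have := normr_ge0 (y - x); have := normr_ge0 M.
by nra.
Qed.

Lemma exp_quadratic (x y q : R) : 0 <= x -> 0 <= y -> 0 <= q ->
  `|expR (- y * q) - expR (- x * q) - (y - x) * (- (q * expR (- x * q)))| <=
  q ^+ 2 * (y - x) ^+ 2.
Proof.
move=> x0 y0 q0.
set A := expR (- x * q); set B := expR (- y * q).
have A0 : 0 < A by exact: expR_gt0.
have B0 : 0 < B by exact: expR_gt0.
have A1 : A <= 1 by rewrite -[1]expR0 ler_expR; nra.
have B1 : B <= 1 by rewrite -[1]expR0 ler_expR; nra.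
set u := (y - x) * q.
have BA : B = A * expR (- u).
  by rewrite /A /B /u -expRD; congr expR; lra.
have AB : A = B * expR u.
  by rewrite /A /B /u -expRD; congr expR; lra.
have h1 : A * (1 - u) <= B by rewrite BA; apply: ler_wpM2l; [exact: ltW|exact: expR_ge1Dx].
have h2 : B * (1 + u) <= A by rewrite [leRHS]AB; apply: ler_wpM2l; [exact: ltW|exact: expR_ge1Dx].
have -> : B - A - (y - x) * - (q * A) = B - A + u * A by rewrite /u; ring.
have -> : q ^+ 2 * (y - x) ^+ 2 = u ^+ 2 by rewrite /u; ring.
rewrite ger0_norm; last by lra.
have h3 : B - A + u * A <= u * (A - B) by lra.
apply: le_trans h3 _; rewrite expr2.
have [u0|u0] := leP 0 u; nra.
Qed.

Context {disp : measure_display} {Omega : measurableType disp}.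
Variables (P : probability Omega R) (D : set Omega) (Q : Omega -> R).
Hypothesis mD : measurable D.
Hypothesis mQ : measurable_fun setT Q.
Hypothesis Q0 : forall w, 0 <= Q w.

(** The weight f makes the family stable under differentiation, which
multiplies f by - Q. *)
Definition weighted_laplace (f : Omega -> R) (a : R) : R :=
  \int[P]_(w in D) (f w * expR (- a * Q w)).

Let integrable_exp (f : Omega -> R) (a : R) : measurable_fun setT f -> 0 <= a ->
  P.-integrable D (EFin \o f) -> P.-integrable D (EFin \o (fun w => f w * expR (- a * Q w))).
Proof.
move=> mf a0 fi; apply: (@le_integrable _ _ _ P D mD _ (EFin \o f)) => //.
- apply/measurable_EFinP; apply: measurable_funTS; apply: measurable_funM => //.
  by apply: measurableT_comp => //; exact: measurable_funM.
- move=> w _ /=; rewrite lee_fin normrM ler_piMr// ger0_norm ?expR_ge0//.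
  by rewrite -[1]expR0 ler_expR; have := Q0 w; nra.
Qed.

(** The second-order remainder of the exponential is at most (y - x)^2 Q^2, and
f Q^2 is integrable. *)
Lemma deriv_ge0_weighted_laplace (f : Omega -> R) (x : R) :
  measurable_fun setT f -> 0 <= x ->
  P.-integrable D (EFin \o f) ->
  P.-integrable D (EFin \o (fun w => f w * Q w)) ->
  P.-integrable D (EFin \o (fun w => f w * Q w ^+ 2)) ->
  deriv_ge0 (weighted_laplace f) x = weighted_laplace (fun w => - (f w * Q w)) x.
Proof.
move=> mf x0 i0 i1 i2.
have mfQ : measurable_fun setT (fun w => - (f w * Q w)).
  by apply: measurableT_comp => //; exact: measurable_funM.
have i1N : P.-integrable D (EFin \o (fun w => - (f w * Q w))).
  by rewrite (_ : _ \o _ = (fun w => - (f w * Q w)%:E)%E)//; exact: integrableN.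
have i2a : P.-integrable D (EFin \o (fun w => `|f w * Q w ^+ 2|)).
  by have := integrable_abse i2; apply: eq_integrable.
apply: (@deriv_ge0_quadratic _ _ _ (\int[P]_(w in D) `|f w * Q w ^+ 2|)) => // y y0.
have e1 := integrable_exp mf y0 i0; have e2 := integrable_exp mf x0 i0.
have e3 := integrable_exp mfQ x0 i1N.
have e4 : P.-integrable D (EFin \o (fun w => (y - x) * (- (f w * Q w) * expR (- x * Q w)))).
  have h : P.-integrable D (fun w => ((y - x)%:E * (- (f w * Q w) * expR (- x * Q w))%:E)%E).
    by apply: integrableZl => //; exact: e3.
  exact: h.
have e12 : P.-integrable D (EFin \o (fun w => f w * expR (- y * Q w) - f w * expR (- x * Q w))).
  rewrite (_ : _ \o _ = (fun w => (f w * expR (- y * Q w))%:E - (f w * expR (- x * Q w))%:E)%E)//.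
  exact: integrableB.
have e5 : P.-integrable D (EFin \o (fun w => f w * expR (- y * Q w) - f w * expR (- x * Q w) -
     (y - x) * (- (f w * Q w) * expR (- x * Q w)))).
  rewrite (_ : _ \o _ = (fun w => (f w * expR (- y * Q w) - f w * expR (- x * Q w))%:E -
     ((y - x) * (- (f w * Q w) * expR (- x * Q w)))%:E)%E)//.
  exact: integrableB.
rewrite /weighted_laplace -(RintegralZl _ mD e3) -(RintegralB mD e1 e2) -(RintegralB mD e12 e4).
apply: (@le_trans _ _ (\int[P]_(w in D) `|f w * expR (- y * Q w) - f w * expR (- x * Q w) -
     (y - x) * (- (f w * Q w) * expR (- x * Q w))|)); first exact: le_normr_Rintegral.
rewrite mulrC -(RintegralZl _ mD i2a).
apply: le_Rintegral => //.
- by have := integrable_abse e5; apply: eq_integrable.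
- have h : P.-integrable D (fun w => (((y - x) ^+ 2)%:E * (`|f w * Q w ^+ 2|)%:E)%E).
    by apply: integrableZl => //; exact: i2a.
  exact: h.
move=> w _.
have -> : f w * expR (- y * Q w) - f w * expR (- x * Q w) -
     (y - x) * (- (f w * Q w) * expR (- x * Q w)) =
   f w * (expR (- y * Q w) - expR (- x * Q w) - (y - x) * (- (Q w * expR (- x * Q w)))) by ring.
rewrite normrM [`|f w * _|]normrM mulrCA ler_wpM2l//.
apply: le_trans (exp_quadratic x0 y0 (Q0 w)) _.
by rewrite mulrC [`|Q w ^+ 2|]ger0_norm ?sqr_ge0.
Qed.

End DerivGe0.

Section Density.
Context {R : realType} {d0 : measure_display} {T0 : measurableType d0}.
Variable m : {measure set T0 -> \bar R}.
Local Notation mu := (@lebesgue_measure R).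
Local Open Scope ereal_scope.
Import HBNNSimple.

(** Equality on indicators is the hypothesis; monotone convergence extends it.
*)
Lemma ge0_integral_density (S : set T0) (V : T0 -> R) (D : set R) (p F : R -> R) :
  measurable S -> measurable_fun setT V -> measurable D ->
  measurable_fun setT p -> (forall x, 0 <= p x)%R ->
  measurable_fun setT F -> (forall x, 0 <= F x)%R ->
  (forall B, measurable B -> B `<=` D ->
     m (S `&` V @^-1` B) = \int[mu]_(x in B) (p x)%:E) ->
  \int[m]_(w in S `&` V @^-1` D) (F (V w))%:E = \int[mu]_(x in D) (F x * p x)%:E.
Proof.
move=> mS mV mD mp p0 mF F0 H.
have mVB B : measurable B -> measurable (V @^-1` B).
  by move=> mB; rewrite -[X in measurable X]setTI; exact: mV.
have mSD : measurable (S `&` V @^-1` D) by apply: measurableI => //; exact: mVB.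
have mEF : measurable_fun setT (EFin \o F) by exact/measurable_EFinP.
pose f_ := nnsfun_approx measurableT mEF.
have fF x : (f_ n x)%:E @[n --> \oo] --> (F x)%:E.
  by apply: (cvg_nnsfun_approx measurableT mEF) => // y _; rewrite lee_fin.
have fnd x m1 m2 : (m1 <= m2)%N -> (f_ m1 x <= f_ m2 x)%R.
  by move=> h; exact/lefP/nd_nnsfun_approx.
have fmeas n : measurable_fun setT (f_ n) by exact: measurable_funP.
transitivity (limn (fun n => \int[m]_(w in S `&` V @^-1` D) (f_ n (V w))%:E)).
  rewrite -monotone_convergence//.
  - by apply: eq_integral => w _; apply/esym/cvg_lim => //; exact: fF.
  - by move=> n; apply/measurable_EFinP; apply: measurable_funTS; exact: measurableT_comp.
  - by move=> n w _; rewrite lee_fin.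
  - by move=> w _ m1 m2 m12; rewrite lee_fin; exact: fnd.
transitivity (limn (fun n => \int[mu]_(x in D) (f_ n x * p x)%:E)); last first.
  rewrite -monotone_convergence//.
  - apply: eq_integral => x _; apply/cvg_lim => //.
    rewrite EFinM; under eq_fun do rewrite EFinM.
    by apply: cvgeZr => //; exact: fF.
  - by move=> n; apply/measurable_EFinP; apply: measurable_funTS; apply: measurable_funM;
      [exact: fmeas|exact: mp].
  - by move=> n w _; rewrite lee_fin mulr_ge0.
  - by move=> w _ m1 m2 m12; rewrite lee_fin ler_wpM2r//; exact: fnd.
congr (limn _); apply/funext => n; set g := f_ n.
have mgk k : measurable (g @^-1` [set k]) by exact: measurable_funPTI.
transitivity (\sum_(k \in range g)
    \int[m]_(w in S `&` V @^-1` D) (k * \1_(g @^-1` [set k]) (V w))%:E).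
  rewrite -ge0_integral_fsum//.
  - by apply: eq_integral => w _; rewrite fsumEFin// -fimfunE.
  - move=> k; apply/measurable_EFinP; apply: measurable_funTS; apply: measurable_funM => //.
    by apply: (measurableT_comp (measurable_indic (mgk k))).
  - by move=> k w _; rewrite nnfun_muleindic_ge0.
transitivity (\sum_(k \in range g)
    \int[mu]_(x in D) (k * \1_(g @^-1` [set k]) x * p x)%:E); last first.
  rewrite -ge0_integral_fsum//.
  - apply: eq_integral => x _; rewrite fsumEFin//; congr _%:E.
    by rewrite [in RHS](fimfunE g) -mulr_fsuml.
  - move=> k; apply/measurable_EFinP; apply: measurable_funTS; apply: measurable_funM => //.
    by apply: measurable_funM; [exact: measurable_cst|exact: (measurable_indic (mgk k))].
  - move=> k x _; rewrite EFinM mule_ge0//; first by rewrite nnfun_muleindic_ge0.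
    by rewrite lee_fin.
apply: eq_fsbigr => k; rewrite inE => -[x _ gx].
have k0 : (0 <= k)%R by rewrite -gx.
under eq_integral do rewrite EFinM.
rewrite ge0_integralZl//; last first.
  apply/measurable_EFinP; apply: measurable_funTS.
  by apply: (measurableT_comp (measurable_indic (mgk k))).
under [in RHS]eq_integral do rewrite -mulrA EFinM.
rewrite ge0_integralZl//; last 2 first.
- apply/measurable_EFinP; apply: measurable_funTS; apply: measurable_funM;
    [exact: (measurable_indic (mgk k))|exact: mp].
- by move=> w _; rewrite lee_fin mulr_ge0.
congr (_ * _).
rewrite (_ : (fun w => (\1_(g @^-1` [set k]) (V w))%:E) =
   (fun w => (\1_(V @^-1` (g @^-1` [set k])) w)%:E)); last first.
  by apply/funext => w; rewrite !indicE.
rewrite integral_indic//; last exact: mVB.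
rewrite (_ : V @^-1` _ `&` _ = S `&` V @^-1` (D `&` g @^-1` [set k])); last first.
  by rewrite preimage_setI setIC setIA.
rewrite (H _ (measurableI _ _ mD (mgk k)) (@subIsetl _ _ _)).
rewrite integral_mkcondr; apply: eq_integral => y _.
by rewrite patchE indicE; case: ifP => yg; rewrite ?mul1r ?mul0r.
Qed.

End Density.

(** * The clock, the paths and the initial workload *)

Section CondProbability.
Context {R : realType} {disp : measure_display} {Omega : measurableType disp}.
Variable P : probability Omega R.
Local Open Scope ereal_scope.

(** Conditional probability given A, bundled so that results on independence
under P can be applied under it. *)
Lemma exists_cond_probability (A : set Omega) (c : R) : measurable A ->
  (0 < c)%R -> P A = c%:E ->
  exists P' : probability Omega R,
    (forall B, measurable B -> P' B = (c^-1)%:E * P (A `&` B)) /\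
    (forall f : Omega -> \bar R, measurable_fun setT f -> (forall w, 0 <= f w) ->
       \int[P']_w f w = (c^-1)%:E * \int[P]_(w in A) f w).
Proof.
move=> mA c0 PA.
have k0 : (0 <= c^-1)%R by rewrite invr_ge0 ltW.
pose m := mscale (NngNum k0) (mrestr P mA).
have mT : m setT = 1%E.
  by rewrite /m/= /mscale/= /mrestr/= setTI PA -EFinM mulVf// gt_eqF.
pose P' : probability Omega R :=
  HB.pack m (Measure_isProbability.Build _ _ _ m mT).
exists P'; split=> [B mB|f mf f0].
  by rewrite setIC.
have -> : \int[P']_w f w = \int[m]_w f w by [].
by rewrite /m ge0_integral_mscale//= ge0_integral_mrestr.
Qed.

End CondProbability.

Section Setup.
Context {R : realType} {disp : measure_display} {Omega : measurableType disp}.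
Variables (P : probability Omega R) (d : nat) (q : 'M[R]_d).
Variables (L : 'I_d -> R -> {RV P >-> R}) (U : 'I_d -> 'I_d -> nat -> {RV P >-> R}).
Variables (J : R -> Omega -> 'I_d) (X : R -> {RV P >-> R}) (Q0 : {RV P >-> R}).
Variables (theta : R) (T : {RV P >-> R}).
Hypothesis HM : markov_additive q L U J X.
Hypothesis HS : stationary_workload J X Q0.
Hypothesis HT : exponential_clock J X Q0 theta T.

Let HJ := map_chain HM.
Let Jr w := @chain_rcont _ _ _ _ _ _ _ HJ w.
Let Jl w := @chain_llim _ _ _ _ _ _ _ HJ w.
Let Lr w i := @levy_rcont _ _ _ _ _ (map_levy HM i) w.
Let Ll w i := @levy_llim _ _ _ _ _ (map_levy HM i) w.

Lemma X_rcont w (t : R) : 0 <= t -> X s w @[s --> t^'+] --> X t w.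
Proof.
exact: (@map_path_rcont _ _ _ _ (fun i t => L i t) (fun i j n => U i j n) J (fun t => X t) w
  (@Jr w) (@Jl w) (@Lr w) (map_eq HM)).
Qed.

Lemma X_bounded w (t : R) : exists M : R, forall s : R, 0 <= s <= t -> `|X s w| <= M.
Proof.
exact: (@map_path_bounded _ _ _ _ (fun i t => L i t) (fun i j n => U i j n) J (fun t => X t) w
  (@Jr w) (@Jl w) (@Lr w) (@Ll w) (map_eq HM)).
Qed.

Lemma X_start w : X 0 w = 0.
Proof.
exact: (@map_path_0 _ _ _ _ (fun i t => L i t) (fun i j n => U i j n) J (fun t => X t) w
  (@Jr w) (map_eq HM)).
Qed.

Local Notation TM := (g_sigma_algebraType (map_events J X)).
Local Notation TG := (g_sigma_algebraType (rv_events Q0 `|` map_events J X)).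
Local Notation Ji i := [set w | J 0 w = i].

Lemma X_measurable_TM (t : R) : 0 <= t -> measurable_fun (setT : set TM) (X t : TM -> R).
Proof.
move=> t0 _ B mB; rewrite setTI; apply: sub_sigma_algebra; left.
by exists t => //; exists B.
Qed.

Lemma Ji_measurable_TM i : @measurable _ TM (Ji i).
Proof. by apply: sub_sigma_algebra; right; exists 0, i. Qed.

Lemma measurable_TG_TM : measurable_fun (setT : set TG) (id : TG -> TM).
Proof.
move=> _ B mB; rewrite setTI; apply: (smallest_sub _ _ mB).
  exact: sigma_algebra_measurable.
by move=> A HA; apply: sub_sigma_algebra; right.
Qed.

Lemma measurable_Omega_TG : measurable_fun setT (id : Omega -> TG).
Proof.
move=> _ B mB; rewrite setTI; apply: (smallest_sub _ _ mB).
  exact: sigma_algebra_measurable.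
move=> A [[C mC ->]|[[t t0 [C mC ->]]|[t [i [t0 ->]]]]].
- exact: measurable_funPTI.
- exact: measurable_funPTI.
- exact: (chain_measurable HJ _ t0).
Qed.

Lemma Q0_measurable_TG : measurable_fun (setT : set TG) (Q0 : TG -> R).
Proof.
by move=> _ B mB; rewrite setTI; apply: sub_sigma_algebra; left; exists B.
Qed.

Lemma measurable_Ji i : measurable (Ji i).
Proof. exact: (chain_measurable HJ). Qed.

Lemma X_joint : measurable_fun setT (fun z : R * TM => X `|z.1| z.2).
Proof.
exact: (@joint_measurable _ _ TM (fun t w => X t w) X_measurable_TM X_rcont).
Qed.

(** The depth of the running infimum below the origin. The absolute value makes
it a function on the whole line, as the measurability results require. *)
Definition depth (t : R) (w : Omega) : R := - running_inf X `|t| w.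

Lemma depth_joint : measurable_fun setT (fun z : R * TM => depth z.1 z.2).
Proof.
apply: measurableT_comp => //.
exact: (@path_inf_measurable _ _ TM (fun t w => X t w) X_measurable_TM X_rcont X_bounded).
Qed.

Lemma depth_ge0 t w : 0 <= depth t w.
Proof.
rewrite oppr_ge0 -(X_start w).
by apply: (path_inf_le (X_bounded w)); rewrite lexx normr_ge0.
Qed.

Let T0 w : 0 <= T w. Proof. by case: HT. Qed.

(** The paths generate a smaller sigma-algebra than the paths with the initial
workload. *)
Lemma joint_TG d1 (T1 : measurableType d1) (F : R * TM -> T1) :
  measurable_fun setT F -> measurable_fun (setT : set (R * TG)) (F : R * TG -> T1).
Proof.
move=> mF.
have h : measurable_fun (setT : set (R * TG)) (fun z => (z.1, z.2 : TM)).
  by apply: measurable_fun_pair => //; exact: (measurableT_comp measurable_TG_TM measurable_snd).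
have := measurableT_comp mF h.
by rewrite (_ : F \o _ = F)//; apply/funext => -[].
Qed.

Lemma joint_path d1 (T1 : measurableType d1) (F : R * TG -> T1) :
  measurable_fun setT F -> measurable_fun setT (fun w => F (T w, w)).
Proof.
move=> mF.
have h : measurable_fun setT (fun w : Omega => (T w, w : TG)).
  by apply: measurable_fun_pair => //; exact: measurable_Omega_TG.
exact: measurableT_comp mF h.
Qed.

Let T_indep (A : set R) (B : set TG) : measurable A -> measurable B ->
  P (T @^-1` A `&` id @^-1` B) = (P (T @^-1` A) * P (id @^-1` B))%E.
Proof. by move=> mA mB; case: HT => _ _; apply => //; exists A. Qed.

(** The clock is independent of the pair of the initial workload and the paths:
integrate over the clock first. *)
Lemma clock_tonelli (F : R * TG -> \bar R) :
  measurable_fun setT F -> (forall z, (0 <= F z)%E) ->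
  (\int[P]_w F (T w, w) = \int[P]_v \int[P]_w F (T w, v))%E.
Proof.
move=> mF F0.
exact: (indep_tonelli (f := T) (g := id : Omega -> TG) _ measurable_Omega_TG T_indep mF F0).
Qed.

Lemma clock_tonelli_swap (F : R * TG -> \bar R) :
  measurable_fun setT F -> (forall z, (0 <= F z)%E) ->
  (\int[P]_w F (T w, w) = \int[P]_w \int[P]_v F (T w, v))%E.
Proof.
move=> mF F0.
pose F' (z : TG * R) := F (z.2, z.1).
have mF' : measurable_fun setT F' by apply: measurableT_comp => //; exact: measurable_swap.
have F'0 z : (0 <= F' z)%E by exact: F0.
apply: (indep_tonelli (P := P) (f := id : Omega -> TG) (g := T) measurable_Omega_TG _ _ mF' F'0) => //.
by move=> A B mA mB; rewrite setIC T_indep// muleC.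
Qed.

(** Given J 0 = i, the initial workload is independent of the paths, and the
clock is independent of both; thus it is independent of the pair of the clock
and the path. The factor P (Ji i) stands on the left in order to cover states
of probability zero. *)
Lemma cond_indep i (f : R -> R) (Phi : R * TM -> R) :
  measurable_fun setT f -> (forall x, 0 <= f x) ->
  measurable_fun setT Phi -> (forall z, 0 <= Phi z) ->
  (P (Ji i) * \int[P]_(w in Ji i) (f (Q0 w) * Phi (T w, w))%:E =
   (\int[P]_(w in Ji i) (f (Q0 w))%:E) * \int[P]_(w in Ji i) (Phi (T w, w))%:E)%E.
Proof.
move=> mf f0 mPhi Phi0; have mJ := measurable_Ji i.
have Pfin : P (Ji i) \is a fin_num by exact: fin_num_measure.
set c := fine (P (Ji i)); have cE : P (Ji i) = c%:E by rewrite fineK.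
have mfQ : measurable_fun setT (fun w => (f (Q0 w))%:E).
  by apply/measurable_EFinP; exact: measurableT_comp.
have mPhiT : measurable_fun setT (fun w => (Phi (T w, w))%:E).
  by apply/measurable_EFinP; exact: (joint_path (joint_TG mPhi)).
have [c0|c0] := leP c 0.
  have c00 : c = 0 by apply/eqP; rewrite eq_le c0 fine_ge0.
  have J0 : P (Ji i) = 0%E by rewrite cE c00.
  have z (g : Omega -> \bar R) : measurable_fun setT g -> (\int[P]_(w in Ji i) g w = 0)%E.
    by move=> mg; apply: null_set_integral => //; exact: measurable_funTS.
  by rewrite J0 mul0e (z _ mfQ) mul0e.
have [P' [P'E P'int]] := exists_cond_probability mJ c0 cE.
pose Y (w : Omega) : R * TG := (T w, w).
have mY : measurable_fun setT Y.
  by apply: measurable_fun_pair => //; exact: measurable_Omega_TG.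
pose YM (w : Omega) : R * TM := (T w, w).
have mYM : measurable_fun setT YM.
  apply: measurable_fun_pair => //.
  exact: (measurableT_comp measurable_TG_TM measurable_Omega_TG).
have ind (A : set R) (B : set (R * TM)) : measurable A -> measurable B ->
    P' (Q0 @^-1` A `&` YM @^-1` B) = (P' (Q0 @^-1` A) * P' (YM @^-1` B))%E.
  move=> mA mB.
  have mQA : measurable (Q0 @^-1` A) by exact: measurable_funPTI.
  have mYB : measurable (YM @^-1` B) by rewrite -[X in measurable X]setTI; exact: mYM.
  rewrite !P'E//; last exact: measurableI.
  have mQATG : @measurable _ TG (Q0 @^-1` A).
    by rewrite -[X in measurable X]setTI; exact: Q0_measurable_TG.
  have mJTG : @measurable _ TG (Ji i).
    by have := measurable_TG_TM measurableT (Ji_measurable_TM i); rewrite setTI.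
  have mBTG : @measurable _ (R * TG)%type (B : set (R * TG)).
    have h : measurable_fun (setT : set (R * TG)) (fun z => (z.1, z.2 : TM)).
      by apply: measurable_fun_pair => //; exact: (measurableT_comp measurable_TG_TM measurable_snd).
    have := h measurableT _ mB; rewrite setTI.
    by rewrite (_ : _ @^-1` B = B)//; apply/seteqP; split => -[].
  (* The conditional independence is known for events of the paths alone;
  sections at fixed values of the clock reduce to it. *)
  have dis (S : set Omega) : @measurable _ TG S ->
      P (S `&` YM @^-1` B) = (\int[P]_w P (S `&` [set v | B (T w, v)]))%E.
    move=> mS.
    pose G (z : R * TG) : R := \1_(snd @^-1` S `&` (B : set (R * TG))) z.
    have mSB : @measurable _ (R * TG)%type (snd @^-1` S `&` (B : set (R * TG))).
      apply: (@measurableI _ (R * TG)%type _ _ _ mBTG).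
      by have := @measurable_snd _ _ R TG measurableT S mS; rewrite setTI.
    have mG : measurable_fun setT (EFin \o G).
      by apply/measurable_EFinP; exact: measurable_indic.
    have := @clock_tonelli_swap (EFin \o G) mG (fun z => ltac:(by rewrite lee_fin)).
    rewrite (_ : (fun w => (EFin \o G) (T w, w)) = (fun w => (\1_(S `&` YM @^-1` B) w)%:E)); last first.
      by apply/funext => w; rewrite /= /G !indicE; congr (nat_of_bool _)%:R%:E;
        apply/idP/idP; rewrite !inE.
    have mSo : measurable S by have := measurable_Omega_TG measurableT mS; rewrite setTI.
    rewrite integral_indic//; last exact: measurableI.
    rewrite setIT => ->; apply: eq_integral => w _.
    rewrite (_ : (fun v => (EFin \o G) (T w, v)) = (fun v => (\1_(S `&` [set v | B (T w, v)]) v)%:E)).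
      rewrite integral_indic ?setIT//; apply: measurableI => //.
      have := measurable_Omega_TG measurableT (measurable_xsection (T w) mBTG).
      rewrite setTI /xsection; congr measurable.
      by apply/seteqP; split => v /=; rewrite inE.
    by apply/funext => v; rewrite /= /G !indicE; congr (nat_of_bool _)%:R%:E;
        apply/idP/idP; rewrite !inE.
  have msec t : @measurable _ TM [set v | B (t, v)].
    have := measurable_xsection t mB; rewrite /xsection; congr (@measurable _ TM _).
    by apply/seteqP; split => v /=; rewrite inE.
  have msecO t : measurable [set v | B (t, v)].
    have := measurable_TG_TM measurableT (msec t); rewrite setTI => h.
    by have := measurable_Omega_TG measurableT h; rewrite setTI.
  have mJQ : @measurable _ TG (Ji i `&` Q0 @^-1` A) by exact: measurableI.
  have E1 := dis _ mJQ; have E2 := dis _ mJTG.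
  have fP (S : set Omega) : measurable S -> P S \is a fin_num by move=> ?; exact: fin_num_measure.
  have mJQo : measurable (Ji i `&` Q0 @^-1` A) by exact: measurableI.
  have Psec_meas (S : set Omega) : @measurable _ TG S ->
      measurable_fun setT (fun w => P (S `&` [set v | B (T w, v)])).
    move=> mS.
    pose G (z : R * TG) : R := \1_(snd @^-1` S `&` (B : set (R * TG))) z.
    have mSB : @measurable _ (R * TG)%type (snd @^-1` S `&` (B : set (R * TG))).
      apply: (@measurableI _ (R * TG)%type _ _ _ mBTG).
      by have := @measurable_snd _ _ R TG measurableT S mS; rewrite setTI.
    pose PG : {mfun Omega >-> TG} := HB.pack (id : Omega -> TG)
      (isMeasurableFun.Build _ _ _ _ _ measurable_Omega_TG).
    have := measurable_fun_xsection (distribution P PG) mSB.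
    move=> h; have := measurableT_comp h (_ : measurable_fun setT T) => /(_ _)/=.
    rewrite (_ : _ \o _ = (fun w => P (S `&` [set v | B (T w, v)])))//; first exact.
    apply/funext => w; rewrite /= /distribution/= /pushforward/=; congr (P _).
    by apply/seteqP; split => v; rewrite /xsection/= inE/=.
  have key : (c%:E * P (Ji i `&` Q0 @^-1` A `&` YM @^-1` B) =
      P (Ji i `&` Q0 @^-1` A) * P (Ji i `&` YM @^-1` B))%E.
    rewrite E1 E2 -ge0_integralZl//; last 2 first.
    - exact: Psec_meas.
    - by rewrite lee_fin ltW.
    rewrite -ge0_integralZl//; last exact: Psec_meas.
    apply: eq_integral => w _.
    have := workload_cindep HS i mA (msec (T w)); rewrite -cE /=.
    rewrite muleC => H.
    rewrite (_ : Ji i `&` Q0 @^-1` A `&` [set v | B (T w, v)] =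
      Q0 @^-1` A `&` [set v | B (T w, v)] `&` Ji i); last by rewrite [RHS]setIC setIA.
    by rewrite H; congr (P _ * P _)%E; rewrite setIC.
  rewrite setIA.
  have fin1 := fP _ mJQo; have fin2 : P (Ji i `&` YM @^-1` B) \is a fin_num.
    by apply: fP; exact: measurableI.
  have fin3 : P (Ji i `&` Q0 @^-1` A `&` YM @^-1` B) \is a fin_num.
    by apply: fP; exact: measurableI.
  move: key; rewrite -(fineK fin1) -(fineK fin2) -(fineK fin3) -!EFinM => -[key].
  congr _%:E; rewrite mulrACA -key; field; exact: lt0r_neq0.
pose F (z : R * (R * TM)) : \bar R := (f z.1 * Phi z.2)%:E.
have mF : measurable_fun setT F.
  apply/measurable_EFinP; apply: measurable_funM.
    exact: (measurableT_comp mf measurable_fst).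
  exact: (measurableT_comp mPhi measurable_snd).
have F0 z : (0 <= F z)%E by rewrite lee_fin mulr_ge0.
have := indep_tonelli (P := P') (f := Q0) (g := YM) _ mYM ind mF F0.
move=> /(_ _)-/(_ ltac:(exact: measurable_funPT)).
under [in RHS]eq_integral => v _.
  under eq_integral do rewrite /F/= EFinM.
  rewrite ge0_integralZr ?lee_fin//; last by move=> w _; rewrite lee_fin.
  over.
rewrite ge0_integralZl//; last 2 first.
- by move=> v _; rewrite lee_fin.
- by apply: integral_ge0 => v _; rewrite lee_fin.
rewrite !P'int//; last 3 first.
- by move=> w; rewrite lee_fin.
- by move=> w; rewrite lee_fin.
- apply/measurable_EFinP; apply: measurable_funM; apply/measurable_EFinP.
    exact: mfQ.
  exact: mPhiT.
move=> H.
have c1 : (c%:E * (c^-1)%:E = 1)%E by rewrite -EFinM mulfV// lt0r_neq0.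
rewrite cE -[X in (c%:E * X)%E]mul1e -c1 -[in LHS]muleA H.
rewrite (muleACA c^-1%:E) !muleA -(muleA c%:E c%:E).
by rewrite c1 mule1 c1 mul1e.
Qed.

Lemma workload_joint : measurable_fun setT (fun z : R * TG => workload X Q0 `|z.1| z.2).
Proof.
apply: measurable_funD; first exact: (joint_TG X_joint).
apply: measurable_maxr; first exact: (measurableT_comp Q0_measurable_TG measurable_snd).
exact: (joint_TG depth_joint).
Qed.

(** The workload has the law of Q0 at each fixed time, hence at the independent
time T. *)
Lemma workload_clock_law (f : R -> \bar R) : measurable_fun setT f -> (forall x, (0 <= f x)%E) ->
  (\int[P]_w f (workload X Q0 (T w) w) = \int[P]_w f (Q0 w))%E.
Proof.
move=> mf f0.
pose F (z : R * TG) : \bar R := f (workload X Q0 `|z.1| z.2).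
have mF : measurable_fun setT F by exact: (measurableT_comp mf workload_joint).
have -> : (\int[P]_w f (workload X Q0 (T w) w) = \int[P]_w F (T w, w))%E.
  by apply: eq_integral => w _; rewrite /F/= ger0_norm.
rewrite (clock_tonelli_swap mF)//; last by move=> z; exact: f0.
have E w : (\int[P]_v F (T w, v) = \int[P]_v f (Q0 v))%E.
  have mW : measurable_fun setT (fun v : Omega => workload X Q0 `|T w| v).
    have h : measurable_fun setT (fun v : Omega => (T w, v : TG)).
      by apply: measurable_fun_pair => //; exact: measurable_Omega_TG.
    exact: (measurableT_comp workload_joint h).
  have [W WE] := exists_mfun mW.
  transitivity (\int[distribution P W]_x f x)%E.
    by rewrite ge0_integral_distribution// WE.
  transitivity (\int[distribution P Q0]_x f x)%E; last by rewrite ge0_integral_distribution.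
  apply: eq_measure_integral => B mB _.
  change (P (W @^-1` B) = P (Q0 @^-1` B)); rewrite WE.
  have dec (V : Omega -> R) (t : R) : 0 <= t -> measurable_fun setT V ->
     P (V @^-1` B) = (\sum_(i < d) P [set v | B (V v) /\ J t v = i])%E.
    move=> t0 mV.
    have -> : V @^-1` B = \big[setU/set0]_(i < d) [set v | B (V v) /\ J t v = i].
      rewrite -[RHS]bigcup_seq; apply/seteqP; split => [v Bv|v [i _ []]//].
      by exists (J t v) => //=; rewrite mem_index_enum.
    rewrite measure_bigsetU_ord//.
    - move=> i; apply: measurableI; last exact: (chain_measurable HJ).
      by rewrite -[X in measurable X]setTI; exact: mV.
    - by apply/trivIsetP => i j _ _ ij; apply/seteqP; split => // v [[_ /= e1] [_ /= e2]]; rewrite -e1 -e2 eqxx in ij.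
  rewrite (dec _ `|T w|)// (dec Q0 0)//.
  by apply: eq_bigr => i _; exact: (workload_stat HS i (normr_ge0 _) mB).
transitivity (\int[P]_w (cst (\int[P]_v f (Q0 v)) w))%E.
  by apply: eq_integral => w _; exact: E.
by move: (\int[P]_v f (Q0 v))%E => I0; rewrite -[RHS]mule1 -[1%E](probability_setT P) integral_cst.
Qed.

End Setup.

(** * Moments from a mixture of exponentials *)

(** The Lebesgue measure lives on a copy of the line whose Borel structure is
only convertible to the standard one; this and the next lemma are stated for
the latter. *)
Lemma lebesgue_integrableS (R : realType) (D E : set R) (f : R -> \bar R) :
  measurable D -> measurable E -> E `<=` D ->
  (@lebesgue_measure R).-integrable D f -> (@lebesgue_measure R).-integrable E f.
Proof.
move=> mD mE ED; apply: (@integrableS _ _ _ (@lebesgue_measure R)) => //.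
Qed.

Lemma lebesgue_integrable_fin_num (R : realType) (D : set R) (f : R -> \bar R) :
  measurable D -> (@lebesgue_measure R).-integrable D f ->
  (\int[@lebesgue_measure R]_(x in D) f x)%E \is a fin_num.
Proof. by move=> mD; apply: (@integrable_fin_num _ _ _ (@lebesgue_measure R)). Qed.

Section Mixture.
Context {R : realType} {disp : measure_display} {Omega : measurableType disp}.
Local Notation mu := (@lebesgue_measure R).
Local Notation D0 := (`]0%R, +oo[%classic : set R).
Variables (P : probability Omega R) (S : set Omega) (V : Omega -> R).
Variables (n : nat) (z eta : 'I_n -> R[i]).
Hypothesis mS : measurable S.
Hypothesis mV : measurable_fun setT V.
Hypothesis eta0 : forall j, 0 < Re (eta j).

Definition mixture (x : R) : R[i] := \sum_j z j * cexp (- (eta j * x%:C)).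

Hypothesis law : forall B : set R, measurable B -> B `<=` D0 ->
  (fine (P (S `&` V @^-1` B)))%:C = cintegral B mixture.

Let mD0 : measurable D0. Proof. exact: measurable_itv. Qed.

Let mV_pre (B : set R) : measurable B -> measurable (V @^-1` B).
Proof. by move=> mB; rewrite -[X in measurable X]setTI; exact: mV. Qed.

Lemma mixture_measurable : cmeasurable mixture.
Proof.
have h j : cmeasurable (fun x => z j * cexp (- (eta j * x%:C))).
  by apply: cmeasurableM; [exact: cmeasurable_cst|exact: cmeasurable_cexp_lin].
split.
  under eq_fun do rewrite /mixture cRe_sum.
  by apply: measurable_sum => j; case: (h j).
under eq_fun do rewrite /mixture cIm_sum.
by apply: measurable_sum => j; case: (h j).
Qed.

Let term_integrable (k : nat) j :
  cintegrable `[0, +oo[ (fun x => (x ^+ k)%:C * (z j * cexp (- (eta j * x%:C)))).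
Proof.
have mD : measurable (`[0, +oo[%classic : set R) by exact: measurable_itv.
have i1 : mu.-integrable `[0, +oo[
    (fun y : R => ((norm1c (z j) * 2)%:E * (y ^+ k * expR (- (Re (eta j) * y)))%:E)%E).
  by apply: integrableZl => //; exact: pow_exp_integrable.
have cm : cmeasurable (fun x : R => (x ^+ k)%:C * (z j * cexp (- (eta j * x%:C)))).
  apply: cmeasurableM; first by apply: cmeasurable_real; exact: measurable_funX.
  by apply: cmeasurableM; [exact: cmeasurable_cst|exact: cmeasurable_cexp_lin].
apply: (cintegrable_bound mD cm (g := fun y => (norm1c (z j) * 2) *
    (y ^+ k * expR (- (Re (eta j) * y))))); first exact: i1.
move=> y; rewrite /= in_itv/= andbT => y0.
apply: le_trans (norm1cM _ _) _.
rewrite norm1c_real ger0_norm ?exprn_ge0//.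
rewrite mulrCA -!mulrA ler_wpM2l ?exprn_ge0//.
apply: le_trans (norm1cM _ _) _.
by rewrite ler_wpM2l ?norm1c_ge0// norm1c_cexp_lin.
Qed.

Lemma mixture_integrable k : cintegrable `[0, +oo[ (fun x => (x ^+ k)%:C * mixture x).
Proof.
have mD : measurable (`[0, +oo[%classic : set R) by exact: measurable_itv.
have [h _] := cintegral_sum mD (index_enum 'I_n) (term_integrable k).
rewrite (_ : (fun x => _) = (fun x => \sum_j (x ^+ k)%:C * (z j * cexp (- (eta j * x%:C)))))//.
by apply/funext => x; rewrite /mixture mulr_sumr.
Qed.

(** The real part of the mixture could be negative on a null set. *)
Definition density (x : R) : R := Num.max (Re (mixture x)) 0.

Let mRe : measurable_fun setT (fun x => Re (mixture x)).
Proof. by case: mixture_measurable. Qed.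

Let mIm : measurable_fun setT (fun x => Im (mixture x)).
Proof. by case: mixture_measurable. Qed.

Lemma density_measurable : measurable_fun setT density.
Proof. exact: measurable_maxr. Qed.

Lemma density_ge0 x : 0 <= density x.
Proof. by rewrite le_max lexx orbT. Qed.

Let iRe0 : mu.-integrable D0 (EFin \o (fun x => Re (mixture x))).
Proof.
have [h _] := mixture_integrable 0.
apply: (@lebesgue_integrableS _ `[0, +oo[) => //.
  by move=> x /=; rewrite !in_itv/= !andbT => /ltW.
move: h; rewrite (_ : (fun y => Re ((y ^+ 0)%:C * mixture y)) = (fun y => Re (mixture y)))//.
by apply/funext => y; rewrite expr0 mul1r.
Qed.

Let iIm0 : mu.-integrable D0 (EFin \o (fun x => Im (mixture x))).
Proof.
have [_ h] := mixture_integrable 0.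
apply: (@lebesgue_integrableS _ `[0, +oo[) => //.
  by move=> x /=; rewrite !in_itv/= !andbT => /ltW.
move: h; rewrite (_ : (fun y => Im ((y ^+ 0)%:C * mixture y)) = (fun y => Im (mixture y)))//.
by apply/funext => y; rewrite expr0 mul1r.
Qed.

Let law_Re B : measurable B -> B `<=` D0 ->
  P (S `&` V @^-1` B) = (\int[mu]_(x in B) (Re (mixture x))%:E)%E.
Proof.
move=> mB BD.
have iB := lebesgue_integrableS mD0 mB BD iRe0.
rewrite -[RHS](fineK (lebesgue_integrable_fin_num mB iB)) -[LHS]fineK; last first.
  by apply: fin_num_measure; apply: measurableI => //; exact: mV_pre.
by have := congr1 (@complex.Re R) (law mB BD) => /= ->.
Qed.

Let law_Im B : measurable B -> B `<=` D0 ->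
  (\int[mu]_(x in B) (Im (mixture x))%:E = 0)%E.
Proof.
move=> mB BD.
have iB := lebesgue_integrableS mD0 mB BD iIm0.
rewrite -[LHS](fineK (lebesgue_integrable_fin_num mB iB)).
have := congr1 (@complex.Im R) (law mB BD) => /= h.
by rewrite -[fine _]/(\int[mu]_(x in B) Im (mixture x)) -h.
Qed.

(** On the set N where the real part of the mixture is negative, the law of V
is nonnegative and is the integral of a negative function, so N carries no
mass. *)
Lemma density_law B : measurable B -> B `<=` D0 ->
  P (S `&` V @^-1` B) = (\int[mu]_(x in B) (density x)%:E)%E.
Proof.
move=> mB BD.
pose N := [set x | Re (mixture x) < 0].
have mN : measurable N.
  by rewrite /N -[X in measurable X]setTI; apply: measurable_fun_ltr.
have mBN : measurable (B `&` N) by exact: measurableI.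
have mBN' : measurable (B `&` ~` N) by apply: measurableI => //; exact: measurableC.
have subN : B `&` N `<=` D0 by move=> x [] /BD.
have subN' : B `&` ~` N `<=` D0 by move=> x [] /BD.
(* A probability that equals the integral of a negative function. *)
have N0 : P (S `&` V @^-1` (B `&` N)) = 0%E.
  apply/eqP; rewrite eq_le measure_ge0 andbT law_Re//.
  apply: (@le_trans _ _ (\int[mu]_(x in B `&` N) (cst 0%E x))%E); last by rewrite integral0.
  apply: le_integral => //.
  - exact: (lebesgue_integrableS mD0 mBN subN iRe0).
  - exact: integrable0.
  - by move=> x; rewrite inE => -[_ /ltW]; rewrite lee_fin.
have E1 : (\int[mu]_(x in B) (density x)%:E = \int[mu]_(x in B `&` ~` N) (Re (mixture x))%:E)%E.
  rewrite integral_mkcondr; apply: eq_integral => x _; rewrite patchE.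
  case: ifPn; rewrite ?inE/= /density; last first.
    rewrite notin_setE/= => /contrapT; rewrite /N/= => h; congr _%:E.
    by apply/max_idPr/ltW.
  by move=> h; congr _%:E; apply/max_idPl; rewrite leNgt; apply/negP.
rewrite E1 -law_Re//.
have mSB : measurable (S `&` V @^-1` B) by apply: measurableI => //; exact: mV_pre.
rewrite (measureDI P mSB (mV_pre mN)).
rewrite (_ : S `&` V @^-1` B `&` V @^-1` N = S `&` V @^-1` (B `&` N)); last first.
  by rewrite preimage_setI setIA.
rewrite -[RHS]adde0 -[X in _ = (_ + X)%E]N0; congr (_ + _)%E.
by rewrite setDE preimage_setI preimage_setC setIA.
Qed.

Let density_ae : ae_eq mu D0 (EFin \o (fun x => Re (mixture x))) (EFin \o density).
Proof.
apply: integral_ae_eq => //.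
  by apply/measurable_EFinP; apply: measurable_funTS; exact: density_measurable.
by move=> E ED mE; rewrite -law_Re//; exact: density_law.
Qed.

Let Im_ae : ae_eq mu D0 (EFin \o (fun x => Im (mixture x))) (cst 0%E).
Proof.
apply: integral_ae_eq => //.
by move=> E ED mE; rewrite [RHS]integral0; exact: law_Im.
Qed.

Let restrict (F : R -> R) : (forall x, x <= 0 -> F x = 0) -> (forall x, 0 <= F x) ->
  measurable_fun setT F ->
  (\int[P]_(w in S) (F (V w))%:E = \int[mu]_(x in D0) (F x * density x)%:E)%E.
Proof.
move=> F0 Fge0 mF.
rewrite -(ge0_integral_density mS mV mD0 density_measurable density_ge0 mF Fge0 density_law).
rewrite integral_mkcondr; apply: eq_integral => w _; rewrite patchE.
case: ifPn => //; rewrite notin_setE/= in_itv/= andbT => h.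
by rewrite F0// leNgt; apply/negP.
Qed.

(** The mixture is dominated by exponentials on the half-line. *)
Lemma mixture_moment k :
  P.-integrable S (EFin \o (fun w => Num.max (V w) 0 ^+ k.+1)).
Proof.
have mD : measurable (`[0, +oo[%classic : set R) by exact: measurable_itv.
pose F (x : R) : R := Num.max x 0 ^+ k.+1.
have mF : measurable_fun setT F by apply: measurable_funX; exact: measurable_maxr.
have Fge0 x : 0 <= F x by rewrite /F exprn_ge0// le_max lexx orbT.
have mFV : measurable_fun S (EFin \o (fun w => Num.max (V w) 0 ^+ k.+1)).
  by apply/measurable_EFinP; apply: measurable_funTS; exact: (measurableT_comp mF mV).
apply/integrableP; split => //.
rewrite (_ : (fun w => _) = (fun w => (F (V w))%:E)); last first.
  by apply/funext => w; rewrite /= ger0_norm// Fge0.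
rewrite restrict//; last by move=> x x0; rewrite /F max_r// expr0n.
have [iR _] := mixture_integrable k.+1.
have sub : D0 `<=` `[0, +oo[ by move=> x /=; rewrite !in_itv/= !andbT => /ltW.
have /integrableP[_] := lebesgue_integrableS mD mD0 sub iR.
apply: le_lt_trans; apply: ge0_le_integral => //.
- by move=> x _; rewrite lee_fin mulr_ge0// density_ge0.
- apply/measurable_EFinP; apply: measurable_funTS; apply: measurable_funM => //.
  exact: density_measurable.
- apply: measurableT_comp => //; apply/measurable_EFinP; apply: measurable_funTS.
  have [h _] : cmeasurable (fun x : R => (x ^+ k.+1)%:C * mixture x).
    apply: cmeasurableM; last exact: mixture_measurable.
    by apply: cmeasurable_real; exact: measurable_funX.
  exact: h.
- move=> x; rewrite /= in_itv/= andbT => x0.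
  have xk : 0 <= x ^+ k.+1 by rewrite exprn_ge0// ltW.
  rewrite lee_fin cReM /= mul0r subr0 normrM /F max_l ?(ltW x0)// (ger0_norm xk).
  by rewrite ler_wpM2l// /density ge_max ler_norm normr_ge0.
Qed.

Definition mixture_gamma (y : R) : R[i] := \sum_j z j * gamma_kernel (eta j) y.

Let primitive (c : R[i]) (y : R) : 0 < y ->
  (\int[mu]_(x in `]0%R, y]) (x * Re (c * mixture x))%:E = (Re (c * mixture_gamma y))%:E)%E.
Proof.
move=> y0.
have sub : (`]0%R, y]%classic : set R) `<=` `[0, +oo[.
  by move=> x /=; rewrite !in_itv/= andbT => /andP[/ltW].
have mI : measurable (`]0%R, y]%classic : set R) by exact: measurable_itv.
have mD : measurable (`[0, +oo[%classic : set R) by exact: measurable_itv.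
have ij j : mu.-integrable `]0%R, y]
    (fun x => (x * Re (c * z j * cexp (- (eta j * x%:C))))%:E).
  have [i1 i2] := term_integrable 1 j.
  have j1 := lebesgue_integrableS mD mI sub i1; have j2 := lebesgue_integrableS mD mI sub i2.
  pose f1 (x : R) := Re ((x ^+ 1)%:C * (z j * cexp (- (eta j * x%:C)))).
  pose f2 (x : R) := Im ((x ^+ 1)%:C * (z j * cexp (- (eta j * x%:C)))).
  have k1 : mu.-integrable `]0%R, y] (fun x => (Re c)%:E * (f1 x)%:E)%E.
    by apply: integrableZl => //; exact: j1.
  have k2 : mu.-integrable `]0%R, y] (fun x => (Im c)%:E * (f2 x)%:E)%E.
    by apply: integrableZl => //; exact: j2.
  have : mu.-integrable `]0%R, y] (fun x => (Re c)%:E * (f1 x)%:E - (Im c)%:E * (f2 x)%:E)%E.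
    exact: integrableB.
  apply: eq_integrable => // x _; rewrite /f1 /f2 /=.
  rewrite -!EFinM -EFinB; congr _%:E.
  rewrite expr1 -mulrA (cReM c) (cReM x%:C) (cImM x%:C) /=.
  by ring.
transitivity (\int[mu]_(x in `]0%R, y]) \sum_j (x * Re (c * z j * cexp (- (eta j * x%:C))))%:E)%E.
  apply: eq_integral => x _; rewrite sumEFin; congr _%:E.
  rewrite /mixture mulr_sumr cRe_sum mulr_sumr.
  by apply: eq_bigr => j _; rewrite mulrA.
rewrite (@integral_sum _ _ _ mu _ _ _ _ ij)//.
rewrite /mixture_gamma mulr_sumr cRe_sum -sumEFin.
apply: eq_bigr => j _; rewrite mulrA -gamma_kernel_primitive//.
rewrite integral_itv_obnd_cbnd//.
exact: (measurable_int _ (ij j)).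
Qed.

(** Integrate x against the density over ]0, y], term by term. *)
Lemma mixture_truncated_mean (y : R) : 0 < y ->
  (\int[P]_(w in S) (Num.max (V w) 0 * \1_(`]-oo, y]) (V w))%:E = (Re (mixture_gamma y))%:E)%E.
Proof.
move=> y0.
pose F (x : R) : R := Num.max x 0 * \1_(`]-oo, y]) x.
have mF : measurable_fun setT F.
  apply: measurable_funM; first exact: measurable_maxr.
  by apply: measurable_indic; exact: measurable_itv.
have Fge0 x : 0 <= F x by rewrite /F mulr_ge0// le_max lexx orbT.
rewrite (restrict (F := F))//; last by move=> x x0; rewrite /F max_r// mul0r.
rewrite -[mixture_gamma y]mul1r -primitive//.
transitivity (\int[mu]_(x in D0) (F x * Re (mixture x))%:E)%E.
  apply: ae_eq_integral => //.
  - apply/measurable_EFinP; apply: measurable_funTS; apply: measurable_funM => //.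
    exact: density_measurable.
  - by apply/measurable_EFinP; apply: measurable_funTS; exact: measurable_funM.
  - by apply: filterS density_ae => x h Dx; have /= [->] := h Dx.
have -> : (`]0%R, y]%classic : set R) = D0 `&` `]-oo, y].
  by apply/seteqP; split => x /=; rewrite !in_itv/= andbT => /andP.
rewrite [RHS]integral_mkcondr; apply: eq_integral => x; rewrite inE/= in_itv/= andbT => x0.
rewrite patchE /F indicE max_l ?ltW// mul1r.
by case: ifPn => _; rewrite ?mulr1// mulr0 mul0r.
Qed.

(** The imaginary part of the mixture integrates to 0 over every Borel set, so
it vanishes almost everywhere. *)
Lemma mixture_gamma_real (y : R) : 0 < y -> Im (mixture_gamma y) = 0.
Proof.
move=> y0.
have mI : measurable (`]0%R, y]%classic : set R) by exact: measurable_itv.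
(* Multiplication by -i brings the imaginary part under the primitive. *)
have ReN (c : R[i]) : Re (0 -i* 1 * c) = Im c.
  by case: c => a b; rewrite cReM /=; ring.
have := primitive (0 -i* 1) y0; rewrite ReN => h; apply: EFin_inj; rewrite -h.
transitivity (\int[mu]_(x in `]0%R, y]) (cst 0%E x))%E; last by rewrite integral0.
apply: ae_eq_integral => //.
- apply/measurable_EFinP; apply: measurable_funTS; apply: measurable_funM => //.
  by under eq_fun do rewrite ReN.
- apply: filterS Im_ae => x hx; rewrite /= in_itv/= => /andP[x0 xy].
  have := hx (ltac:(by rewrite /= in_itv/= x0)) => /= -[e].
  by rewrite ReN e mulr0.
Qed.

End Mixture.

(** * Layer cake formula and exponential times *)

Section LayerCake.
Context {R : realType} {disp : measure_display} {Omega : measurableType disp}.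
Variable P : probability Omega R.
Local Notation mu := (@lebesgue_measure R).

(** Both kinds of right end occur: the open one bounds the Laplace transform of
the hitting time from below and the closed one from above. *)
Definition gap_itv (b : bool) (x y : R) : set R := [set` Interval (BLeft x) (BSide b y)].

Lemma gap_itv_length b x y : (mu (gap_itv b x y) = (Num.max (y - x) 0)%:E)%E.
Proof.
rewrite /gap_itv lebesgue_measure_itv/= lte_fin.
by case: ltP => h; congr _%:E; apply/esym; [apply/max_idPl|apply/max_idPr]; lra.
Qed.

Lemma gap_itvE b x y z : gap_itv b x y z = ((x <= z) && (if b then z < y else z <= y)) :> Prop.
Proof. by rewrite /gap_itv/= in_itv/= /Order.lteif; case: b. Qed.

(** The length of the interval from V to W is (W - V)^+; exchange the
integrals. *)
Lemma layer_cake (S : set Omega) (a V W : Omega -> R) (b : bool) :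
  measurable S -> measurable_fun setT a -> (forall w, 0 <= a w) ->
  measurable_fun setT V -> (forall w, 0 <= V w) -> measurable_fun setT W ->
  (\int[P]_(w in S) (a w * Num.max (W w - V w) 0)%:E =
   \int[mu]_(y in `[0%R, +oo[) \int[P]_(w in S) (a w * \1_(gap_itv b (V w) (W w)) y)%:E)%E.
Proof.
move=> mS ma a0 mV V0 mW.
(* Lebesgue measure is defined on this copy of the line. *)
pose T2 := measurableTypeR R.
pose E : set (Omega * T2) := [set z | gap_itv b (V z.1) (W z.1) z.2].
have m2 : measurable_fun setT (fun z : Omega * T2 => z.2 : R).
  exact: (@measurable_snd _ _ Omega T2).
have mV1 : measurable_fun setT (fun z : Omega * T2 => V z.1).
  exact: (measurableT_comp mV (@measurable_fst _ _ Omega T2)).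
have mW1 : measurable_fun setT (fun z : Omega * T2 => W z.1).
  exact: (measurableT_comp mW (@measurable_fst _ _ Omega T2)).
have ma1 : measurable_fun setT (fun z : Omega * T2 => a z.1).
  exact: (measurableT_comp ma (@measurable_fst _ _ Omega T2)).
have mE : measurable E.
  have -> : E = [set z | V z.1 <= z.2] `&` (if b then [set z | z.2 < W z.1] else [set z | z.2 <= W z.1]).
    apply/seteqP; split => z; rewrite /E /= gap_itvE; case: (b) => /=.
    - by move=> /andP[].
    - by move=> /andP[].
    - by move=> [-> ->].
    - by move=> [-> ->].
  apply: measurableI; first exact: measurable_set_ler.
  by case: (b); [exact: measurable_set_ltr|exact: measurable_set_ler].
have mS1 : measurable ([set z | S z.1] : set (Omega * T2)).
  by have := @measurable_fst _ _ Omega T2 measurableT S mS; rewrite setTI.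
pose f (z : Omega * T2) : \bar R := (\1_[set z : Omega * T2 | S z.1] z * (a z.1 * \1_E z))%:E.
have mf : measurable_fun setT f.
  apply/measurable_EFinP; apply: measurable_funM; first exact: measurable_indic.
  by apply: measurable_funM => //; exact: measurable_indic.
have f0 z : (0 <= f z)%E by rewrite lee_fin mulr_ge0// mulr_ge0.
have := @fubini_tonelli _ _ _ _ _ P mu f mf f0.
have E1 w (y : T2) : \1_E (w, y) = \1_(gap_itv b (V w) (W w)) y :> R by rewrite !indicE.
have E2 w (y : T2) : \1_[set z : Omega * T2 | S z.1] (w, y) = \1_S w :> R.
  by rewrite !indicE; congr (nat_of_bool _)%:R; apply/idP/idP; rewrite !inE.
have -> : (\int[P]_x \int[mu]_y f (x, y) = \int[P]_(w in S) (a w * Num.max (W w - V w) 0)%:E)%E.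
  rewrite [RHS]integral_mkcond; apply: eq_integral => w _.
  rewrite patchE; case: ifPn => wS; last first.
    by rewrite integral0_eq// => y _; rewrite /f E2 indicE (negbTE wS) mul0r.
  transitivity (\int[mu]_y ((a w)%:E * (\1_(gap_itv b (V w) (W w)) y)%:E))%E.
    by apply: eq_integral => y _; rewrite /f E1 E2 indicE wS mul1r EFinM.
  have mI : measurable (gap_itv b (V w) (W w)) by exact: measurable_itv.
  rewrite ge0_integralZl//; last 2 first.
  - by apply/measurable_EFinP; exact: (measurable_indic mI).
  - by rewrite lee_fin.
  rewrite integral_indic//.
  by rewrite setIT EFinM; congr (_ * _)%E; exact: gap_itv_length.
move=> ->.
rewrite [RHS]integral_mkcond; apply: eq_integral => y _; rewrite patchE.
case: ifPn => y0.
  rewrite [RHS]integral_mkcond; apply: eq_integral => w _; rewrite patchE /f E1 E2 indicE.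
  by case: ifPn => wS; rewrite ?mul1r// mul0r.
rewrite integral0_eq// => w _; rewrite /f E1 [X in _ * (_ * X)]indicE memNset ?mulr0//.
move=> h; move: y0; rewrite notin_setE/= in_itv/= andbT; apply.
by move: h; rewrite gap_itvE => /andP[h _]; exact: le_trans (V0 w) h.
Qed.

End LayerCake.

Section Exponential.
Context {R : realType} {disp : measure_display} {Omega : measurableType disp}.
Variables (P : probability Omega R) (theta : R) (T : {RV P >-> R}).
Local Notation mu := (@lebesgue_measure R).
Hypothesis theta0 : 0 < theta.
Hypothesis lawT : forall B, measurable B -> distribution P T B = exponential_prob theta B.

Lemma exponential_tail (r : R) : 0 <= r ->
  (P [set w | (r <= T w)%R] = (expR (- (theta * r)))%:E)%E.
Proof.
move=> r0.
have mr : measurable (`[r, +oo[%classic : set R) by exact: measurable_itv.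
have -> : P [set w | (r <= T w)%R] = exponential_prob theta `[r, +oo[.
  rewrite -lawT//; congr (P _).
  by apply/seteqP; split => w /=; rewrite in_itv/= andbT.
rewrite /exponential_prob.
have cR : {within `[r, +oo[%classic, continuous (fun x => theta * expR (- theta * x))}.
  apply: continuous_subspaceT => x; apply: cvgM; first exact: cvg_cst.
  apply: (@continuous_comp _ _ _ (fun x : R => - theta * x) expR); last exact: continuous_expR.
  by apply: cvgM; [exact: cvg_cst|exact: cvg_id].
have cE (x : R) : (fun x : R => - expR (- theta * x)) y @[y --> x] --> - expR (- theta * x).
  apply: cvgN; apply: (@continuous_comp _ _ _ (fun x : R => - theta * x) expR); last exact: continuous_expR.
  by apply: cvgM; [exact: cvg_cst|exact: cvg_id].
transitivity (\int[mu]_(x in `[r, +oo[) (theta * expR (- theta * x))%:E)%E.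
  apply: eq_integral => x; rewrite inE/= in_itv/= andbT => rx.
  by rewrite exponential_pdfE// (le_trans r0).
rewrite (@ge0_continuous_FTC2y _ _ (fun x => - (expR (- theta * x))) _ 0)//.
- by rewrite EFinN oppeK add0e mulNr.
- by move=> x _; rewrite mulr_ge0 ?expR_ge0// ltW.
- rewrite -oppr0; apply: cvgN.
  rewrite (_ : (fun x => expR (- theta * x)) = (fun z => expR (- z)) \o (fun z => theta * z)); last first.
    by apply: eq_fun => x; rewrite mulNr.
  apply: (@cvg_comp _ R^o _ _ _ _ (pinfty_nbhs R)); last exact: cvgr_expR.
  exact: gt0_cvgMry.
- by apply/cvg_at_right_filter/cE.
- move=> z _.
  rewrite derive1_comp// derive1N// derive1_id mulN1r derive1_comp// derive1E.
  have /funeqP -> := @derive_expR R.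
  by rewrite derive1Ml// derive1_id mulr1 mulrN opprK mulrC.
Qed.

(** The integrand is the bound on E |X t|, up to a constant. *)
Lemma exponential_second_moment : (forall w, 0 <= T w) ->
  (\int[P]_w ((2 + T w) ^+ 2)%:E < +oo)%E.
Proof.
move=> T0.
have mD : measurable (`[0, +oo[%classic : set R) by exact: measurable_itv.
pose F (x : R) : R := (2 + x) ^+ 2.
have mF : measurable_fun setT F by apply: measurable_funX; exact: measurable_funD.
have F0 x : 0 <= F x by exact: sqr_ge0.
have H B : measurable B -> B `<=` (`[0, +oo[%classic : set R) ->
    P (setT `&` T @^-1` B) = (\int[mu]_(x in B) (exponential_pdf theta x)%:E)%E.
  by move=> mB _; rewrite setTI -[RHS]lawT.
have := ge0_integral_density measurableT (measurable_funPT T) mD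
  (measurable_exponential_pdf theta) (exponential_pdf_ge0 (ltW theta0)) mF F0 H.
rewrite setTI (_ : T @^-1` _ = setT); last first.
  by apply/seteqP; split => w //= _; rewrite in_itv/= andbT.
move=> ->.
have i1 : mu.-integrable `[0, +oo[ (fun y : R => ((8 * theta)%:E * (y ^+ 0 * expR (- (theta * y)))%:E)%E).
  by apply: integrableZl => //; exact: pow_exp_integrable.
have i2 : mu.-integrable `[0, +oo[ (fun y : R => ((2 * theta)%:E * (y ^+ 2 * expR (- (theta * y)))%:E)%E).
  by apply: integrableZl => //; exact: pow_exp_integrable.
have i12 : mu.-integrable `[0, +oo[ (fun y : R => ((8 * theta)%:E * (y ^+ 0 * expR (- (theta * y)))%:E
    + (2 * theta)%:E * (y ^+ 2 * expR (- (theta * y)))%:E)%E) by exact: integrableD.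
have mG : measurable_fun (`[0, +oo[%classic : set R) (fun y : R => ((F y * exponential_pdf theta y)%:E)).
  apply/measurable_EFinP; apply: measurable_funTS; apply: measurable_funM => //.
  exact: measurable_exponential_pdf.
have : mu.-integrable `[0, +oo[ (fun y : R => ((F y * exponential_pdf theta y)%:E)).
  apply: (le_integrable _ _ _ i12) => // y; rewrite /= in_itv/= andbT => y0.
  rewrite lee_fin exponential_pdfE// expr0 mul1r /F.
  rewrite !ger0_norm; last 2 first.
  - by rewrite addr_ge0// !mulr_ge0 ?expR_ge0 ?exprn_ge0// ltW.
  - by rewrite mulr_ge0 ?sqr_ge0// mulr_ge0 ?expR_ge0// ltW.
  rewrite mulNr; have := expR_gt0 (- (theta * y)); move: (expR _) => e e0.
  have -> : 8 * theta * e + 2 * theta * (y ^+ 2 * e) = (8 + 2 * y ^+ 2) * (theta * e) by ring.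
  apply: ler_wpM2r; first by rewrite mulr_ge0// ltW.
  by have := sqr_ge0 (2 - y); rewrite !expr2; lra.
move=> /integrableP[_]; apply: le_lt_trans; apply: ge0_le_integral => //.
- by move=> y _; rewrite lee_fin mulr_ge0// exponential_pdf_ge0// ltW.
- exact: measurableT_comp.
- by move=> y _ /=; rewrite lee_fin ler_norm.
Qed.

End Exponential.

(** * Hitting times before the clock *)

Section Hitting.
Context {R : realType} {disp : measure_display} {Omega : measurableType disp}.
Variables (P : probability Omega R) (d : nat) (q : 'M[R]_d).
Variables (L : 'I_d -> R -> {RV P >-> R}) (U : 'I_d -> 'I_d -> nat -> {RV P >-> R}).
Variables (J : R -> Omega -> 'I_d) (X : R -> {RV P >-> R}) (Q0 : {RV P >-> R}).
Variables (theta : R) (T : {RV P >-> R}).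
Hypothesis HM : markov_additive q L U J X.
Hypothesis HT : exponential_clock J X Q0 theta T.
Hypothesis theta0 : 0 < theta.

Local Notation TM := (g_sigma_algebraType (map_events J X)).
Local Notation TG := (g_sigma_algebraType (rv_events Q0 `|` map_events J X)).
Local Notation Ji i := [set w | J 0 w = i].

(** The random variable whose conditional mean is the Laplace transform of the
hitting time. It is not known to be measurable. *)
Definition discount (y : R) (w : Omega) : R :=
  fine (expeR (- (theta%:E * hitting_time X y w))%E).

Lemma hitting_time_ge0 y w : (0 <= hitting_time X y w)%E.
Proof. by apply: le_ereal_inf_tmp => /= _ [t [t0 _] <-]; rewrite lee_fin. Qed.

Lemma hitting_time_le y1 y2 w : y1 <= y2 -> (hitting_time X y1 w <= hitting_time X y2 w)%E.
Proof.
move=> y12; apply: le_ereal_inf => _ /= [t [t0 Xt] <-]; exists t => //; split => //.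
by apply: le_trans Xt _; rewrite lerN2.
Qed.

Lemma discountE y w : discount y w =
  if hitting_time X y w is r%:E then expR (- (theta * r)) else 0.
Proof.
rewrite /discount; have := hitting_time_ge0 y w.
by case: (hitting_time X y w) => [r||]//= _; rewrite gt0_muley ?lte_fin.
Qed.

Lemma discount_bounds y w : 0 <= discount y w <= 1.
Proof.
rewrite discountE; have := hitting_time_ge0 y w.
case: (hitting_time X y w) => [r||]//=; last by rewrite lexx ler01.
rewrite lee_fin => r0; rewrite expR_ge0/= -[1]expR0 ler_expR.
by rewrite oppr_le0 mulr_ge0// ltW.
Qed.

Lemma discount_nonincreasing y1 y2 w : y1 <= y2 -> discount y2 w <= discount y1 w.
Proof.
move=> y12; have := hitting_time_le w y12; have := hitting_time_ge0 y1 w; rewrite !discountE.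
case: (hitting_time X y1 w) => [r1||]; case: (hitting_time X y2 w) => [r2||]//=.
- by rewrite !lee_fin => _ r12; rewrite ler_expR lerN2 ler_wpM2l// ltW.
Qed.

(** The two ways to compare a level with the depth, as a function of a boolean
so that both are treated at once. *)
Definition deeper (b : bool) (y x : R) : bool := if b then y < x else y <= x.

Lemma deeper_measurable b y : measurable_fun setT (deeper b y).
Proof.
rewrite /deeper; case: b.
  exact: (@measurable_fun_ltr _ _ _ setT (cst y) id).
exact: (@measurable_fun_ler _ _ _ setT (cst y) id).
Qed.

Let mdeep (b : bool) y : measurable_fun setT (fun z : R * TM => deeper b y (depth X z.1 z.2)).
Proof. exact: (measurableT_comp (deeper_measurable b y) (depth_joint HM)). Qed.

Lemma deep_set_measurable (b : bool) y : measurable ([set z | deeper b y (depth X z.1 z.2)] : set (R * TM)).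
Proof. by have := mdeep b y measurableT (_ : measurable [set true]); rewrite setTI; exact. Qed.

Let T0 w : 0 <= T w. Proof. by case: HT. Qed.

Let lawT B : measurable B -> distribution P T B = exponential_prob theta B.
Proof. by case: HT => _ h _; exact: h. Qed.

Let mdeepT (b : bool) y v : measurable [set w | deeper b y (depth X (T w) v)].
Proof.
have h : measurable_fun setT (fun w : Omega => (T w, v : TM)) by exact: measurable_fun_pair.
by have := h measurableT _ (deep_set_measurable b y); rewrite setTI.
Qed.

Let hit_le v y t : 0 <= t -> y < depth X t v -> (hitting_time X y v <= t%:E)%E.
Proof.
move=> t0; rewrite /depth ger0_norm// => h.
exact: (@path_hit_le _ (fun t => X t v) (X_bounded HM v) t y t0 h).
Qed.

Let hit_ge v y t : 0 <= t -> (hitting_time X y v <= t%:E)%E -> y <= depth X t v.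
Proof.
move=> t0 h; rewrite /depth ger0_norm//.
apply: (@path_hit_ge _ (fun t => X t v) _ (X_bounded HM v) t y t0 h) => s s0.
exact: X_rcont HM v s s0.
Qed.

(** For a fixed path, the clock exceeds the hitting time r with probability
e^{- theta r}; depth more than y implies that -y has been hit, which implies
depth at least y. *)
Lemma discount_sandwich y v :
  (P [set w | deeper true y (depth X (T w) v)] <= (discount y v)%:E)%E /\
  ((discount y v)%:E <= P [set w | deeper false y (depth X (T w) v)])%E.
Proof.
have mtail r : measurable [set w | r <= T w].
  have mr : measurable (`[r, +oo[%classic : set R) by exact: measurable_itv.
  have := measurable_funPTI T mr.
  by congr (measurable _); apply/seteqP; split => w /=; rewrite in_itv/= andbT.
rewrite discountE; have := @hit_le v y; have := @hit_ge v y; have := hitting_time_ge0 y v.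
case: (hitting_time X y v) => [r||]//.
- rewrite lee_fin => r0 hge hle; rewrite -(exponential_tail theta0 lawT r0); split.
  + apply: le_measure; rewrite ?inE//.
    by move=> w /= /(hle _ (T0 w)); rewrite lee_fin.
  + apply: le_measure; rewrite ?inE//.
    by move=> w /= h; apply: hge => //; rewrite lee_fin.
- move=> _ _ hle; split; last exact: measure_ge0.
  rewrite (_ : [set w | _] = set0) ?measure0//.
  by apply/seteqP; split => // w /= /(hle _ (T0 w)).
Qed.

Lemma clock_section b i y :
  (P (Ji i `&` [set w | deeper b y (depth X (T w) w)]) =
   \int[P]_(v in Ji i) P [set w | deeper b y (depth X (T w) v)])%E.
Proof.
pose E : set (R * TM) := [set z | J 0 z.2 = i] `&` [set z | deeper b y (depth X z.1 z.2)].
have mJ : measurable ([set z | J 0 z.2 = i] : set (R * TM)).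
  by have := @measurable_snd _ _ R TM measurableT _ (Ji_measurable_TM (P:=P) (J:=J) (X:=X) i); rewrite setTI.
have mE : measurable E by apply: measurableI => //; exact: deep_set_measurable.
pose F (z : R * TM) : \bar R := (\1_E z)%:E.
have mF : measurable_fun setT F by apply/measurable_EFinP; exact: measurable_indic.
have F0 (z : R * TG) : (0 <= F z)%E by rewrite lee_fin.
have := clock_tonelli HM HT (joint_TG mF) F0.
have -> : (\int[P]_w F (T w, w) = P (Ji i `&` [set w | deeper b y (depth X (T w) w)]))%E.
  have mS : measurable (Ji i `&` [set w | deeper b y (depth X (T w) w)]).
    have h : measurable_fun setT (fun w : Omega => (T w, w : TM)).
      apply: measurable_fun_pair => //.
      exact: (measurableT_comp (@measurable_TG_TM _ _ _ P d J X Q0) (measurable_Omega_TG HM)).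
    by have := h measurableT _ mE; rewrite setTI.
  by rewrite -[in RHS](setIT (Ji i `&` _)) -integral_indic.
move=> ->; rewrite [RHS]integral_mkcond; apply: eq_integral => v _; rewrite patchE.
case: ifPn => vJ.
  rewrite -[in RHS](setIT [set w | _]) -integral_indic//.
  apply: eq_integral => w _; rewrite /F !indicE; congr (nat_of_bool _)%:R%:E.
  by move: vJ; rewrite inE/= => vJ; apply/idP/idP; rewrite !inE /E/= => // -[].
rewrite integral0_eq// => w _; rewrite /F indicE memNset// => -[/= h _].
by move: vJ; rewrite notin_setE/=.
Qed.

Definition discount_mass i y : \bar R := (\int[P]_(w in Ji i) (discount y w)%:E)%E.

(** Integrate the bounds for fixed paths; the outer terms are probabilities by
the independence of the clock. *)
Lemma discount_mass_sandwich i y :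
  (P (Ji i `&` [set w | deeper true y (depth X (T w) w)]) <= discount_mass i y)%E /\
  (discount_mass i y <= P (Ji i `&` [set w | deeper false y (depth X (T w) w)]))%E.
Proof.
rewrite !clock_section /discount_mass; split; apply: ge0_le_integralN.
- by move=> v _; exact: measure_ge0.
- by move=> v _; case: (discount_sandwich y v).
- by move=> v _; rewrite lee_fin; case/andP: (discount_bounds y v).
- by move=> v _; case: (discount_sandwich y v).
Qed.

Lemma discount_mass_bounds i y : (0 <= discount_mass i y <= P (Ji i))%E.
Proof.
apply/andP; split.
  by apply: integral_ge0 => w _; rewrite lee_fin; case/andP: (discount_bounds y w).
have mJ := measurable_Ji HM i.
rewrite -[leRHS]mul1e -integral_cst//.
apply: ge0_le_integralN => w _; rewrite lee_fin; by case/andP: (discount_bounds y w).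
Qed.

Let mass_fin i y : discount_mass i y \is a fin_num.
Proof.
have /andP[h0 h1] := discount_mass_bounds i y.
rewrite ge0_fin_numE//; apply: le_lt_trans h1 _.
by rewrite ltey_eq fin_num_measure//; exact: measurable_Ji HM i.
Qed.

Let lstE i y : hitting_lst J X i theta y = fine (discount_mass i y) / fine (P (Ji i)).
Proof. by []. Qed.

(** Both sides vanish when P (Ji i) = 0. *)
Lemma hitting_lst_mass i y : (P (Ji i) * (hitting_lst J X i theta y)%:E = discount_mass i y)%E.
Proof.
have mJ := measurable_Ji HM i.
have PE : P (Ji i) = (fine (P (Ji i)))%:E by rewrite fineK// fin_num_measure.
have [c0|c0] := eqVneq (fine (P (Ji i))) 0.
  have /andP[h0 h1] := discount_mass_bounds i y.
  have P0 : P (Ji i) = 0%E by rewrite PE c0.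
  by rewrite P0 mul0e; apply/eqP; rewrite eq_le h0 -P0 h1.
by rewrite lstE PE -EFinM mulrC divfK// fineK.
Qed.

Lemma hitting_lst_bounds i y : 0 <= hitting_lst J X i theta y <= 1.
Proof.
have /andP[h0 h1] := discount_mass_bounds i y; rewrite lstE.
have c0 : 0 <= fine (P (Ji i)) by exact: fine_ge0.
rewrite divr_ge0 ?fine_ge0//=.
have [->|cN0] := eqVneq (fine (P (Ji i))) 0; first by rewrite invr0 mulr0.
rewrite ler_pdivrMr ?lt0r ?cN0// mul1r fine_le//.
by rewrite fin_num_measure//; exact: measurable_Ji HM i.
Qed.

Lemma hitting_lst_nonincreasing i y1 y2 : y1 <= y2 ->
  hitting_lst J X i theta y2 <= hitting_lst J X i theta y1.
Proof.
move=> y12; rewrite !lstE; apply: ler_wpM2r; first by rewrite invr_ge0 fine_ge0.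
apply: fine_le => //; apply: ge0_le_integralN => w _; rewrite lee_fin.
  by case/andP: (discount_bounds y2 w).
exact: discount_nonincreasing.
Qed.

(** Monotone in the level, hence measurable, whatever the hitting times are. *)
Lemma hitting_lst_measurable i : measurable_fun setT (hitting_lst J X i theta).
Proof. by apply: nonincreasing_measurable => // y1 y2; exact: hitting_lst_nonincreasing. Qed.

End Hitting.

(** * The covariance *)

Section Assembly.
Context {R : realType} {disp : measure_display} {Omega : measurableType disp}.
Variables (P : probability Omega R) (d : nat) (q : 'M[R]_d).
Variables (L : 'I_d -> R -> {RV P >-> R}) (U : 'I_d -> 'I_d -> nat -> {RV P >-> R}).
Variables (J : R -> Omega -> 'I_d) (X : R -> {RV P >-> R}) (Q0 : {RV P >-> R}).
Variables (zeta : 'M[R[i]]_d) (eta : 'I_d -> R[i]) (theta : R) (T : {RV P >-> R}).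
Hypothesis HM : markov_additive q L U J X.
Hypothesis Hfin : finite_means L U.
Hypothesis HS : stationary_workload J X Q0.
Hypothesis HT : exponential_clock J X Q0 theta T.
Hypothesis theta0 : 0 < theta.
Hypothesis eta0 : forall j, 0 < Re (eta j).
Hypothesis Hdens : forall (i : 'I_d) (B : set R), measurable B -> B `<=` `]0, +oo[ ->
  (fine (P [set w | B (Q0 w) /\ J 0 w = i]))%:C =
  cintegral B (fun x => \sum_j zeta i j * cexp (- (eta j * x%:C))).

Local Notation mu := (@lebesgue_measure R).
Local Notation TM := (g_sigma_algebraType (map_events J X)).
Local Notation TG := (g_sigma_algebraType (rv_events Q0 `|` map_events J X)).
Local Notation Ji i := [set w | J 0 w = i].

Let mJ i : measurable (Ji i). Proof. exact: measurable_Ji HM i. Qed.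
Let mQ0 : measurable_fun setT Q0. Proof. exact: measurable_funPT. Qed.
Let T0 w : 0 <= T w. Proof. by case: HT. Qed.
Let lawT B : measurable B -> distribution P T B = exponential_prob theta B.
Proof. by case: HT => _ h _; exact: h. Qed.

Lemma chain_integral (f : Omega -> R) : measurable_fun setT f ->
  (\int[P]_w (f w)%:E = \sum_(i < d) \int[P]_(w in Ji i) (f w)%:E)%E.
Proof.
move=> mf.
have cover : \big[setU/set0]_(i <- index_enum 'I_d) Ji i = setT.
  rewrite -bigcup_seq; apply/seteqP; split => // w _.
  by exists (J 0 w) => //=; rewrite mem_index_enum.
have := @integral_bigsetU_EFin _ _ _ P _ (fun i => Ji i) f (index_enum 'I_d) mJ (index_enum_uniq _).
rewrite cover; apply; last by apply/measurable_EFinP.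
by apply/trivIsetP => i j _ _ ij; apply/seteqP; split => // w [/= e1 e2]; rewrite -e1 -e2 eqxx in ij.
Qed.

Lemma chain_integrable (f : Omega -> R) : measurable_fun setT f ->
  (forall i, P.-integrable (Ji i) (EFin \o f)) -> P.-integrable setT (EFin \o f).
Proof.
move=> mf fi; apply/integrableP; split; first by apply/measurable_EFinP.
have mn : measurable_fun setT (fun w => `|f w|) by exact: measurableT_comp.
rewrite (chain_integral mn); apply: lte_sum_pinfty => i _.
by case/integrableP: (fi i).
Qed.

Lemma null_integral i (f : Omega -> R) : measurable_fun setT f -> P (Ji i) = 0%E ->
  (\int[P]_(w in Ji i) (f w)%:E = 0)%E.
Proof.
move=> mf P0; apply: null_set_integral => //.
by apply: measurable_funTS; apply/measurable_EFinP.
Qed.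

Definition pos_part (x : R) : R := Num.max x 0.
Local Notation Q w := (pos_part (Q0 w)).

Let mpos : measurable_fun setT pos_part. Proof. exact: measurable_maxr. Qed.
Let pos0 x : 0 <= pos_part x. Proof. by rewrite le_max lexx orbT. Qed.
Let mQ : measurable_fun setT (fun w => Q w). Proof. exact: measurableT_comp. Qed.

Let Q0E : {ae P, forall w, Q0 w = Q w}.
Proof.
by apply: filterS (workload_ge0 HS) => w h; rewrite /pos_part max_l.
Qed.

Let law i (B : set R) : measurable B -> B `<=` `]0, +oo[ ->
  (fine (P (Ji i `&` Q0 @^-1` B)))%:C = cintegral B (mixture (zeta i) eta).
Proof.
move=> mB BD; rewrite -[RHS](Hdens i mB BD); congr (_%:C); congr (fine (P _)).
by apply/seteqP; split => w [].
Qed.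

Lemma initial_moment_on i k : P.-integrable (Ji i) (EFin \o (fun w => Q w ^+ k.+1)).
Proof. exact: (mixture_moment (mJ i) mQ0 eta0 (law i)). Qed.

Lemma initial_moment k : P.-integrable setT (EFin \o (fun w => Q w ^+ k.+1)).
Proof.
apply: chain_integrable; first exact: measurable_funX.
by move=> i; exact: initial_moment_on.
Qed.

Let iQ : P.-integrable setT (EFin \o (fun w => Q w)).
Proof. exact: (initial_moment 0). Qed.

Let iQi i : P.-integrable (Ji i) (EFin \o (fun w => Q w)).
Proof. exact: (initial_moment_on i 0). Qed.

Definition clock_pos (w : Omega) : R := X (T w) w.
Definition clock_depth (w : Omega) : R := depth X (T w) w.
Definition clock_workload (w : Omega) : R := workload X Q0 (T w) w.
Local Notation Y := clock_pos.
Local Notation I := clock_depth.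
Local Notation W := clock_workload.

Let YE w : Y w = X `|T w| w. Proof. by rewrite ger0_norm. Qed.

Let mY : measurable_fun setT Y.
Proof.
have := joint_path T HM (joint_TG (Q0 := Q0) (X_joint HM)).
by rewrite (_ : (fun w => X `|T w| w) = Y)//; apply/funext => w; rewrite YE.
Qed.

Let mI : measurable_fun setT I.
Proof. exact: (joint_path T HM (joint_TG (Q0 := Q0) (depth_joint HM))). Qed.

Let I0 w : 0 <= I w. Proof. exact: depth_ge0 HM _ _. Qed.

Lemma clock_workloadE w : W w = Y w + Num.max (Q w) (I w).
Proof.
rewrite /clock_workload /workload /clock_pos; congr (_ + _).
have -> : - running_inf X (T w) w = I w by rewrite /clock_depth /depth ger0_norm.
by rewrite /pos_part -maxA (max_r (I0 w)).
Qed.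

(** The reflection formula: the excess of the depth over the initial workload
is what reflection at 0 has added. *)
Lemma clock_workload_split w : W w = Y w + Q w + Num.max (I w - Q w) 0.
Proof.
rewrite clock_workloadE -addrA; congr (_ + _); case: (leP (Q w) (I w)) => h.
  by rewrite max_l ?subr_ge0// addrC subrK.
by rewrite max_r ?addr0// subr_le0 ltW.
Qed.

Let mW : measurable_fun setT W.
Proof.
have -> : W = (fun w => Y w + Num.max (Q w) (I w)) by apply/funext => w; exact: clock_workloadE.
by apply: measurable_funD => //; exact: measurable_maxr.
Qed.

(** The mean of |X t| grows at most quadratically and T has a second moment. *)
Lemma clock_pos_integrable : P.-integrable setT (EFin \o Y).
Proof.
have [C C0 HC] := map_abs_mean HM Hfin.
apply/integrableP; split; first by apply/measurable_EFinP.
pose F (z : R * TM) : \bar R := (`|X `|z.1| z.2|)%:E.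
have mF : measurable_fun setT F.
  by apply/measurable_EFinP; apply: measurableT_comp => //; exact: X_joint HM.
have F0 (z : R * TG) : (0 <= F z)%E by rewrite lee_fin.
have := clock_tonelli_swap HM HT (joint_TG mF) F0.
have -> : (\int[P]_w F (T w, w) = \int[P]_w `|(EFin \o Y) w|)%E.
  by apply: eq_integral => w _; rewrite /F /= YE.
move=> ->.
apply: (@le_lt_trans _ _ (\int[P]_w (C%:E * ((2 + T w) ^+ 2)%:E))%E).
  apply: ge0_le_integralN => w _; first by apply: integral_ge0 => v _; exact: F0.
  rewrite -EFinM; apply: le_trans (HC _ (T0 w)).
  by rewrite /F /= ger0_norm.
rewrite ge0_integralZl//; last 2 first.
- apply/measurable_EFinP; apply: measurable_funX; apply: measurable_funD => //.
- by move=> w _; rewrite lee_fin sqr_ge0.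
apply: lte_mul_pinfty => //.
exact: (exponential_second_moment theta0 lawT T0).
Qed.

Let clock_law_fin (f : R -> R) : measurable_fun setT f -> (forall x, 0 <= f x) ->
  (\int[P]_w (f (W w))%:E = \int[P]_w (f (Q w))%:E)%E.
Proof.
move=> mf f0.
have mEf : measurable_fun setT (fun x => (f x)%:E) by apply/measurable_EFinP.
rewrite (workload_clock_law HM HS HT mEf)//.
apply: ae_eq_integral => //.
- by apply/measurable_EFinP; exact: (measurableT_comp mf).
- by apply/measurable_EFinP; exact: (measurableT_comp mf).
- by apply: filterS Q0E => w e _; rewrite -e.
Qed.

Lemma clock_workload_integrable : P.-integrable setT (EFin \o W).
Proof.
apply/integrableP; split; first by apply/measurable_EFinP.
have E : (\int[P]_w (`|W w|)%:E = \int[P]_w (`|Q w|)%:E)%E.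
  by apply: (clock_law_fin (f := fun x => `|x|)) => //; exact: normr_measurable.
have -> : (\int[P]_w `|(EFin \o W) w| = \int[P]_w (`|W w|)%:E)%E by [].
by rewrite E; case/integrableP: iQ.
Qed.

Lemma clock_workload_sq_integrable : P.-integrable setT (EFin \o (fun w => W w ^+ 2)).
Proof.
have mW2 : measurable_fun setT (fun w => W w ^+ 2) by exact: measurable_funX.
apply/integrableP; split; first by apply/measurable_EFinP.
rewrite (_ : (fun w => _) = (fun w => ((fun x : R => x ^+ 2) (W w))%:E)); last first.
  by apply/funext => w; rewrite /= ger0_norm ?sqr_ge0.
rewrite (clock_law_fin (f := fun x => x ^+ 2)); last 2 first.
- exact: measurable_funX.
- by move=> x; exact: sqr_ge0.
have /integrableP[_] := initial_moment 1.
by under eq_integral do rewrite /= ger0_norm ?sqr_ge0//.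
Qed.

(** Equality of laws, applied to the positive and the negative part. *)
Lemma clock_workload_mean : (\int[P]_w (W w)%:E = \int[P]_w (Q w)%:E)%E.
Proof.
rewrite integralE [RHS]integralE; congr (_ - _)%E.
  rewrite (_ : _^\+%E = (fun w => (pos_part (W w))%:E)); last first.
    by apply/funext => w; rewrite funeposE -EFin_max.
  rewrite [in RHS](_ : _^\+%E = (fun w => (pos_part (Q w))%:E)); last first.
    by apply/funext => w; rewrite funeposE -EFin_max.
  exact: clock_law_fin.
rewrite (_ : _^\-%E = (fun w => (pos_part (- W w))%:E)); last first.
  by apply/funext => w; rewrite funenegE -EFinN -EFin_max.
rewrite [in RHS](_ : _^\-%E = (fun w => (pos_part (- Q w))%:E)); last first.
  by apply/funext => w; rewrite funenegE -EFinN -EFin_max.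
apply: (clock_law_fin (f := fun x => pos_part (- x))) => //.
exact: measurableT_comp.
Qed.

(** The depth is at most the workload minus the position. *)
Lemma clock_depth_integrable : P.-integrable setT (EFin \o I).
Proof.
have iD : P.-integrable setT (fun w => (W w)%:E - (Y w)%:E)%E.
  exact: (integrableB measurableT clock_workload_integrable clock_pos_integrable).
apply: (le_integrable _ _ _ iD) => //; first by apply/measurable_EFinP.
move=> w _; rewrite -EFinB /= lee_fin clock_workloadE addrAC subrr add0r.
rewrite !ger0_norm// ?le_max ?lexx ?orbT ?I0//.
Qed.


Let c i : R := fine (P (Ji i)).
Let cE i : P (Ji i) = (c i)%:E. Proof. by rewrite fineK// fin_num_measure. Qed.
Let c0 i : 0 <= c i. Proof. exact: fine_ge0. Qed.

Let clock_measurable (Phi : R * TM -> R) : measurable_fun setT Phi ->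
  measurable_fun setT (fun w => Phi (T w, w)).
Proof. by move=> mPhi; exact: (joint_path T HM (joint_TG (Q0 := Q0) mPhi)). Qed.

(** The bound by |X| gives integrability; when P (Ji i) = 0 everything
vanishes, and otherwise finiteness is read off from the factorization. *)
Lemma cond_indep_real i (Phi : R * TM -> R) :
  measurable_fun setT Phi -> (forall z, 0 <= Phi z) ->
  (forall z, Phi z <= `|X `|z.1| z.2|) ->
  [/\ P.-integrable (Ji i) (EFin \o (fun w => Q w * Phi (T w, w))),
      P.-integrable (Ji i) (EFin \o (fun w => Phi (T w, w))) &
      c i * \int[P]_(w in Ji i) (Q w * Phi (T w, w)) =
      \int[P]_(w in Ji i) Q w * \int[P]_(w in Ji i) Phi (T w, w)].
Proof.
move=> mPhi Phi0 PhiX; have mPT := clock_measurable mPhi.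
have iPhi : P.-integrable (Ji i) (EFin \o (fun w => Phi (T w, w))).
  have iY := integrableS measurableT (mJ i) (@subsetT _ _) clock_pos_integrable.
  apply: (le_integrable (mJ i) _ _ iY); first by apply/measurable_EFinP; exact: measurable_funTS.
  by move=> w _ /=; rewrite lee_fin ger0_norm// YE; exact: PhiX.
have E := cond_indep HM HS HT i mpos pos0 mPhi Phi0.
have f1 := integrable_fin_num (mJ i) (iQi i).
have f2 := integrable_fin_num (mJ i) iPhi.
have mQP : measurable_fun setT (fun w => Q w * Phi (T w, w)) by exact: measurable_funM.
have fQP : (\int[P]_(w in Ji i) (Q w * Phi (T w, w))%:E < +oo)%E.
  have [ci0|ci0] := eqVneq (c i) 0.
    by rewrite null_integral ?ltry// cE ci0.
  have : (P (Ji i) * \int[P]_(w in Ji i) (pos_part (Q0 w) * Phi (T w, w))%:E)%E \is a fin_num.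
    by rewrite E fin_numM.
  rewrite cE; case: (\int[P]_(w in Ji i) _)%E => [r||]//; first by rewrite ltry.
  by rewrite gt0_muley// lte_fin lt0r ci0 c0.
have iQP : P.-integrable (Ji i) (EFin \o (fun w => Q w * Phi (T w, w))).
  apply/integrableP; split; first by apply/measurable_EFinP; exact: measurable_funTS.
  under eq_integral do rewrite /= ger0_norm ?mulr_ge0//.
  exact: fQP.
split => //.
have f3 := integrable_fin_num (mJ i) iQP.
by apply: EFin_inj; rewrite !EFinM -cE /Rintegral !fineK.
Qed.

(** Factorization for the positive and for the negative part of X. *)
Lemma initial_clock_pos i :
  P.-integrable (Ji i) (EFin \o (fun w => Q w * Y w)) /\
  c i * \int[P]_(w in Ji i) (Q w * Y w) = \int[P]_(w in Ji i) Q w * \int[P]_(w in Ji i) Y w.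
Proof.
pose Phi1 (z : R * TM) : R := pos_part (X `|z.1| z.2).
pose Phi2 (z : R * TM) : R := pos_part (- X `|z.1| z.2).
have m1 : measurable_fun setT Phi1 by apply: measurableT_comp => //; exact: X_joint HM.
have m2 : measurable_fun setT Phi2.
  by apply: measurableT_comp => //; apply: measurableT_comp => //; exact: X_joint HM.
have le1 z : Phi1 z <= `|X `|z.1| z.2| by rewrite /Phi1 /pos_part ge_max ler_norm normr_ge0.
have le2 z : Phi2 z <= `|X `|z.1| z.2|.
  rewrite /Phi2 /pos_part ge_max normr_ge0 andbT.
  by have := ler_norm (- X `|z.1| z.2); rewrite normrN.
have [i1 j1 e1] := cond_indep_real i m1 (fun z => pos0 _) le1.
have [i2 j2 e2] := cond_indep_real i m2 (fun z => pos0 _) le2.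
have dec w : Y w = Phi1 (T w, w) - Phi2 (T w, w).
  rewrite /Phi1 /Phi2 /pos_part /= -YE; case: (leP 0 (Y w)) => h.
    by rewrite max_r ?subr0// oppr_le0.
  by rewrite max_l ?sub0r ?opprK// oppr_ge0 ltW.
have decQ w : Q w * Y w = Q w * Phi1 (T w, w) - Q w * Phi2 (T w, w) by rewrite dec mulrBr.
split.
  rewrite (_ : _ \o _ = (fun w => (Q w * Phi1 (T w, w))%:E - (Q w * Phi2 (T w, w))%:E)%E).
    exact: (integrableB (mJ i) i1 i2).
  by apply/funext => w /=; rewrite decQ EFinB.
rewrite (@eq_Rintegral _ _ _ P _ (fun w => Q w * Phi1 (T w, w) - Q w * Phi2 (T w, w))); last first.
  by move=> w _; exact: decQ.
rewrite [X in _ = _ * X](@eq_Rintegral _ _ _ P _ (fun w => Phi1 (T w, w) - Phi2 (T w, w))); last first.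
  by move=> w _; exact: dec.
by rewrite (RintegralB (mJ i) i1 i2) (RintegralB (mJ i) j1 j2) !mulrBr e1 e2.
Qed.

(** For states of probability 0 both sides vanish. *)
Lemma initial_clock_pos_nu i :
  \int[P]_(w in Ji i) (Q w * Y w) = \int[P]_(w in Ji i) Q w * nu J X T i.
Proof.
have [_ e] := initial_clock_pos i.
have mQY : measurable_fun setT (fun w => Q w * Y w) by exact: measurable_funM.
rewrite /nu /cond_mean -/(c i).
have [ci0|ci0] := eqVneq (c i) 0.
  have P0 : P (Ji i) = 0%E by rewrite cE ci0.
  by rewrite /Rintegral !null_integral// !mul0r.
by apply: (mulfI ci0); rewrite e [RHS]mulrCA [c i * _]mulrCA mulfV// mulr1.
Qed.

Definition excess (w : Omega) : R := Num.max (I w - Q w) 0.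

Let mexcess : measurable_fun setT excess.
Proof. by apply: measurable_maxr => //; exact: measurable_funB. Qed.

(** Both factors are square-integrable. *)
Lemma initial_workload_integrable : P.-integrable setT (EFin \o (fun w => Q w * W w)).
Proof.
have iS : P.-integrable setT (fun w => (Q w ^+ 2)%:E + (W w ^+ 2)%:E)%E.
  exact: (integrableD measurableT (initial_moment 1) clock_workload_sq_integrable).
apply: (le_integrable _ _ _ iS) => //; first by apply/measurable_EFinP; exact: measurable_funM.
move=> w _; rewrite -EFinD /= lee_fin.
rewrite [leRHS]ger0_norm ?addr_ge0 ?sqr_ge0//.
move: (Q w) (W w) => a b; rewrite normrM -(real_normK (num_real a)) -(real_normK (num_real b)).
move: `|a| `|b| (normr_ge0 a) (normr_ge0 b) => x y x0 y0.
have := sqr_ge0 (x - y); rewrite !expr2; nra.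
Qed.

Lemma initial_excess_split w : Q w * excess w = Q w * W w - Q w * Y w - Q w ^+ 2.
Proof. by rewrite clock_workload_split -/(excess w) expr2; ring. Qed.

Lemma initial_clock_pos_integrable : P.-integrable setT (EFin \o (fun w => Q w * Y w)).
Proof.
apply: chain_integrable; first exact: measurable_funM.
by move=> i; case: (initial_clock_pos i).
Qed.

Lemma initial_excess_integrable : P.-integrable setT (EFin \o (fun w => Q w * excess w)).
Proof.
rewrite (_ : _ \o _ = (fun w => (Q w * W w)%:E - (Q w * Y w)%:E - (Q w ^+ 2)%:E)%E).
  apply: integrableB => //; last exact: (initial_moment 1).
  exact: (integrableB measurableT initial_workload_integrable initial_clock_pos_integrable).
by apply/funext => w /=; rewrite initial_excess_split.
Qed.

Local Notation F i := (mixture_gamma (zeta i) eta).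
Local Notation h i := (hitting_lst J X i theta).

Lemma mixture_gamma0 i : F i 0 = 0.
Proof.
rewrite /mixture_gamma big1// => j _; rewrite /gamma_kernel !mulr0 oppr0 addr0 mul1r.
have -> : cexp 0 = 1 :> R[i] by rewrite /cexp /= expR0 cos0 sin0 mulr1 mulr0.
by rewrite subrr mul0r mulr0.
Qed.

Let truncated i (y : R) : 0 <= y ->
  (\int[P]_(w in Ji i) (Q w * \1_(`]-oo, y]) (Q0 w))%:E = (Re (F i y))%:E)%E.
Proof.
rewrite le_eqVlt => /predU1P[<-|y0].
  rewrite mixture_gamma0 integral0_eq// => w _; rewrite indicE.
  have [h0|h0] := leP (Q0 w) 0; first by rewrite /pos_part max_r// mul0r.
  by rewrite memNset ?mulr0//= in_itv/= => h1; move: h0; rewrite ltNge h1.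
exact: (mixture_truncated_mean (mJ i) mQ0 eta0 (law i) y0).
Qed.

Let F_ge0 i y : 0 <= y -> 0 <= Re (F i y).
Proof.
move=> y0; rewrite -lee_fin -truncated//; apply: integral_ge0 => w _.
by rewrite lee_fin mulr_ge0.
Qed.

(** At a fixed level y the layer factors into a function of the initial
workload, whose mean is known, and a function of the path and the clock. *)
Lemma excess_layer i b (y : R) : 0 <= y ->
  (P (Ji i) * \int[P]_(w in Ji i) (Q w * \1_(gap_itv b (Q w) (I w)) y)%:E =
   (Re (F i y))%:E * P (Ji i `&` [set w | deeper b y (I w)]))%E.
Proof.
move=> y0.
pose f (x : R) : R := pos_part x * \1_(`]-oo, y]) x.
have mf : measurable_fun setT f.
  by apply: measurable_funM => //; apply: measurable_indic; exact: measurable_itv.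
have f0 x : 0 <= f x by rewrite mulr_ge0.
pose D : set (R * TM) := [set z | deeper b y (depth X z.1 z.2)].
have mD : measurable D by exact: (deep_set_measurable HM b y).
pose Phi (z : R * TM) : R := \1_D z.
have mPhi : measurable_fun setT Phi by exact: measurable_indic.
have := cond_indep HM HS HT i mf f0 mPhi (fun z => ltac:(by [])).
rewrite truncated//.
have -> : (\int[P]_(w in Ji i) (Phi (T w, w))%:E = P (Ji i `&` [set w | deeper b y (I w)]))%E.
  have mE : measurable [set w | deeper b y (I w)].
    have := clock_measurable mPhi measurableT (measurable_set1 1); rewrite setTI.
    congr (measurable _); apply/seteqP; split => w; rewrite /Phi /= indicE.
      case: (boolP ((T w, w) \in D)) => [|_ /eqP]; first by rewrite inE.
      by rewrite eq_sym oner_eq0.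
    by move=> hd; rewrite mem_set.
  by rewrite setIC -integral_indic.
move=> <-; congr (_ * _)%E; apply: eq_integral => w _; congr (_%:E).
rewrite /f -mulrA; congr (_ * _).
rewrite /Phi !indicE -natrM mulnb; congr (nat_of_bool _)%:R.
(* As y >= 0, the negative values of Q0 do not matter. *)
have qy : (Q w <= y) = (Q0 w <= y) by rewrite /pos_part ge_max y0 andbT.
apply/idP/andP.
  by rewrite !inE gap_itvE qy => /andP[h1 hd]; split => //=.
by rewrite !inE gap_itvE qy => -[]; rewrite /= in_itv/= => ->.
Qed.

Let excess_layer_bounds i (y : R) : 0 <= y -> 0 < c i ->
  (\int[P]_(w in Ji i) (Q w * \1_(gap_itv true (Q w) (I w)) y)%:E <= (Re (F i y) * h i y)%:E)%E /\
  ((Re (F i y) * h i y)%:E <= \int[P]_(w in Ji i) (Q w * \1_(gap_itv false (Q w) (I w)) y)%:E)%E.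
Proof.
move=> y0 ci0.
have E1 := excess_layer i true y0; have E2 := excess_layer i false y0.
have [s1 s2] := discount_mass_sandwich HM HT theta0 i y.
have Em := hitting_lst_mass HM theta0 i y.
have fc : P (Ji i) \is a fin_num by rewrite fin_num_measure.
have Pc : (0 < P (Ji i))%E by rewrite cE lte_fin.
have F0 : (0 <= (Re (F i y))%:E)%E by rewrite lee_fin F_ge0.
have EF : (P (Ji i) * (Re (F i y) * h i y)%:E = (Re (F i y))%:E * discount_mass J X theta i y)%E.
  by rewrite -Em EFinM muleCA.
split; rewrite -(lee_pmul2l fc Pc) EF ?E1 ?E2; exact: lee_wpmul2l.
Qed.

(** The layer cake formula with the open and with the closed comparison
encloses the integral with the Laplace transform of the hitting time from both
sides. *)
Lemma excess_integral i :
  (\int[P]_(w in Ji i) (Q w * excess w)%:E =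
   \int[mu]_(y in `[0%R, +oo[) (Re (F i y) * h i y)%:E)%E.
Proof.
(* Conditional means given a null event are 0, as division by 0 gives 0. *)
have [ci0|ci0] := eqVneq (c i) 0.
  have P0 : P (Ji i) = 0%E by rewrite cE ci0.
  rewrite null_integral//; last exact: measurable_funM.
  rewrite integral0_eq// => y _.
  by rewrite /hitting_lst /cond_mean -/(Ji i) P0 /= invr0 !mulr0.
have cpos : 0 < c i by rewrite lt0r ci0 c0.
have L1 := layer_cake P true (mJ i) mQ (fun w => pos0 _) mQ (fun w => pos0 _) mI.
have L2 := layer_cake P false (mJ i) mQ (fun w => pos0 _) mQ (fun w => pos0 _) mI.
apply/eqP; rewrite eq_le; apply/andP; split.
  rewrite [leLHS]L1; apply: ge0_le_integralN => y; rewrite /= in_itv/= andbT => y0.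
    by apply: integral_ge0 => w _; rewrite lee_fin mulr_ge0.
  by case: (excess_layer_bounds y0 cpos).
rewrite [leRHS]L2; apply: ge0_le_integralN => y; rewrite /= in_itv/= andbT => y0.
  rewrite lee_fin mulr_ge0// ?F_ge0//.
  by case/andP: (hitting_lst_bounds HM theta0 i y).
by case: (excess_layer_bounds y0 cpos).
Qed.

(** Its integral over the levels is at most that of P (y <= depth), which is
the mean depth. *)
Lemma hitting_lst_integrable i : mu.-integrable `[0, +oo[ (EFin \o h i).
Proof.
have mh := hitting_lst_measurable HM theta0 i.
have h0 y : 0 <= h i y by case/andP: (hitting_lst_bounds HM theta0 i y).
have mhD : measurable_fun (`[0, +oo[%classic : set R) (EFin \o h i).
  by apply/measurable_EFinP; exact: measurable_funTS.
have [ci0|ci0] := eqVneq (c i) 0.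
  have P0 : P (Ji i) = 0%E by rewrite cE ci0.
  rewrite (_ : _ \o _ = cst 0%E); first exact: integrable0.
  by apply/funext => y; rewrite /= /hitting_lst /cond_mean -/(Ji i) P0 /= invr0 mulr0.
apply/integrableP; split => //.
under eq_integral do rewrite /= ger0_norm//.
have cpos : 0 < c i by rewrite lt0r ci0 c0.
have : (P (Ji i) * \int[mu]_(y in `[0%R, +oo[) (h i y)%:E < +oo)%E.
  rewrite -ge0_integralZl//; last by move=> y _; rewrite lee_fin.
  have m1 : measurable_fun setT (fun _ : Omega => 1 : R) by exact: measurable_cst.
  have m0 : measurable_fun setT (fun _ : Omega => 0 : R) by exact: measurable_cst.
  have := layer_cake P false (mJ i) m1 (fun w => ler01) m0 (fun w => lexx 0) mI.
  have iI := integrableS measurableT (mJ i) (@subsetT _ _) clock_depth_integrable.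
  move=> E; apply: (@le_lt_trans _ _ (\int[P]_(w in Ji i) (I w)%:E)%E).
    rewrite [leRHS](_ : _ = \int[P]_(w in Ji i) (1 * Num.max (I w - 0) 0)%:E)%E; last first.
      by apply: eq_integral => w _; rewrite mul1r subr0 max_l.
    rewrite E; apply: ge0_le_integralN => y; rewrite /= in_itv/= andbT => y0.
      by rewrite mule_ge0// lee_fin.
    rewrite (hitting_lst_mass HM theta0); have [_ s2] := discount_mass_sandwich HM HT theta0 i y.
    apply: le_trans s2 _.
    have mE : measurable [set w | deeper false y (I w)].
      have := measurable_set_ler (measurable_cst y) mI; exact.
    rewrite setIC -integral_indic//; apply: ge0_le_integralN => w _; first by rewrite lee_fin.
    rewrite lee_fin mul1r !indicE; case: (boolP (w \in _)) => //; rewrite inE/= => hd.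
    by rewrite mem_set// gap_itvE y0.
  by case/integrableP: iI => _; under eq_integral do rewrite /= ger0_norm//.
move: (\int[mu]_(y in `[0%R, +oo[) (h i y)%:E)%E => x; rewrite cE.
by case: x => [r _||]//; rewrite ?ltry// gt0_muley.
Qed.

(** Linear combination over j of the transforms gives the integral of the
truncated mean against the Laplace transform of the hitting time, which is the
mean excess term. *)
Lemma Omega_bar_combination i :
  \sum_j zeta i j / eta j ^+ 2 *
    (Omega_bar J X theta i 0 - Omega_bar J X theta i (eta j)
     + eta j * Omega_bar' J X theta i (eta j)) =
  (\int[P]_(w in Ji i) (Q w * excess w))%:C.
Proof.
have mh := hitting_lst_measurable HM theta0 i.
have h01 y := hitting_lst_bounds HM theta0 i y.
have ih := hitting_lst_integrable i.
have OE e : Omega_bar J X theta i e = laplace (h i) e by [].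
have OE' j : Omega_bar' J X theta i (eta j) = laplace_deriv (h i) (eta j).
  by rewrite -(derive1_laplace mh h01 (eta0 j)).
have mD : measurable (`[0, +oo[%classic : set R) by exact: measurable_itv.
have H j := laplace_combination mh h01 ih (zeta i j) (eta0 j).
transitivity (\sum_j cintegral `[0%R, +oo[
    (fun y => zeta i j * gamma_kernel (eta j) y * (h i y)%:C)).
  by apply: eq_bigr => j _; rewrite !OE OE'; case: (H j).
have [_ <-] := cintegral_sum mD (index_enum 'I_d) (fun j => (H j).1).
apply: complex_eq => /=.
  rewrite [RHS]/Rintegral excess_integral; congr fine.
  apply: eq_integral => y; rewrite inE/= in_itv/= andbT => y0.
  by rewrite -mulr_suml cReM /= mulr0 subr0.
rewrite (@eq_Rintegral _ _ _ mu _ (cst 0)); first by rewrite Rintegral_cst//= mul0r.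
move=> y; rewrite inE/= in_itv/= andbT le_eqVlt => /predU1P[<-|y0].
  by rewrite -mulr_suml -/(mixture_gamma (zeta i) eta 0) mixture_gamma0 mul0r.
by rewrite -mulr_suml cImM /= mulr0 add0r (mixture_gamma_real eta0 (law i) y0) mul0r.
Qed.


Lemma weighted_laplace0 (D : set Omega) (V f : Omega -> R) :
  weighted_laplace P D V f 0 = \int[P]_(w in D) f w.
Proof. by apply: eq_Rintegral => w _; rewrite oppr0 mul0r expR0 mulr1. Qed.

Let wl D (f : Omega -> R) := weighted_laplace P D (fun w => Q w) f.

Let laplace_deriv1 D (x : R) : measurable D -> 0 <= x ->
  deriv_ge0 (wl D (cst 1)) x = wl D (fun w => - (1 * Q w)) x.
Proof.
move=> mD x0.
have iD k : P.-integrable D (EFin \o (fun w => Q w ^+ k.+1)).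
  exact: integrableS measurableT mD (@subsetT _ _) (initial_moment k).
apply: (deriv_ge0_weighted_laplace mD mQ (fun w => pos0 _)) => //.
- exact: finite_measure_integrable_cst.
- by have := iD 0; apply: eq_integrable => // w _ /=; rewrite mul1r.
- by have := iD 1; apply: eq_integrable => // w _ /=; rewrite mul1r.
Qed.

Lemma kappaE a : kappa Q0 a = wl setT (cst 1) a.
Proof.
rewrite /kappa unlock /wl /weighted_laplace /Rintegral; congr fine.
have mexp (V : Omega -> R) : measurable_fun setT V ->
    measurable_fun setT (fun w => expR (- a * V w)).
  by move=> mV; apply: measurableT_comp => //; exact: measurable_funM.
apply: ae_eq_integral => //.
- by apply/measurable_EFinP; exact: mexp.
- by apply/measurable_EFinP; apply: measurable_funM => //; exact: mexp.
- by apply: filterS Q0E => w e _; rewrite -e mul1r.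
Qed.

Lemma kappa_atE i a : kappa_at J Q0 i a = wl (Ji i) (cst 1) a.
Proof.
rewrite /kappa_at /wl /weighted_laplace /Rintegral; congr fine.
have mexp (V : Omega -> R) : measurable_fun setT V ->
    measurable_fun setT (fun w => expR (- a * V w)).
  by move=> mV; apply: measurableT_comp => //; exact: measurable_funM.
apply: ae_eq_integral => //.
- by apply/measurable_EFinP; apply: measurable_funTS; exact: mexp.
- by apply/measurable_EFinP; apply: measurable_funTS; apply: measurable_funM => //; exact: mexp.
- by apply: filterS Q0E => w e _; rewrite -e mul1r.
Qed.

Lemma kappa_at_deriv i : deriv_ge0 (kappa_at J Q0 i) 0 = - \int[P]_(w in Ji i) Q w.
Proof.
rewrite (@deriv_ge0_eq _ _ (wl (Ji i) (cst 1)))//; last by move=> y _; exact: kappa_atE.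
rewrite laplace_deriv1// /wl weighted_laplace0 -mulN1r -RintegralZl//.
by apply: eq_Rintegral => w _; rewrite mul1r mulN1r.
Qed.

Let kappa_deriv_at x : 0 <= x -> deriv_ge0 (kappa Q0) x = wl setT (fun w => - (1 * Q w)) x.
Proof.
move=> x0; rewrite (@deriv_ge0_eq _ _ (wl setT (cst 1)))//; last by move=> y _; exact: kappaE.
exact: laplace_deriv1.
Qed.

Lemma kappa_deriv : deriv_ge0 (kappa Q0) 0 = - \int[P]_w Q w.
Proof.
rewrite kappa_deriv_at// /wl weighted_laplace0 -mulN1r -RintegralZl//.
by apply: eq_Rintegral => w _; rewrite mul1r mulN1r.
Qed.

(** The first derivative is used at all points of the half-line, since it is
differentiated again. *)
Lemma kappa_deriv2 : deriv_ge0 (deriv_ge0 (kappa Q0)) 0 = \int[P]_w (Q w ^+ 2).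
Proof.
rewrite (deriv_ge0_eq (lexx 0) kappa_deriv_at).
have iN k : P.-integrable setT (EFin \o (fun w => - Q w ^+ k.+1)).
  rewrite (_ : _ \o _ = (fun w => - (Q w ^+ k.+1)%:E)%E)//.
  exact: integrableN (initial_moment k).
rewrite /wl deriv_ge0_weighted_laplace//.
- by rewrite weighted_laplace0; apply: eq_Rintegral => w _; rewrite mul1r mulNr opprK expr2.
- by apply: measurableT_comp => //; exact: measurable_funM.
- by have := iN 0; apply: eq_integrable => // w _ /=; rewrite mul1r.
- by have := iN 1; apply: eq_integrable => // w _ /=; rewrite mul1r mulNr expr2.
- by have := iN 2; apply: eq_integrable => // w _ /=; rewrite mul1r mulNr -exprS.
Qed.

Lemma Q0_integrable (g : Omega -> R) : measurable_fun setT g ->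
  P.-integrable setT (EFin \o (fun w => Q w * g w)) ->
  P.-integrable setT (EFin \o (fun w => Q0 w * g w)).
Proof.
move=> mg /integrableP[_ fin]; have mQ0g : measurable_fun setT (fun w => Q0 w * g w).
  exact: measurable_funM.
apply/integrableP; split; first by apply/measurable_EFinP.
apply: le_lt_trans fin; rewrite le_eqVlt; apply/orP; left; apply/eqP.
apply: ae_eq_integral => //.
- by apply: measurableT_comp => //; apply/measurable_EFinP.
- by apply: measurableT_comp => //; apply/measurable_EFinP; exact: measurable_funM.
- by apply: filterS Q0E => w e _ /=; rewrite -e.
Qed.

(** Sum the reflection formula times Q over the initial states. *)
Lemma product_mean :
  \int[P]_w (Q w * W w) =
  \sum_i \int[P]_(w in Ji i) Q w * nu J X T i + \int[P]_w (Q w ^+ 2) +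
  \sum_i \int[P]_(w in Ji i) (Q w * excess w).
Proof.
have mQY : measurable_fun setT (fun w => Q w * Y w) by exact: measurable_funM.
have mQE : measurable_fun setT (fun w => Q w * excess w) by exact: measurable_funM.
have chain (f : Omega -> R) : measurable_fun setT f -> P.-integrable setT (EFin \o f) ->
    \int[P]_w f w = \sum_i \int[P]_(w in Ji i) f w.
  move=> mf fi; apply: EFin_inj; rewrite -sumEFin /Rintegral fineK; last exact: integrable_fin_num.
  rewrite chain_integral//; apply: eq_bigr => i _; rewrite fineK//.
  by apply: integrable_fin_num => //; exact: integrableS measurableT (mJ i) (@subsetT _ _) fi.
have iQY := initial_clock_pos_integrable.
have iQE := initial_excess_integrable.
have iQ2 := initial_moment 1.
have iS : P.-integrable setT (EFin \o (fun w => Q w * Y w + Q w ^+ 2)).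
  rewrite (_ : _ \o _ = (fun w => (Q w * Y w)%:E + (Q w ^+ 2)%:E)%E)//.
  exact: (integrableD measurableT iQY iQ2).
transitivity (\int[P]_w (Q w * Y w + Q w ^+ 2 + Q w * excess w)).
  by apply: eq_Rintegral => w _; rewrite initial_excess_split; ring.
rewrite (RintegralD measurableT iS iQE) (RintegralD measurableT iQY iQ2).
rewrite (chain _ mQY iQY) (chain _ mQE iQE); congr (_ + _ + _).
by apply: eq_bigr => i _; exact: initial_clock_pos_nu.
Qed.

(** Q_T has the mean of Q0, and Q0 and Q coincide almost surely. *)
Lemma covariance_formula :
  let gamma := covariance P Q0 W in
  gamma \is a fin_num /\
  fine gamma = \int[P]_w (Q w ^+ 2) - (\int[P]_w Q w) ^+ 2
    + \sum_i \int[P]_(w in Ji i) (Q w * excess w)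
    + \sum_i \int[P]_(w in Ji i) Q w * nu J X T i.
Proof.
have iQ0 : P.-integrable setT (EFin \o Q0).
  have h : P.-integrable setT (EFin \o (fun w => Q0 w * 1)).
    apply: (Q0_integrable (g := cst 1)) => //.
    by have := iQ; apply: eq_integrable => // w _ /=; rewrite mulr1.
  by move: h; apply: eq_integrable => // w _ /=; rewrite mulr1.
have iQW := Q0_integrable mW initial_workload_integrable.
have E := @covarianceE _ _ _ P Q0 W.
have -> : covariance P Q0 W = ((\int[P]_w (Q w * W w))%:E - ((\int[P]_w Q w) ^+ 2)%:E)%E.
  rewrite E; first last.
  - by apply/Lfun1_integrable.
  - by apply/Lfun1_integrable; exact: clock_workload_integrable.
  - by apply/Lfun1_integrable.
  rewrite unlock; congr (_ - _)%E.
    rewrite /Rintegral fineK; last by apply: integrable_fin_num => //; exact: initial_workload_integrable.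
    apply: ae_eq_integral => //.
    - by apply/measurable_EFinP; exact: measurable_funM.
    - by apply/measurable_EFinP; exact: measurable_funM.
    - by apply: filterS Q0E => w e _ /=; rewrite -e.
  have -> : (\int[P]_w (W w)%:E = (\int[P]_w Q w)%:E)%E.
    by rewrite clock_workload_mean /Rintegral fineK//; exact: integrable_fin_num.
  have -> : (\int[P]_w (Q0 w)%:E = (\int[P]_w Q w)%:E)%E.
    rewrite /Rintegral fineK; last exact: integrable_fin_num.
    apply: ae_eq_integral => //; try exact/measurable_EFinP.
    by apply: filterS Q0E => w e _; rewrite -e.
  by rewrite -EFinM expr2.
split=> //=; rewrite product_mean.
have alg (a b x y : R) : a + x + b - y = x - y + b + a by ring.
exact: alg.
Qed.

End Assembly.

Theorem theorem4 (R : realType) (disp : measure_display)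
    (Omega : measurableType disp) (P : probability Omega R)
    (d : nat) (q : 'M[R]_d) (pi : 'rV[R]_d)
    (L : 'I_d -> R -> {RV P >-> R}) (U : 'I_d -> 'I_d -> nat -> {RV P >-> R})
    (J : R -> Omega -> 'I_d) (X : R -> {RV P >-> R}) (Q0 : {RV P >-> R})
    (zeta : 'M[R[i]]_d) (eta : 'I_d -> R[i]) (theta : R) (T : {RV P >-> R}) :
  markov_additive q L U J X ->
  spectrally_negative L U ->
  finite_means L U ->
  stationary_distr q pi ->
  mean_drift q L U pi < 0 ->
  stationary_workload J X Q0 ->
  (forall j, 0 < complex.Re (eta j)) ->
  (forall (i : 'I_d) (B : set R), measurable B -> B `<=` `]0, +oo[ ->
     (fine (P [set w | B (Q0 w) /\ J 0 w = i]))%:C =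
     cintegral B (fun x => \sum_j zeta i j * cexp (- (eta j * x%:C)))) ->
  0 < theta ->
  exponential_clock J X Q0 theta T ->
  let gamma := covariance P Q0 (fun w => workload X Q0 (T w) w) in
  gamma \is a fin_num /\
  (fine gamma)%:C =
    (deriv_ge0 (deriv_ge0 (kappa Q0)) 0)%:C - (deriv_ge0 (kappa Q0) 0)%:C ^+ 2
    + \sum_i \sum_j zeta i j / eta j ^+ 2 *
        (Omega_bar J X theta i 0 - Omega_bar J X theta i (eta j)
         + eta j * Omega_bar' J X theta i (eta j))
    - \sum_i (nu J X T i * deriv_ge0 (kappa_at J Q0 i) 0)%:C.
Proof.
move=> HM _ Hfin _ _ HS eta0 Hdens theta0 HT gamma.
have [gfin gE] := covariance_formula HM Hfin HS HT theta0 eta0 Hdens.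
split; first exact: gfin.
rewrite [fine gamma]gE.
rewrite (kappa_deriv2 HM HS eta0 Hdens) (kappa_deriv HM HS eta0 Hdens).
under [X in _ + X - _]eq_bigr => i _ do
  rewrite (Omega_bar_combination HM Hfin HS HT theta0 eta0 Hdens).
under [X in _ - X]eq_bigr => i _ do rewrite (kappa_at_deriv HM HS eta0 Hdens).
rewrite -!rmorph_sum -rmorphXn -!rmorphB -rmorphD -rmorphB; congr (_%:C).
rewrite sqrrN; congr (_ + _); rewrite -sumrN; apply: eq_bigr => i _.
by rewrite mulrN opprK mulrC.
Qed.
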